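(* Let $a$ be weakly degenerate at $x_0\in[0,1]$. Then the operator $(A_2,D(A_2))$, $A_2u:=au''''$, is self-adjoint and non negative on $L^2_{\frac1a}(0,1)$ with dense domain. Hence $-A_2$ generates a contractive analytic semigroup of angle $\frac{\pi}{2}$ on $L^2_{\frac1a}(0,1)$.
   Context: Function spaces are real (for the analytic semigroup statement, pass to the complexification). A function $a:[0,1]\to[0,\infty)$ is weakly degenerate at $x_0\in[0,1]$ if $a(x_0)=0$, $a>0$ on $[0,1]\setminus\{x_0\}$, $a\in\mathcal C[0,1]\cap\mathcal C^1([0,1]\setminus\{x_0\})$ and $\frac1a\in L^1(0,1)$. $L^2_{\frac1a}(0,1):=\{u\in L^2(0,1):\int_0^1\frac{u^2}{a}\,dx<+\infty\}$ is a Hilbert space with inner product $\langle u,v\rangle_{L^2_{\frac1a}(0,1)}=\int_0^1\frac{uv}{a}\,dx$, and $H^2_{\frac1a}(0,1):=L^2_{\frac1a}(0,1)\cap H^2(0,1)$. $\mathcal W(0,1):=\{u\in H^2_{\frac1a}(0,1): au''''\in L^2_{\frac1a}(0,1)\}$, where $u''''$ is the distributional fourth derivative of $u$ on the whole of $(0,1)$, required to be a locally integrable function. Every $u\in\mathcal W(0,1)$ belongs to $W^{4,1}(0,1)\subset\mathcal C^3[0,1]$, so the following boundary values make sense: $$D(A_2):=\{u\in\mathcal W(0,1): u''(0)=u''(1)=u'''(0)=u'''(1)=0\}$$ (the same domain for every $x_0\in[0,1]$). *)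

(* Defs.v *)
From HB Require Import structures.
From mathcomp Require Import all_boot all_order all_algebra.
From mathcomp Require Import generic_quotient ring_quotient complex ring lra.
From mathcomp Require Import all_classical all_reals all_analysis.
From mathcomp Require Import measurable_realfun.

Set Implicit Arguments.
Unset Strict Implicit.
Unset Printing Implicit Defensive.
Import Order.TTheory GRing.Theory Num.Theory.
Import numFieldNormedType.Exports.

Local Open Scope classical_set_scope.
Local Open Scope ring_scope.

(* Functions on (0,1) are functions R -> R of which only the restriction to
   (0,1) is used. *)

Notation I01 := (`]0%R, 1%R[%classic : set (Real.sort _)) (only parsing).

(* C^1 regularity on S = [0,1] \ {x0}: the difference quotients are taken
   within S, so that derivatives at 0 and 1 are one-sided. *)
Definition weakly_degenerate {R : realType} (a : R -> R) (x0 : R) : Prop :=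
  let S := `[0, 1] `\ x0 in
  [/\ x0 \in `[0, 1],
      a x0 = 0 /\ (forall x, S x -> 0 < a x),
      {within `[0, 1], continuous a},
      exists a' : R -> R, {within S, continuous a'} /\
        forall x, S x ->
          (a y - a x) / (y - x) @[y --> within S (dnbhs x)] --> a' x
    & lebesgue_measure.-integrable I01 (EFin \o (fun x => (a x)^-1))].

Section L2.
Context {R : realType}.
Local Notation mu := (@lebesgue_measure R).

(* Being integrable includes measurability; for a measurable nonnegative
   weight w it says that the integral of w u^2 is finite. *)
Definition sq_integrable (w u : R -> R) : Prop :=
  measurable_fun I01 u /\
  mu.-integrable I01 (EFin \o (fun x => u x ^+ 2 * w x)).

Definition in_L2 (u : R -> R) : Prop := sq_integrable (cst 1) u.

Definition in_L2w (a u : R -> R) : Prop :=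
  in_L2 u /\ sq_integrable (fun x => (a x)^-1) u.

Let ae_filter : Filter (nbhs (almost_everywhere mu)).
Proof. exact: (@ae_filter_ringOfSetsType _ _ _ mu). Qed.
#[local] Existing Instance ae_filter.

Lemma measurable_invr : measurable_fun [set: R] (fun x : R => x^-1).
Proof.
rewrite (_ : (fun _ => _) = (fun x : R => x * (`|x| `^ (-2)))).
  apply: measurable_funM => //.
  by apply: (measurableT_comp (measurable_powR _)); exact: normr_measurable.
apply/funext => x; have [->|x0] := eqVneq x 0; first by rewrite invr0 mul0r.
rewrite powRN -[2]/(2%:R) powR_mulrn// real_normK ?num_real//.
by rewrite expr2 invfM mulrA divff// mul1r.
Qed.

Lemma sq_integrableM w u v : sq_integrable w u -> sq_integrable w v ->
  mu.-integrable I01 (EFin \o (fun x => u x * v x * w x)).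
Proof.
move=> [mu_ iu] [mv iv].
pose n f : R -> \bar R := EFin \o (fun x : R => `|f x ^+ 2 * w x|).
apply: (@le_integrable _ _ R mu _ _ _ (n u \+ n v)%E).
- exact: measurable_itv.
- apply/measurable_EFinP.
  rewrite (_ : (fun _ => _) =
    (fun x => (u x ^+ 2 * w x) * (v x * (u x)^-1))); last first.
    apply/funext => x; have [->|ux0] := eqVneq (u x) 0.
      by rewrite expr0n/= !mul0r.
    transitivity ((u x / u x) * (u x * v x * w x)); last by ring.
    by rewrite divff// mul1r.
  apply: measurable_funM.
    by case/integrableP : iu => /measurable_EFinP.
  apply: measurable_funM => //.
  exact: (measurableT_comp measurable_invr).
- move=> x _ /=; rewrite lee_fin [leRHS]ger0_norm ?addr_ge0// !normrM.
  rewrite -mulrDl ler_wpM2r// ?(normrX, normrM).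
  have := sqr_ge0 (`|u x| - `|v x|); have := sqr_ge0 `|u x|.
  have := sqr_ge0 `|v x|; nra.
- have nE f : n f = (abse \o (EFin \o (fun x => f x ^+ 2 * w x)%R))%E by [].
  rewrite !nE; apply: integrableD; first exact: measurable_itv.
    exact: integrable_abse.
  exact: integrable_abse.
Qed.

Lemma sq_integrable0 w : sq_integrable w (fun=> 0).
Proof.
split; first exact: measurable_cst.
rewrite (_ : _ \o _ = cst 0%E); first exact: integrable0.
by apply/funext => x /=; rewrite expr0n mul0r.
Qed.

Lemma sq_integrable_lin w (c : R) u v :
  sq_integrable w u -> sq_integrable w v ->
  sq_integrable w (fun x => c * u x + v x).
Proof.
move=> Lu Lv; have iuv := sq_integrableM Lu Lv; case: Lu Lv => mu_ iu [mv iv].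
split.
  by apply: measurable_funD => //; apply: measurable_funM.
pose n (f : R -> R) : R -> \bar R := EFin \o f.
rewrite (_ : _ \o _ =
    (fun x => (c ^+ 2)%:E * n (fun x => u x ^+ 2 * w x)%R x) \+
    ((fun x => (c *+ 2)%:E * n (fun x => u x * v x * w x)%R x) \+
    n (fun x => v x ^+ 2 * w x)%R))%E; last first.
  by apply/funext => x /=; rewrite -!EFinM -!EFinD; congr EFin; ring.
by do ?[apply: integrableD => //]; apply: integrableZl.
Qed.

Lemma in_L2w0 a : in_L2w a (fun=> 0).
Proof. by split; exact: sq_integrable0. Qed.

Lemma in_L2w_lin a c u v : in_L2w a u -> in_L2w a v ->
  in_L2w a (fun x => c * u x + v x).
Proof. by move=> [? ?] [? ?]; split; exact: sq_integrable_lin. Qed.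

(* The functions of L^2_{1/a}(0,1), before identification of functions that
   agree almost everywhere. *)
Definition L2w_pred (a : R -> R) : {pred R -> R} := [pred u | `[< in_L2w a u >]].

Lemma L2w_submod_closed a : submod_closed (L2w_pred a).
Proof.
split; first by apply/asboolP; exact: in_L2w0.
by move=> c u v /asboolP Lu /asboolP Lv; apply/asboolP; exact: in_L2w_lin.
Qed.

HB.instance Definition _ a :=
  GRing.isSubmodClosed.Build R (R -> R) (L2w_pred a) (L2w_submod_closed a).

Lemma L2w_oppr_closed a : oppr_closed (L2w_pred a).
Proof. by move=> u Pu; rewrite -scaleN1r; exact: rpredZ. Qed.

HB.instance Definition _ a :=
  GRing.isOppClosed.Build (R -> R) (L2w_pred a) (@L2w_oppr_closed a).

Record L2wfun (a : R -> R) :=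
  { L2wfun_val :> R -> R; L2wfunP : L2wfun_val \in L2w_pred a }.

HB.instance Definition _ a := [isSub for @L2wfun_val a].
HB.instance Definition _ a := [Choice of L2wfun a by <:].
HB.instance Definition _ a := [SubChoice_isSubLmodule of L2wfun a by <:].

Definition null_pred (a : R -> R) : {pred L2wfun a} :=
  [pred u : L2wfun a | `[< ae_eq mu I01 u (fun=> 0) >]].
Arguments null_pred : clear implicits.

Lemma null_submod_closed a : submod_closed (null_pred a).
Proof.
split; first by apply/asboolP; apply: aeW.
move=> c u v /asboolP u0 /asboolP v0; apply/asboolP.
move: u0 v0; apply: filterS2 => x u0 v0 Ix.
change (c * u x + v x = 0).
by rewrite u0// v0// mulr0 addr0.
Qed.

HB.instance Definition _ a := GRing.isSubmodClosed.Build R (L2wfun a)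
  (null_pred a) (null_submod_closed a).

Lemma null_oppr_closed a : oppr_closed (null_pred a).
Proof. by move=> u Pu; rewrite -scaleN1r; exact: rpredZ. Qed.

HB.instance Definition _ a :=
  GRing.isOppClosed.Build (L2wfun a) (null_pred a) (@null_oppr_closed a).

Section QuotientSpace.
Variable a : R -> R.
Local Open Scope quotient_scope.

(* L^2_{1/a}(0,1), functions being identified when they agree almost
   everywhere on (0,1); an element coerces to one of its representatives. *)
Definition L2w : Type := Quotient.quot (null_pred a).
HB.instance Definition _ := GRing.Zmodule.on L2w.
HB.instance Definition _ := EqQuotient.on L2w.

Definition L2w_repr (u : L2w) : R -> R := repr u.
Coercion L2w_repr : L2w >-> Funclass.

Definition L2w_scale (c : R) (u : L2w) : L2w := \pi_L2w (c *: repr u).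

Lemma eq_L2w_pi (u v : L2wfun a) :
  ae_eq mu I01 u v -> \pi_L2w u = \pi_L2w v.
Proof.
move=> uv; apply/eqP; rewrite -Quotient.idealrBE; apply/asboolP.
by move: uv; apply: filterS => x uv Ix; rewrite -[LHS]/(u x - v x) uv// subrr.
Qed.

Lemma L2w_pi_ae (u : L2wfun a) :
  ae_eq mu I01 (\pi_L2w u : L2w) u.
Proof.
have : \pi_L2w (repr (\pi_L2w u)) == \pi_L2w u by rewrite reprK.
rewrite -Quotient.idealrBE => /asboolP; apply: filterS => x h Ix.
by apply/eqP; rewrite -subr_eq0; apply/eqP; exact: h.
Qed.

Lemma eq_L2w (u v : L2w) :
  ae_eq mu I01 u v -> u = v.
Proof. by move=> uv; rewrite -[u]reprK -[v]reprK; exact: eq_L2w_pi. Qed.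

Lemma L2w_pi_scale c u : L2w_scale c (\pi_L2w u) = \pi_L2w (c *: u).
Proof.
apply: eq_L2w_pi; move: (L2w_pi_ae u); apply: filterS => x h Ix.
by rewrite -[LHS]/(c * (\pi_L2w u : L2w) x) -[RHS]/(c * u x) h.
Qed.

Lemma L2w_piD (u v : L2wfun a) : \pi_L2w (u + v) = \pi_L2w u + \pi_L2w v :> L2w.
Proof. exact: (Quotient.pi_add (null_pred a)). Qed.

Lemma L2w_scaleA c d u : L2w_scale c (L2w_scale d u) = L2w_scale (c * d) u.
Proof.
by rewrite -[u]reprK [L2w_scale d _]L2w_pi_scale !L2w_pi_scale scalerA.
Qed.

Lemma L2w_scale1 : left_id 1 L2w_scale.
Proof. by move=> u; rewrite /L2w_scale scale1r reprK. Qed.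

Lemma L2w_scaleDr : right_distributive L2w_scale +%R.
Proof.
move=> c u v; rewrite -[u]reprK -[v]reprK -L2w_piD.
by rewrite !L2w_pi_scale scalerDr L2w_piD.
Qed.

Lemma L2w_scaleDl u : {morph L2w_scale^~ u : c d / c + d}.
Proof.
by move=> c d; rewrite -[u]reprK !L2w_pi_scale scalerDl L2w_piD.
Qed.

HB.instance Definition _ := GRing.Zmodule_isLmodule.Build R L2w
  L2w_scaleA L2w_scale1 L2w_scaleDr L2w_scaleDl.

(* <u, v> = \int_0^1 u v / a *)
Definition L2w_dot (u v : L2w) : R :=
  \int[mu]_(x in I01) (u x * v x / a x).

End QuotientSpace.
End L2.

Arguments L2w {R} a.
Arguments L2w_dot {R} a u v.

Section Sobolev.
Context {R : realType}.
Local Notation mu := (@lebesgue_measure R).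

(* C_c^\infty(0,1) *)
Definition test_function (phi : R -> R) : Prop :=
  (forall n x, derivable (derive1n n phi) x 1) /\
  let supp := closure [set x | phi x != 0] in compact supp /\ supp `<=` I01.

Definition weak_derivative (k : nat) (u g : R -> R) : Prop :=
  [/\ locally_integrable I01 u, locally_integrable I01 g
    & forall phi, test_function phi ->
        \int[mu]_(x in I01) (u x * derive1n k phi x) =
        (-1) ^+ k * \int[mu]_(x in I01) (g x * phi x)].

Definition in_H2 (u : R -> R) : Prop :=
  [/\ in_L2 u,
      exists2 g, weak_derivative 1 u g & in_L2 g
    & exists2 g, weak_derivative 2 u g & in_L2 g].

Definition in_W (a u : R -> R) : Prop :=
  [/\ in_L2w a u, in_H2 u
    & exists2 g, weak_derivative 4 u g & in_L2w a (fun x => a x * g x)].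

(* The k-th derivative of u has value c at x in [0,1], computed on its
   representative continuous on [0,1]; there is at most one such
   representative, and one exists for k <= 3 when u is in W^{4,1}(0,1). *)
Definition has_boundary_value (k : nat) (u : R -> R) (x c : R) : Prop :=
  exists g : R -> R,
    [/\ {within `[0, 1], continuous g}, weak_derivative k u g & g x = c].

Definition D_A2 (a : R -> R) : set (L2w a) :=
  [set u | in_W a u /\
    [/\ has_boundary_value 2 u 0 0, has_boundary_value 2 u 1 0,
        has_boundary_value 3 u 0 0 & has_boundary_value 3 u 1 0]].

End Sobolev.

Arguments D_A2 {R} a.

(* A possibly unbounded operator is given by its graph: A u f means that u is
   in the domain of A and A u = f. *)
Definition operator (H : Type) := H -> H -> Prop.

Definition dom (H : Type) (A : operator H) : set H :=
  [set u | exists f, A u f].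

Definition opp_operator (H : zmodType) (A : operator H) : operator H :=
  fun u f => A u (- f).

Definition linear_operator (K : pzRingType) (H : lmodType K)
    (A : operator H) : Prop :=
  [/\ forall u f g, A u f -> A u g -> f = g,
      A 0 0
    & forall c u v f g, A u f -> A v g -> A (c *: u + v) (c *: f + g)].

Section RealOperators.
Context {R : realType} {H : lmodType R}.
Variable dot : H -> H -> R.

Definition hnorm (u : H) : R := Num.sqrt (dot u u).

Definition dense_subset (D : set H) : Prop :=
  forall u eps, 0 < eps -> exists2 v, D v & hnorm (u - v) < eps.

(* The graph of the adjoint A* of a densely defined operator A. *)
Definition adjoint (A : operator H) : operator H :=
  fun v w => forall u f, A u f -> dot f v = dot u w.

Definition self_adjoint (A : operator H) : Prop :=
  forall v w, A v w <-> adjoint A v w.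

Definition nonnegative_operator (A : operator H) : Prop :=
  forall u f, A u f -> 0 <= dot f u.

End RealOperators.

(* The complexification of a real vector space: (u, v) stands for u + i v. *)
Definition complexification (H : Type) : Type := (H * H)%type.

Section Complexification.
Context {R : realType} {H : lmodType R}.
Local Notation HC := (complexification H).

HB.instance Definition _ := GRing.Zmodule.copy HC (H * H)%type.

Definition complexification_scale (z : R[i]) (x : HC) : HC :=
  (complex.Re z *: x.1 - complex.Im z *: x.2,
   complex.Re z *: x.2 + complex.Im z *: x.1).

Lemma complexification_scaleA z w x :
  complexification_scale z (complexification_scale w x) =
  complexification_scale (z * w) x.
Proof.
case: z w x => [a b] [c d] [u v]; congr pair => /=;
  rewrite ?(scalerDr, scalerDl, scalerN, scaleNr, scalerA, opprD) -!addrA;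
  by congr (_ + _); rewrite addrA addrC.
Qed.


Lemma complexification_scale1 : left_id 1 complexification_scale.
Proof.
by case=> u v; rewrite /complexification_scale /= !scale1r !scale0r subr0 addr0.
Qed.

Lemma complexification_scaleDr : right_distributive complexification_scale +%R.
Proof.
case=> a b [u v] [u' v']; congr pair => /=; rewrite !scalerDr ?opprD;
  exact: addrACA.
Qed.

Lemma complexification_scaleDl x :
  {morph complexification_scale^~ x : z w / z + w}.
Proof.
case: x => [u v] [a b] [c d]; congr pair => /=; rewrite !scalerDl ?opprD;
  exact: addrACA.
Qed.

HB.instance Definition _ := GRing.Zmodule_isLmodule.Build R[i] HC
  complexification_scaleA complexification_scale1
  complexification_scaleDr complexification_scaleDl.

Definition complexification_norm (dot : H -> H -> R) (x : HC) : R :=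
  Num.sqrt (dot x.1 x.1 + dot x.2 x.2).

Definition complexify_operator (A : operator H) : operator HC :=
  fun x y => A x.1 y.1 /\ A x.2 y.2.

End Complexification.

Section Semigroups.
Context {R : realType} {X : lmodType R[i]}.
Variable N : X -> R.
Local Notation normc := ComplexField.Normc.normc.

(* {z != 0 : |arg z| < theta} *)
Definition sector (theta : R) : set R[i] :=
  [set z | exists r phi : R, [/\ 0 < r, `|phi| < theta &
     z = Complex (r * cos phi) (r * sin phi)]].

Definition bounded_operator (L : X -> X) : Prop :=
  exists M : R, forall x, N (L x) <= M * N x.

(* Complex differentiability, in operator norm, at every point of S. *)
Definition analytic_on (S : set R[i]) (T : R[i] -> {linear X -> X}) : Prop :=
  forall z, S z -> exists2 T' : {linear X -> X}, bounded_operator T' &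
    forall eps : R, 0 < eps -> exists2 delta : R, 0 < delta &
      forall h, normc h < delta -> S (z + h) -> forall x,
        N (T (z + h) x - T z x - h *: T' x) <= eps * normc h * N x.

Definition analytic_semigroup (theta : R) (T : R[i] -> {linear X -> X}) : Prop :=
  [/\ forall z, sector theta z -> bounded_operator (T z),
      forall x, T 0 x = x,
      forall z w x, sector theta z -> sector theta w ->
        T (z + w) x = T z (T w x),
      analytic_on (sector theta) T
    & forall theta' x (eps : R), 0 < theta' < theta -> 0 < eps ->
        exists2 delta : R, 0 < delta &
          forall z, sector theta' z -> normc z < delta -> N (T z x - x) < eps].

Definition contractive_on (S : set R[i]) (T : R[i] -> {linear X -> X}) : Prop :=
  forall z x, S z -> N (T z x) <= N x.

Definition generator (T : R[i] -> {linear X -> X}) : operator X :=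
  fun x y =>
    N ((t^-1)%:C%C *: (T t%:C%C x - x) - y) @[t --> (0 : R)^'+] --> (0 : R).

Definition generates_contractive_analytic_semigroup
    (theta : R) (B : operator X) : Prop :=
  exists T : R[i] -> {linear X -> X},
    [/\ analytic_semigroup theta T, contractive_on (sector theta) T
      & forall x y, B x y <-> generator T x y].

End Semigroups.

(* A2 u = a u'''' *)
Definition A2 {R : realType} (a : R -> R) : operator (L2w a) :=
  fun u f => D_A2 a u /\
    exists2 g, weak_derivative 4 u g &
      ae_eq lebesgue_measure I01 f (fun x => a x * g x).

Arguments A2 {R} a u f.

Lemma dom_A2 (R : realType) (a : R -> R) : dom (A2 a) = D_A2 a.
Proof.
apply/seteqP; split=> [u [f [Du _]] //|u Du].
have [[_ _ [g wg Lg]] _] := Du.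
have Pg : (fun x => a x * g x) \in L2w_pred a by apply/asboolP.
exists (\pi_(L2w a)%qT (Build_L2wfun Pg)); split => //; exists g => //.
exact: L2w_pi_ae.
Qed.

(* Main.v *)
From HB Require Import structures.
Require Import Defs.
From mathcomp Require Import all_boot all_order all_algebra complex.
From mathcomp Require Import ring lra zify.
From mathcomp Require Import all_classical all_reals all_analysis measurable_realfun.

(** On the domain of A2, two integrations by parts give
    <A2 u, v> = \int_0^1 u'' v'', so A2 is symmetric and non negative.  If v is in
    the domain of the adjoint, testing with C_c^\infty functions shows that v'''' is
    weakly the integrable function A2* v / a, so that v has three absolutely
    continuous derivatives, and testing with polynomials of the domain shows that
    v'' and v''' vanish at 0 and 1.

    A non negative self-adjoint operator A has an everywhere defined resolvent
    L = (1 + A)^-1 with 0 <= L <= 1.  By the positivity of Bernstein coefficients,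
    p(L) is bounded by the supremum of |p| on [0,1], whence a continuous functional
    calculus for L.  The semigroup is exp(-zA) = f_z(L) with
    f_z(r) = exp(-z (1/r - 1)) and f_z(0) = 0, which is continuous on [0,1] and
    bounded by 1 for Re z > 0; estimates on f_z are estimates in operator norm. *)

Set Implicit Arguments.
Unset Strict Implicit.
Unset Printing Implicit Defensive.
Import Order.TTheory GRing.Theory Num.Theory.
Import numFieldNormedType.Exports.

Local Open Scope classical_set_scope.
Local Open Scope ring_scope.

(** * Hilbert spaces *)

Section Hilbert.
Context {R : realType} {H : lmodType R} (dot : H -> H -> R).
Local Notation hn := (hnorm dot).

(** Passing to L keeps the analysis to a bounded operator on a real space and to real functions on
    [0,1]; the complexification only enters by splitting a symbol into real and imaginary parts.
    Claims on the semigroup become scalar estimates uniform in r = 1/(1 + s), with s >= 0 in the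
    role of A: contractivity is |exp(-zs)| <= 1. Continuity of f_z at r = 0 is the decay of exp(-zs)
    at infinity; it fails for nonzero imaginary z, which is why the half plane, of angle pi/2,
    appears. Strong continuity at 0 and the limit defining the generator are not uniform in r, but
    become so after multiplication by r, that is on the range of L, which is the dense domain of A.

    The weight acts in two ways: a bounded puts L^2_{1/a} inside L^2, and 1/a integrable makes f/a
    integrable for every f in L^2_{1/a}. So u'''' = f/a is integrable across x0 and up to 0 and 1,
    wherever x0 lies. A function v of the adjoint domain has four unknown boundary values, hence
    four polynomials to test it with. *)

Record inner_product : Prop := InnerProduct {
  dotDZl : forall c u v w, dot (c *: u + v) w = c * dot u w + dot v w;
  dotC : forall u v, dot u v = dot v u;
  dot_ge0 : forall u, 0 <= dot u u;
  dot_eq0 : forall u, dot u u = 0 -> u = 0 }.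

Record hilbert : Prop := Hilbert {
  hilbert_inner_product :> inner_product;
  hcomplete : forall u_ : nat -> H,
    (forall eps : R, 0 < eps -> exists N, forall m n, (N <= m)%N -> (N <= n)%N ->
       hn (u_ m - u_ n) < eps) ->
    exists l, hn (u_ n - l) @[n --> \oo] --> 0 }.

Section InnerProduct.
Hypothesis hH : inner_product.

Lemma dot0l v : dot 0 v = 0.
Proof.
have := dotDZl hH (-1) 0 0 v.
by rewrite scaler0 addr0 mulN1r addNr.
Qed.

Lemma dotDl u v w : dot (u + v) w = dot u w + dot v w.
Proof. by rewrite -[u]scale1r dotDZl// mul1r scale1r. Qed.

Lemma dotZl c u w : dot (c *: u) w = c * dot u w.
Proof. by rewrite -[c *: u]addr0 dotDZl// dot0l addr0. Qed.

Lemma dotNl u w : dot (- u) w = - dot u w.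
Proof. by rewrite -scaleN1r dotZl mulN1r. Qed.

Lemma dotBl u v w : dot (u - v) w = dot u w - dot v w.
Proof. by rewrite dotDl dotNl. Qed.

Lemma dot0r v : dot v 0 = 0. Proof. by rewrite dotC// dot0l. Qed.

Lemma dotDr u v w : dot w (u + v) = dot w u + dot w v.
Proof. by rewrite !(dotC hH w) dotDl. Qed.

Lemma dotZr c u w : dot w (c *: u) = c * dot w u.
Proof. by rewrite !(dotC hH w) dotZl. Qed.

Lemma dotNr u w : dot w (- u) = - dot w u.
Proof. by rewrite !(dotC hH w) dotNl. Qed.

Lemma dotBr u v w : dot w (u - v) = dot w u - dot w v.
Proof. by rewrite !(dotC hH w) dotBl. Qed.

Definition dotE := (dotDl, dotDr, dotZl, dotZr, dotNl, dotNr, dot0l, dot0r).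

Lemma hnorm_ge0 u : 0 <= hn u. Proof. exact: sqrtr_ge0. Qed.

Lemma hnorm_sqr u : hn u ^+ 2 = dot u u.
Proof. by rewrite sqr_sqrtr// dot_ge0. Qed.

Lemma hnorm0 : hn 0 = 0. Proof. by rewrite /hnorm dot0l sqrtr0. Qed.

Lemma hnorm0_eq0 u : hn u = 0 -> u = 0.
Proof. by move=> u0; apply: (dot_eq0 hH); rewrite -hnorm_sqr u0 expr0n. Qed.

Lemma hnormZ c u : hn (c *: u) = `|c| * hn u.
Proof.
by rewrite /hnorm !dotE mulrA -expr2 sqrtrM ?sqr_ge0// sqrtr_sqr.
Qed.

Lemma hnormN u : hn (- u) = hn u.
Proof. by rewrite /hnorm !dotE opprK. Qed.

Lemma hnorm_le u c : 0 <= c -> dot u u <= c ^+ 2 -> hn u <= c.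
Proof. by move=> c0; rewrite -hnorm_sqr ler_sqr ?nnegrE// hnorm_ge0. Qed.


Lemma cauchy_schwarz_sqr u v : dot u v ^+ 2 <= dot u u * dot v v.
Proof.
have [v0|v0] := eqVneq (dot v v) 0.
  by rewrite (dot_eq0 hH v0) !dot0r expr0n mulr0.
have vv : 0 < dot v v by rewrite lt_neqAle eq_sym v0 dot_ge0.
(* This is dot v v times the component of u orthogonal to v; its square norm is dot v v (dot u u dot
   v v - (dot u v)^2). *)
have := dot_ge0 hH (dot v v *: u - dot u v *: v).
rewrite !dotE (dotC hH v u).
set x := dot v v in v0 vv *; set y := dot u v; set z := dot u u.
move=> h.
have : 0 <= x * (z * x - y ^+ 2) by move: h; nra.
by rewrite pmulr_rge0// subr_ge0.
Qed.

Lemma cauchy_schwarz u v : `|dot u v| <= hn u * hn v.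
Proof.
rewrite -[_ * _]ger0_norm ?mulr_ge0 ?hnorm_ge0// -ler_sqr ?nnegrE//.
rewrite !real_normK ?num_real// exprMn !hnorm_sqr; exact: cauchy_schwarz_sqr.
Qed.

Lemma dot_le u v : dot u v <= hn u * hn v.
Proof. exact: le_trans (ler_norm _) (cauchy_schwarz u v). Qed.

Lemma ler_hnormD u v : hn (u + v) <= hn u + hn v.
Proof.
apply: hnorm_le; first by rewrite addr_ge0 ?hnorm_ge0.
rewrite !dotE sqrrD !hnorm_sqr (dotC hH v u).
have := dot_le u v; rewrite mulr2n; nra.
Qed.

Lemma ler_hnormB u v : hn (u - v) <= hn u + hn v.
Proof. by rewrite -(hnormN v) ler_hnormD. Qed.

Lemma hdistC u v : hn (u - v) = hn (v - u).
Proof. by rewrite -hnormN opprB. Qed.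

Lemma ler_hdistD w u v : hn (u - v) <= hn (u - w) + hn (w - v).
Proof. by rewrite -(subrKA w u) ler_hnormD. Qed.

Lemma cvg_dot u_ u v : hn (u_ n - u) @[n --> \oo] --> 0 ->
  dot (u_ n) v @[n --> \oo] --> dot u v.
Proof.
move=> cu; apply/cvgrPdist_le => /= e e0.
have e1 : 0 < e / (hn v + 1) by rewrite divr_gt0// ltr_wpDl ?hnorm_ge0.
move/cvgrPdist_le : cu => /(_ _ e1); apply: filterS => n /=.
rewrite sub0r normrN ger0_norm ?hnorm_ge0// => h.
rewrite -dotBl (le_trans (cauchy_schwarz _ _))// hdistC.
apply: (@le_trans _ _ (e / (hn v + 1) * (hn v + 1))).
  by rewrite ler_pM ?hnorm_ge0// lerDl.
by rewrite divfK// gt_eqF// ltr_wpDl ?hnorm_ge0.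
Qed.

Lemma hcvg_cauchy u_ l : hn (u_ n - l) @[n --> \oo] --> 0 ->
  forall eps : R, 0 < eps -> exists N, forall m n, (N <= m)%N -> (N <= n)%N ->
    hn (u_ m - u_ n) < eps.
Proof.
move=> cu e e0.
have e2 : 0 < e / 2 by rewrite divr_gt0.
move/cvgrPdist_lt : cu => /(_ _ e2) [N _ hN]; exists N => m n Nm Nn.
have := hN m Nm; have := hN n Nn => /=.
rewrite !sub0r !normrN !(ger0_norm (hnorm_ge0 _)) => h1 h2.
rewrite (le_lt_trans (ler_hdistD l _ _))// (splitr e) ltrD//.
by rewrite hdistC.
Qed.

End InnerProduct.

Hypothesis hH : hilbert.

Let hI : inner_product := hH.

Definition subspace (V : set H) :=
  V 0 /\ forall c u v, V u -> V v -> V (c *: u + v).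

Lemma subspaceZ V c u : subspace V -> V u -> V (c *: u).
Proof. by case=> V0 sV Vu; rewrite -[_ *: _]addr0; exact: sV. Qed.

(* A minimizing sequence of dist(w, V) converges to the projection p of w on the
   closure of V, and w - p is orthogonal to V. *)
Lemma dense_orthogonal V : subspace V ->
  (forall v, (forall u, V u -> dot u v = 0) -> v = 0) -> dense_subset dot V.
Proof.
move=> sV V0 w.
pose S := [set dot (w - u) (w - u) | u in V].
have S0 : has_inf S.
  split; first by exists (dot (w - 0) (w - 0)), 0 => //; case: sV.
  by exists 0 => _ [u _ <-]; exact: dot_ge0.
pose d := inf S.
have dle u : V u -> d <= dot (w - u) (w - u).
  by move=> Vu; apply: ge_inf; [case: S0|exists u].
have /choice[u_ hu] n : exists u, V u /\ dot (w - u) (w - u) < d + n.+1%:R^-1.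
  have n0 : (0 : R) < n.+1%:R^-1 by rewrite invr_gt0.
  have [_ [u Vu <-] hu] := inf_adherent n0 S0.
  by exists u.
have Vu n : V (u_ n) by case: (hu n).
have ud n : dot (w - u_ n) (w - u_ n) < d + n.+1%:R^-1 by case: (hu n).
have cauchy m n :
    dot (u_ m - u_ n) (u_ m - u_ n) <= 2 * (m.+1%:R^-1 + n.+1%:R^-1).
  (* Parallelogram law: the midpoint lies in V, so its squared distance to w is at least d, while
     those of [u_ m] and [u_ n] are nearly d. *)
  have Vmn : V (2^-1 *: (u_ m + u_ n)).
    apply: (subspaceZ _ sV); rewrite -[u_ m]scale1r; case: sV => _; exact.
  have := dle _ Vmn; have := ltW (ud m); have := ltW (ud n).
  rewrite !(dotE hI) (dotC hH (u_ m) w) (dotC hH (u_ n) w) (dotC hH (u_ n) (u_ m)).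
  set a := m.+1%:R^-1; set b := n.+1%:R^-1.
  by lra.
have [p cp] : exists l, hn (u_ n - l) @[n --> \oo] --> 0.
  apply: (hcomplete hH) => e e0.
  have e4 : 0 < e ^+ 2 / 5 by rewrite divr_gt0// exprn_gt0.
  have [N _ hN] := near_infty_natSinv_lt (PosNum e4).
  exists N => m n Nm Nn.
  rewrite -ltr_sqr ?nnegrE ?hnorm_ge0 ?(ltW e0)// (hnorm_sqr hI).
  rewrite (le_lt_trans (cauchy m n))//.
  have := hN m Nm; have := hN n Nn; have := e4 => /=.
  by move: (m.+1%:R^-1) (n.+1%:R^-1) (e ^+ 2) => x y z; lra.
have wp u : V u -> dot u (w - p) = 0.
  move=> V_u; have [u0|u0] := eqVneq (dot u u) 0.
    by rewrite (dot_eq0 hH u0) (dot0l hI).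
  have uu : 0 < dot u u by rewrite lt_neqAle eq_sym u0 dot_ge0.
  have le_n n : dot (w - u_ n) u ^+ 2 <= dot u u * n.+1%:R^-1.
    (* With r = w - u_n, this t minimizes |r - t u|^2, whose minimum is |r|^2 - t dot r u. Being at
       least d, it forces t dot r u <= 1/(n+1). *)
    pose t := dot (w - u_ n) u / dot u u.
    have Vt : V (t *: u + u_ n) by case: sV => _; exact.
    have := dle _ Vt; have := ltW (ud n).
    have -> : w - (t *: u + u_ n) = (w - u_ n) - t *: u.
      by rewrite opprD addrA addrAC.
    move: (w - u_ n) @t Vt => r t _.
    rewrite (dotBl hI _ (t *: u)) !(dotBr hI _ (t *: u)) !(dotE hI) (dotC hH u r) => h1 h2.
    have tE : t * dot u u = dot r u by rewrite divfK.
    have -> : dot r u ^+ 2 = dot u u * (t * dot r u).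
      by rewrite mulrCA mulrA tE expr2.
    rewrite ler_pM2l//; move: h1 h2; rewrite tE.
    by move: (n.+1%:R^-1) (t * dot r u) (dot r r) => x y z; lra.
  have cr : dot (w - u_ n) u @[n --> \oo] --> dot (w - p) u.
    apply: (cvg_dot hI); move: cp; apply: cvg_trans; apply: near_eq_cvg.
    by near=> n; rewrite opprB [in RHS]addrC addrA subrK (hdistC hI).
  have c2 : dot (w - u_ n) u ^+ 2 @[n --> \oo] --> dot (w - p) u ^+ 2.
    by rewrite expr2; under eq_fun do rewrite expr2; exact: cvgM.
  have c0 : dot u u * n.+1%:R^-1 @[n --> \oo] --> (0 : R).
    rewrite -[X in _ --> X](mulr0 (dot u u)).
    by apply: cvgMr; exact: cvg_harmonic.
  have : dot (w - p) u ^+ 2 <= 0.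
    have -> : dot (w - p) u ^+ 2 = limn (fun n => dot (w - u_ n) u ^+ 2).
      by apply/esym/cvg_lim.
    have -> : 0 = limn (fun n => dot u u * n.+1%:R^-1) :> R.
      by apply/esym/cvg_lim.
    apply: ler_lim; [exact: cvgP c2|exact: cvgP c0|exact: nearW].
  by rewrite dotC// => h; apply/eqP; rewrite -sqrf_eq0 eq_le h sqr_ge0.
have wpE : w = p by apply/eqP; rewrite -subr_eq0; apply/eqP/V0.
move=> e e0; move/cvgrPdist_lt : cp => /(_ _ e0) [N _ hN].
exists (u_ N) => //; have := hN N (leqnn N) => /=.
by rewrite sub0r normrN ger0_norm ?hnorm_ge0// (hdistC hI) wpE.
Unshelve. all: by end_near.
Qed.

(* The range of 1 + A is dense, as Av = -v for v orthogonal to it, and closed, as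
   1 + A does not decrease norms. *)
Lemma nonnegative_resolvent_onto (A : operator H) : linear_operator A ->
  self_adjoint dot A -> nonnegative_operator dot A ->
  forall y, exists u, A u (y - u).
Proof.
move=> [_ A0 Alin] sA nnA.
pose V := [set y | exists u, A u (y - u)].
have sV : subspace V.
  split=> [|c y z [u Au] [v Av]]; first by exists 0; rewrite subr0.
  exists (c *: u + v); have := Alin c _ _ _ _ Au Av.
  by rewrite scalerBr addrACA -opprD.
have dV : dense_subset dot V.
  apply: dense_orthogonal => // v hv.
  have Av : A v (- v).
    apply/sA => u f Auf; rewrite (dotNr hI); apply/eqP; rewrite -addr_eq0 -(dotDl hI).
    by apply/eqP/hv; exists u; rewrite addrK.
  have := nnA _ _ Av; rewrite (dotNl hI) oppr_ge0 => h.
  by apply: (dot_eq0 hH); apply/eqP; rewrite eq_le h dot_ge0.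
have nle u f : A u f -> hn u <= hn (u + f) /\ hn f <= hn (u + f).
  move=> Auf; have fu := nnA _ _ Auf.
  have [uu ff] := (dot_ge0 hH u, dot_ge0 hH f).
  split; apply: (hnorm_le hI); rewrite ?hnorm_ge0// (hnorm_sqr hI) !(dotE hI) (dotC hH u f);
    by lra.
move=> y.
have /choice[y_ hy] n : exists z, V z /\ hn (y - z) < n.+1%:R^-1.
  have n0 : (0 : R) < n.+1%:R^-1 by rewrite invr_gt0.
  by have [z Vz hz] := dV y _ n0; exists z.
have /choice[u_ Au] n : exists u, A u (y_ n - u) by case: (hy n).
have cy : hn (y_ n - y) @[n --> \oo] --> 0.
  apply: (@squeeze_cvgr _ _ _ _ (fun=> 0) (fun n => n.+1%:R^-1)).
  - by near=> n; rewrite hnorm_ge0 (hdistC hI) ltW//; case: (hy n).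
  - exact: cvg_cst.
  - exact: cvg_harmonic.
have cauy := hcvg_cauchy hI cy.
have Asub m n : A (u_ m - u_ n) ((y_ m - u_ m) - (y_ n - u_ n)).
  have := Alin (-1) _ _ _ _ (Au n) (Au m).
  by rewrite !scaleN1r ![- _ + _]addrC.
have E m n : (u_ m - u_ n) + ((y_ m - u_ m) - (y_ n - u_ n)) = y_ m - y_ n.
  by rewrite addrACA -opprD !subrKC.
have [u cu] : exists l, hn (u_ n - l) @[n --> \oo] --> 0.
  apply: (hcomplete hH) => e e0; have [N hN] := cauy e e0.
  exists N => m n Nm Nn; apply: le_lt_trans (hN m n Nm Nn).
  by have [] := nle _ _ (Asub m n); rewrite E.
(* A is closed because it equals its adjoint: lying in its graph is a family of equalities of inner
   products, which pass to the limit. *)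
exists u; apply/sA => v g Avg.
have Avg' := (sA _ _).1 Avg.
have cf : hn ((y_ n - u_ n) - (y - u)) @[n --> \oo] --> 0.
  apply: (@squeeze_cvgr _ _ _ _ (fun=> 0)
    (fun n => hn (y_ n - y) + hn (u_ n - u))).
  - near=> n; rewrite hnorm_ge0/=.
    rewrite (_ : _ - (y - u) = (y_ n - y) - (u_ n - u)) ?(ler_hnormB hI)//.
    by rewrite !opprB addrACA [RHS]addrACA (addrC (- y)).
  - exact: cvg_cst.
  - by rewrite -[X in _ --> X](addr0 0); exact: cvgD.
have c1 := @cvg_dot hI _ _ g cu; have c2 := @cvg_dot hI _ _ v cf.
rewrite dotC// (dotC hH v).
have e1 : limn (fun n => dot (u_ n) g) = dot u g by exact/cvg_lim.
have e2 : limn (fun n => dot (y_ n - u_ n) v) = dot (y - u) v by exact/cvg_lim.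
rewrite -e1 -e2; congr (limn _); apply/funext => n.
by rewrite (dotC hH (u_ n)) (Avg' _ _ (Au n)) dotC.
Unshelve. all: by end_near.
Qed.

End Hilbert.

(** * The Weierstrass approximation theorem *)

Section BernsteinPoly.
Context {R : realType}.
Implicit Types (p q : {poly R}).

Definition bernstein n k : {poly R} :=
  'C(n, k)%:R *: ('X^k * (1 - 'X) ^+ (n - k)).

Lemma ffact_bin_mul n i j : (i + j <= n)%N ->
  ((i + j) ^_ j * 'C(n, i + j) = n ^_ j * 'C(n - j, i))%N.
Proof.
move=> ijn.
have jn : (j <= n)%N by apply: leq_trans ijn; rewrite leq_addl.
have inj : (i <= n - j)%N by rewrite leq_subRL// addnC.
apply/eqP; rewrite -(eqn_pmul2r (fact_gt0 i)) -(eqn_pmul2r (fact_gt0 (n - (i + j)))).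
apply/eqP.
transitivity ('C(n, i + j) * ((i + j)`! * (n - (i + j))`!))%N.
  rewrite -(@ffact_fact (i + j) j) ?leq_addl// addnK; lia.
rewrite bin_fact// -(ffact_fact jn) -(bin_fact inj).
rewrite (addnC i j) subnDA; lia.
Qed.

(** The factorial moments of the binomial distribution: the terms k < j vanish, and absorbing k^_j
    into the binomial coefficient leaves the expansion of ((1 - X) + X)^(n - j). *)
Lemma sum_ffact_bernstein n j : (j <= n)%N ->
  \sum_(k < n.+1) (k ^_ j)%:R *: bernstein n k = (n ^_ j)%:R *: 'X^j.
Proof.
move=> jn; pose F k := (k ^_ j)%:R *: bernstein n k.
rewrite -(big_mkord xpredT F) (@big_cat_nat _ _ _ j)//=; last exact: leqW.
rewrite big_nat big1 ?add0r; last first.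
  by move=> k /andP[_ kj]; rewrite /F ffact_small// scale0r.
rewrite -{1}[j]add0n big_addn subSn// big_mkord.
have -> : (n ^_ j)%:R *: 'X^j =
    (n ^_ j)%:R *: (((1 - 'X) + 'X) ^+ (n - j) * 'X^j) :> {poly R}.
  by rewrite subrK expr1n mul1r.
rewrite exprDn mulr_suml scaler_sumr; apply: eq_bigr => i _.
rewrite /F /bernstein scalerA -natrM ffact_bin_mul; last first.
  by have := ltn_ord i; lia.
rewrite natrM -scalerA mulrnAl -[X in _ = _ *: X]scaler_nat.
congr (_ *: (_ *: _)).
by rewrite exprD mulrC -mulrA (addnC i) subnDA.
Qed.

Lemma sum_bernstein n : \sum_(k < n.+1) bernstein n k = 1.
Proof.
have := @sum_ffact_bernstein n 0 (leq0n _); rewrite ffactn0 scale1r expr0 => <-.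
by apply: eq_bigr => k _; rewrite ffactn0 scale1r.
Qed.

(** By [sum_ffact_bernstein], X^j has the Bernstein coefficients k^_j / n^_j, which are close to
    (k/n)^j for large n. *)
Definition bernstein_coef p n k :=
  \sum_(j < size p) p`_j * ((k ^_ j)%:R / (n ^_ j)%:R).

Lemma bernstein_expansion p n : (size p <= n)%N ->
  p = \sum_(k < n.+1) bernstein_coef p n k *: bernstein n k.
Proof.
move=> pn; under eq_bigr do rewrite scaler_suml.
rewrite exchange_big/= -[LHS]coefK poly_def; apply: eq_bigr => j _.
have jn : (j <= n)%N by apply: leq_trans pn; exact: ltnW.
have n0 : (n ^_ j)%:R != 0 :> R by rewrite pnatr_eq0 -lt0n ffact_gt0.
have -> : 'X^j = ((n ^_ j)%:R)^-1 *: ((n ^_ j)%:R *: 'X^j) :> {poly R}.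
  by rewrite scalerA mulVf// scale1r.
rewrite -sum_ffact_bernstein// !scaler_sumr; apply: eq_bigr => k _.
by rewrite 2!scalerA; congr (_ *: _); rewrite -mulrA; congr (_ * _); exact: mulrC.
Qed.

(** Each factor (k - j)/(n - j) differs from k/n by at most j/(n - j) and all factors lie in [0,1],
    so errors add up; j^2 + j <= (j + 1)^2 closes the induction. *)
Lemma ffact_ratio_le n k j : (j < n)%N -> (k <= n)%N ->
  `|(k ^_ j)%:R / (n ^_ j)%:R - (k%:R / n%:R) ^+ j| <=
    (j ^ 2)%:R / (n - j)%:R :> R.
Proof.
elim: j => [|j IH] jn kn.
  by rewrite !ffactn0 divrr ?unitr1// expr0 subrr normr0 mul0r.
have {}IH := IH (ltnW jn) kn.
rewrite !ffactnSr !natrM.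
set A := (k ^_ j)%:R in IH *; set B := (n ^_ j)%:R in IH *.
set x := k%:R / n%:R in IH *.
set y := (k - j)%:R / (n - j)%:R : R.
rewrite invfM mulrACA -/y.
have n0 : 0 < n%:R :> R by rewrite ltr0n; apply: leq_trans jn.
have nj0 : 0 < (n - j)%:R :> R by rewrite ltr0n subn_gt0 ltnW.
have nj1 : 0 < (n - j.+1)%:R :> R by rewrite ltr0n subn_gt0.
have x0 : 0 <= x by rewrite divr_ge0.
have x1 : x <= 1 by rewrite ler_pdivrMr// mul1r ler_nat.
have y0 : 0 <= y by rewrite divr_ge0.
have y1 : y <= 1 by rewrite ler_pdivrMr// mul1r ler_nat leq_sub2r.
have xy : `|y - x| <= j%:R / (n - j)%:R.
  (* For k < j the truncated subtraction makes y zero, and x = k/n is itself small enough. *)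
  have [kj|jk] := ltnP k j.
    have -> : y = 0 by rewrite /y (_ : k - j = 0)%N ?mul0r//; lia.
    rewrite sub0r normrN ger0_norm//; apply: ler_pM; rewrite ?invr_ge0//.
      by rewrite ler_nat ltnW.
    by rewrite lef_pV2 ?posrE// ler_nat leq_subr.
  have jE : y - x = - (j%:R * ((n%:R - k%:R) / n%:R) / (n - j)%:R).
    move: nj0; rewrite /y /x !natrB ?(ltnW (ltnW jn))// => nj0.
    by field; rewrite !gt_eqF.
  rewrite jE normrN ger0_norm ?divr_ge0 ?mulr_ge0 ?subr_ge0 ?ler_nat ?invr_ge0//.
  rewrite ler_pM2r ?invr_gt0// ler_piMr// ler_pdivrMr// mul1r.
  by rewrite gerBl.
clearbody y x.
have -> : A / B * y - x ^+ j.+1 = (A / B - x ^+ j) * y + x ^+ j * (y - x).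
  by rewrite exprSr; ring.
rewrite (le_trans (ler_normD _ _))// !normrM.
have h1 : `|A / B - x ^+ j| * `|y| <= (j ^ 2)%:R / (n - j)%:R.
  rewrite -[leRHS]mulr1; apply: ler_pM => //; by rewrite ger0_norm.
have h2 : `|x ^+ j| * `|y - x| <= j%:R / (n - j)%:R.
  rewrite -[leRHS]mul1r; apply: ler_pM => //.
  by rewrite normrX ger0_norm// exprn_ile1.
rewrite (le_trans (lerD h1 h2))// -mulrDl -natrD -natrM.
apply: ler_pM; rewrite ?invr_ge0// ?ler_nat//.
  by rewrite -mulnn -mulnSr leq_mul.
by rewrite lef_pV2 ?posrE// ler_nat leq_sub2l.
Qed.

Lemma horner_bernstein n k x :
  (bernstein n k).[x] = 'C(n, k)%:R * (x ^+ k * (1 - x) ^+ (n - k)).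
Proof. by rewrite /bernstein !hornerE. Qed.

Lemma horner_bernstein_ge0 n k x : 0 <= x <= 1 -> 0 <= (bernstein n k).[x].
Proof.
move=> /andP[x0 x1]; rewrite horner_bernstein.
by rewrite !mulr_ge0// exprn_ge0// subr_ge0.
Qed.

Lemma sum_horner_bernstein n x : \sum_(k < n.+1) (bernstein n k).[x] = 1.
Proof. by rewrite -horner_sum sum_bernstein hornerC. Qed.

(* The variance of a binomial frequency with parameters n and x. *)
Lemma bernstein_variance n x : (1 < n)%N ->
  \sum_(k < n.+1) (k%:R / n%:R - x) ^+ 2 * (bernstein n k).[x] =
  x * (1 - x) / n%:R.
Proof.
move=> n1; have n0 : n%:R != 0 :> R by rewrite pnatr_eq0; lia.
have S j : (j <= n)%N -> \sum_(k < n.+1) (k ^_ j)%:R * (bernstein n k).[x] =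
    (n ^_ j)%:R * x ^+ j.
  move=> jn; have := congr1 (horner_eval x) (sum_ffact_bernstein jn).
  rewrite /horner_eval horner_sum !hornerE => <-.
  by apply: eq_bigr => k _; rewrite [in RHS]hornerZ.
(* The square is expanded in the falling factorials of k of orders 2, 1 and 0, using k^2 = k^_2 + k;
   order 2 is where 1 < n is required. *)
have -> : \sum_(k < n.+1) (k%:R / n%:R - x) ^+ 2 * (bernstein n k).[x] =
   n%:R ^- 2 * \sum_(k < n.+1) (k ^_ 2)%:R * (bernstein n k).[x] +
   ((n%:R ^- 2 - 2 * x / n%:R) *
      \sum_(k < n.+1) (k ^_ 1)%:R * (bernstein n k).[x] +
    x ^+ 2 * \sum_(k < n.+1) (k ^_ 0)%:R * (bernstein n k).[x]).
  rewrite !mulr_sumr -!big_split/=; apply: eq_bigr => k _.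
  have -> : (k ^_ 2)%:R = k%:R ^+ 2 - k%:R :> R.
    rewrite ffactnS ffactn1; case: (nat_of_ord k) => [|m].
      by rewrite mul0n expr0n subrr.
    by rewrite natrM -natr1; ring.
  by rewrite ffactn1 ffactn0; field.
rewrite !S ?(ltnW n1)// ffactnS !ffactn1 ffactn0.
have -> : (n * n.-1)%:R = n%:R ^+ 2 - n%:R :> R.
  by case: n {S n0} n1 => // m _; rewrite natrM -natr1; ring.
by field.
Qed.

Lemma within_continuousP (A : set R) (f : R -> R) :
  {within A, continuous f} -> forall x, A x -> forall e : R, 0 < e ->
  exists2 d : R, 0 < d & forall y, A y -> `|x - y| < d -> `|f x - f y| < e.
Proof.
move=> /subspace_continuousP cf x Ax e e0.
have := cf x Ax; move/cvgrPdist_lt => /(_ _ e0).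
rewrite near_withinE => /nbhs_ballP[d /= d0 hd].
by exists d => // y Ay xy; exact: hd.
Qed.

(** By contradiction: among pairs at distance below 1/(n+1) with values eps apart, the first
    components accumulate at some l, where continuity is violated. *)
Lemma itv01_unif_continuous (f : R -> R) : {within `[0, 1], continuous f} ->
  forall eps : R, 0 < eps -> exists2 d : R, 0 < d & forall x y : R,
    0 <= x <= 1 -> 0 <= y <= 1 -> `|x - y| < d -> `|f x - f y| < eps.
Proof.
move=> cf eps e0; apply: contrapT => h.
have /choice[u hu] (n : nat) : exists x : R * R,
    [/\ 0 <= x.1 <= 1, 0 <= x.2 <= 1, `|x.1 - x.2| < n.+1%:R^-1 &
      eps <= `|f x.1 - f x.2|].
  apply: contrapT => hn; apply: h; exists n.+1%:R^-1 => // x y x01 y01 xy.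
  rewrite ltNge; apply/negP => fxy; apply: hn.
  by exists (x, y).
have [|k kincr cu] := @bolzano_weierstrass R (fun n => (u n).1).
  exists 1; split => // M M1 n _ /=; have [/andP[x0 x1] _ _ _] := hu n.
  by rewrite ger0_norm// (le_trans x1)// ltW.
set l := limn _ in cu.
have l01 : 0 <= l <= 1.
  apply/andP; split; [apply: limr_ge|apply: limr_le] => //.
    by apply: nearW => n /=; have [/andP[]] := hu (k n).
  by apply: nearW => n /=; have [/andP[]] := hu (k n).
have kn n : (n <= k n)%N.
  elim: n => // n IH; apply: leq_ltn_trans IH _.
  by have := kincr n.+1 n; rewrite !leEnat ltnn ltnNge => ->.
have e2 : 0 < eps / 2 by rewrite divr_gt0.
have l01' : `[0, 1]%classic l by rewrite /= in_itv.
have [d d0 hd] := within_continuousP cf l01' e2.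
have d2 : 0 < d / 2 by rewrite divr_gt0.
move/cvgrPdist_lt : cu => /(_ _ d2) [N1 _ h1].
have [N2 _ h2] := near_infty_natSinv_lt (PosNum d2).
pose n := maxn N1 N2.
have := h1 n (leq_maxl _ _); rewrite /= => ln.
have := h2 (k n) (leq_trans (leq_maxr N1 N2) (kn n)) => /= kd.
have [x01 y01 xy] := hu (k n); apply/negP; rewrite -ltNge.
rewrite (le_lt_trans (ler_distD (f l) _ _))// (splitr eps) ltrD//.
  rewrite distrC; apply: hd; first by rewrite /= in_itv.
  by rewrite (lt_trans ln)// gtr_pMr// invf_lt1 ?ltr1n.
apply: hd; first by rewrite /= in_itv.
rewrite (le_lt_trans (ler_distD (u (k n)).1 _ _))// (splitr d) ltrD//.
exact: lt_trans xy kd.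
Qed.

Lemma itv01_bounded (f : R -> R) : {within `[0, 1], continuous f} ->
  exists2 M : R, 0 <= M & forall x : R, 0 <= x <= 1 -> `|f x| <= M.
Proof.
move=> cf; have [c c01 hc] := EVT_max ler01 cf.
have [b b01 hb] := EVT_min ler01 cf.
exists (`|f c| + `|f b|) => // x x01; rewrite ler_norml.
have x01' : x \in `[0, 1] by rewrite in_itv.
rewrite (le_trans (hc _ x01')) ?andbT; last first.
  by rewrite (le_trans (ler_norm _))// lerDl.
rewrite (le_trans _ (hb _ x01'))// lerNl (le_trans (ler_norm _))// normrN.
by rewrite lerDr.
Qed.

(** Bernstein's proof. If |x - y| >= d then 2M (x - y)^2 / d^2 already exceeds |f x - f y|.
    Averaging with the Bernstein weights turns the square into the binomial variance, at most
    1/n. *)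
Lemma weierstrass01 (f : R -> R) : {within `[0, 1], continuous f} ->
  forall eps : R, 0 < eps -> exists p : {poly R},
    forall x, 0 <= x <= 1 -> `|p.[x] - f x| <= eps.
Proof.
move=> cf eps e0.
have e2 : 0 < eps / 2 by rewrite divr_gt0.
have [d d0 hd] := itv01_unif_continuous cf e2.
have [M M0 hM] := itv01_bounded cf.
have K0 : 0 <= 2 * M / d ^+ 2 by rewrite divr_ge0 ?sqr_ge0 ?mulr_ge0.
have key (x y : R) : 0 <= x <= 1 -> 0 <= y <= 1 ->
    `|f x - f y| <= eps / 2 + 2 * M / d ^+ 2 * (x - y) ^+ 2.
  move=> x01 y01; have [xy|xy] := ltP `|x - y| d.
    rewrite (le_trans (ltW (hd _ _ x01 y01 xy)))// lerDl.
    by rewrite mulr_ge0 ?sqr_ge0.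
  rewrite (le_trans (ler_normB _ _))// (@le_trans _ _ (2 * M))//.
    by rewrite mulr_natl mulr2n lerD ?hM.
  rewrite -[leLHS]add0r lerD ?(ltW e2)// -mulrA ler_peMr ?mulr_ge0//.
  rewrite mulrC ler_pdivlMr ?exprn_gt0// mul1r -[leRHS]real_normK ?num_real//.
  by rewrite ler_sqr ?nnegrE// ltW.
have [n [n1 nlarge]] : exists n, (1 < n)%N /\ 2 * M / d ^+ 2 / n%:R <= eps / 2.
  exists (maxn 2 (Num.truncn (2 * M / d ^+ 2 / (eps / 2))).+1).
  split; first by rewrite leq_max.
  set t := _ / d ^+ 2 in K0 *.
  rewrite ler_pdivrMr ?ltr0n ?leq_max// mulrC -ler_pdivrMr//.
  rewrite (@le_trans _ _ (Num.truncn (t / (eps / 2))).+1%:R)//.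
    by rewrite ltW// truncnS_gt// divr_ge0// ltW.
  by rewrite ler_nat leq_max leqnn orbT.
have n0 : 0 < n%:R :> R by rewrite ltr0n; lia.
exists (\sum_(k < n.+1) f (k%:R / n%:R) *: bernstein n k) => x x01.
rewrite horner_sum.
have -> : f x = \sum_(k < n.+1) f x * (bernstein n k).[x].
  by rewrite -mulr_sumr sum_horner_bernstein mulr1.
rewrite -sumrB (le_trans (ler_norm_sum _ _ _))//.
apply: (@le_trans _ _ (\sum_(k < n.+1) (eps / 2 * (bernstein n k).[x] +
    2 * M / d ^+ 2 * ((k%:R / n%:R - x) ^+ 2 * (bernstein n k).[x])))).
  apply: ler_sum => k _.
  rewrite hornerZ -mulrBl normrM (ger0_norm (horner_bernstein_ge0 _ _ x01)).
  rewrite [X in _ <= _ + X]mulrA -mulrDl ler_wpM2r ?horner_bernstein_ge0//.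
  apply: key => //; rewrite divr_ge0//= ler_pdivrMr// mul1r ler_nat.
  by rewrite -ltnS.
rewrite big_split/= -!mulr_sumr sum_horner_bernstein bernstein_variance//.
rewrite mulr1 [leRHS](splitr eps) lerD2l mulrA (le_trans _ nlarge)//.
rewrite ler_wpM2r ?invr_ge0// -[leRHS]mulr1.
rewrite ler_wpM2l//.
by case/andP: x01 => ? ?; nra.
Qed.

End BernsteinPoly.

(** * Functional calculus of a symmetric operator with 0 <= L <= 1 *)

Section PolyCalculus.
Context {R : realType} {H : lmodType R} (dot : H -> H -> R).
Hypothesis hH : hilbert dot.
Variable L : {linear H -> H}.
Implicit Types (p q : {poly R}) (x y : H).

Definition papp p x : H := \sum_(i < size p) p`_i *: iter i L x.

Lemma pappE n p x : (size p <= n)%N ->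
  papp p x = \sum_(i < n) p`_i *: iter i L x.
Proof.
move=> pn; rewrite /papp (big_ord_widen n (fun i => p`_i *: iter i L x))//.
rewrite big_mkcond; apply: eq_bigr => i _; case: ltnP => // ip.
by rewrite nth_default// scale0r.
Qed.

Lemma pappD p q x : papp (p + q) x = papp p x + papp q x.
Proof.
pose n := maxn (size p) (size q).
rewrite !(@pappE n) ?leq_maxl ?leq_maxr//; last exact: size_polyD.
by rewrite -big_split/=; apply: eq_bigr => i _; rewrite coefD scalerDl.
Qed.

Lemma pappZ c p x : papp (c *: p) x = c *: papp p x.
Proof.
rewrite (@pappE (size p) (c *: p)) ?size_scale_leq// scaler_sumr.
by apply: eq_bigr => i _; rewrite coefZ scalerA.
Qed.

Lemma papp0 x : papp 0 x = 0.
Proof. by rewrite /papp size_poly0 big_ord0. Qed.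

Lemma pappN p x : papp (- p) x = - papp p x.
Proof. by rewrite -[- p]scaleN1r pappZ scaleN1r. Qed.

Lemma pappB p q x : papp (p - q) x = papp p x - papp q x.
Proof. by rewrite pappD pappN. Qed.

Lemma pappC c x : papp c%:P x = c *: x.
Proof. by rewrite (@pappE 1) ?size_polyC_leq1// big_ord1 coefC. Qed.

Lemma papp1 x : papp 1 x = x. Proof. by rewrite pappC scale1r. Qed.

Lemma pappMX p x : papp (p * 'X) x = L (papp p x).
Proof.
rewrite (@pappE (size p).+1); last first.
  by rewrite (leq_trans (size_polyMleq _ _))// size_polyX addn2.
rewrite big_ord_recl coefMX scale0r add0r linear_sum.
by apply: eq_bigr => i _; rewrite coefMX/= linearZ.
Qed.

Lemma pappX x : papp 'X x = L x.
Proof. by rewrite -['X]mul1r pappMX papp1. Qed.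

Lemma pappM p q x : papp (p * q) x = papp p (papp q x).
Proof.
elim/poly_ind: p => [|p c IH]; first by rewrite mul0r !papp0.
by rewrite mulrDl !pappD mulrAC !pappMX IH mul_polyC pappZ pappC.
Qed.

Lemma papp_linear p c x y : papp p (c *: x + y) = c *: papp p x + papp p y.
Proof.
elim/poly_ind: p => [|p d IH]; first by rewrite !papp0 scaler0 addr0.
rewrite !pappD !pappMX IH !pappC linearP !scalerDr !scalerA (mulrC c).
by rewrite addrACA.
Qed.

Lemma papp_sum (I : Type) (r : seq I) (F : I -> {poly R}) x :
  papp (\sum_(i <- r) F i) x = \sum_(i <- r) papp (F i) x.
Proof.
apply: (big_morph (papp^~ x)) => [p q|]; first exact: pappD.
exact: papp0.
Qed.

Hypothesis Lsym : forall x y, dot (L x) y = dot x (L y).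
Hypothesis Lge0 : forall x, 0 <= dot (L x) x.
Hypothesis Lle1 : forall x, dot (L x) x <= dot x x.

Lemma papp_sym p x y : dot (papp p x) y = dot x (papp p y).
Proof.
elim/poly_ind: p => [|p c IH] in x y *.
  by rewrite !papp0 (dot0l hH) (dot0r hH).
rewrite !pappD !pappC !(dotE hH) !pappMX Lsym IH.
by rewrite -!pappMX mulrC -[L y]pappX -pappM.
Qed.

Lemma papp_sqr p q x : dot (papp (p ^+ 2 * q) x) x = dot (papp q (papp p x)) (papp p x).
Proof. by rewrite expr2 -mulrA pappM papp_sym -pappM mulrC pappM. Qed.

(* Squares can be moved to the sides of the product, as L is symmetric; what is
   left is settled by X (1 - X) = X^2 (1 - X) + (1 - X)^2 X. *)
Lemma papp_X_onem_ge0 i j x : 0 <= dot (papp ('X^i * (1 - 'X) ^+ j) x) x.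
Proof.
have L1 z : 0 <= dot (papp (1 - 'X) z) z.
  by rewrite pappB papp1 pappX (dotBl hH) subr_ge0.
have base b c z : 0 <= dot (papp ('X^(nat_of_bool b) * (1 - 'X) ^+ (nat_of_bool c)) z) z.
  case: b; case: c; rewrite ?expr0 ?expr1 ?mul1r ?mulr1.
  - have -> : 'X * (1 - 'X) = 'X ^+ 2 * (1 - 'X) + (1 - 'X) ^+ 2 * 'X :> {poly R}.
      by ring.
    rewrite pappD (dotDl hH) !papp_sqr addr_ge0//.
    by rewrite pappX.
  - by rewrite pappX.
  - exact: L1.
  - by rewrite papp1 (dot_ge0 hH).
rewrite -[ i]odd_double_half -[j]odd_double_half !exprD -!muln2 !exprM.
rewrite mulrACA mulrC -exprMn papp_sqr; exact: base.
Qed.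

(* The Bernstein coefficients of p converge uniformly to values of p, so for
   degree n they are at least -O(1/n), and the operators (bernstein n k)(L) are
   nonnegative with sum 1. *)
Lemma papp_ge0 p : (forall r : R, 0 <= r <= 1 -> 0 <= p.[r]) ->
  forall x, 0 <= dot (papp p x) x.
Proof.
move=> p0 x; set d := size p.
(* By [ffact_ratio_le] the j-th term of a Bernstein coefficient is off by at most |p_j| j^2 / (n -
   j), hence the total error is at most M / (n - d). *)
pose M := \sum_(j < d) `|p`_j| * (j ^ 2)%:R.
have M0 : 0 <= M by apply: sumr_ge0 => j _; rewrite mulr_ge0.
have coef_ge n k : (d < n)%N -> (k <= n)%N ->
    - (M / (n - d)%:R) <= bernstein_coef p n k.
  move=> dn kn.
  have n0 : (0 : R) < n%:R by rewrite ltr0n; apply: leq_ltn_trans dn.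
  have := p0 (k%:R / n%:R); rewrite divr_ge0//= ler_pdivrMr// mul1r ler_nat kn.
  move=> /(_ isT) h.
  have : `|bernstein_coef p n k - p.[k%:R / n%:R]| <= M / (n - d)%:R.
    rewrite horner_coef -sumrB mulr_suml (le_trans (ler_norm_sum _ _ _))//.
    apply: ler_sum => j _; rewrite -mulrBr normrM -mulrA ler_wpM2l//.
    have jd := ltn_ord j.
    rewrite (le_trans (@ffact_ratio_le R _ _ _ (ltn_trans jd dn) kn))//.
    rewrite ler_wpM2l// lef_pV2 ?posrE ?ltr0n ?subn_gt0//; last exact: ltn_trans jd dn.
    by rewrite ler_nat leq_sub2l// ltnW.
  rewrite ler_norml => /andP[h1 _]; move: h1 h.
  by move: (M / _) (p.[_]) (bernstein_coef _ _ _) => ? ? ?; lra.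
have main m : - (M * dot x x) <= m.+1%:R * dot (papp p x) x.
  have nd : (d < d + m.+1)%N by lia.
  rewrite [X in papp X](@bernstein_expansion _ p (d + m.+1)) ?leq_addr//.
  rewrite papp_sum.
  have -> : dot (\sum_(k < (d + m.+1).+1)
      papp (bernstein_coef p (d + m.+1) k *: bernstein (d + m.+1) k) x) x =
    \sum_(k < (d + m.+1).+1) bernstein_coef p (d + m.+1) k *
      dot (papp (bernstein (d + m.+1) k) x) x.
    elim/big_ind2: _ => [|u a v b <- <-|k _]; first by rewrite (dot0l hH).
      by rewrite (dotDl hH).
    by rewrite pappZ (dotZl hH).
  have {1}-> : dot x x = \sum_(k < (d + m.+1).+1) dot (papp (bernstein (d + m.+1) k) x) x.
    rewrite -{1}[x]papp1 -(sum_bernstein (d + m.+1)) papp_sum.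
    elim/big_ind2: _ => [|u a v b <- <-|k _]; first by rewrite (dot0l hH).
      by rewrite (dotDl hH).
    by [].
  rewrite !mulr_sumr -sumrN; apply: ler_sum => k _.
  rewrite mulrA -mulNr ler_wpM2r//.
    rewrite /bernstein pappZ (dotZl hH) mulr_ge0//; exact: papp_X_onem_ge0.
  have kn : (k <= d + m.+1)%N by rewrite -ltnS.
  have := coef_ge _ _ nd kn; rewrite addKn => h.
  by rewrite mulrC -ler_pdivrMr ?ltr0Sn// mulNr.
rewrite leNgt; apply/negP => neg.
have := main (Num.truncn (M * dot x x / - dot (papp p x) x)).
apply/negP; rewrite -ltNge -ltrN2 opprK -mulrN -ltr_pdivrMr ?oppr_gt0//.
exact: truncnS_gt.
Qed.

(** Positivity applied to the polynomial M^2 - p^2, since by symmetry |p(L)x|^2 is the form of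
    p^2(L) at x. *)
Lemma papp_norm p M : 0 <= M -> (forall r : R, 0 <= r <= 1 -> `|p.[r]| <= M) ->
  forall x, hnorm dot (papp p x) <= M * hnorm dot x.
Proof.
move=> M0 pM x; apply: (hnorm_le hH); first by rewrite mulr_ge0 ?hnorm_ge0.
rewrite exprMn (hnorm_sqr hH) papp_sym -pappM -subr_ge0.
rewrite -(dotZr hH) -pappC -(dotBr hH) -pappB (dotC hH).
apply: papp_ge0 => r r01; rewrite !hornerE subr_ge0 -expr2.
by rewrite -[leLHS]real_normK ?num_real// ler_sqr ?nnegrE ?pM.
Qed.

End PolyCalculus.

(** * Extension of the calculus from polynomials to continuous functions *)

Section ContinuousCalculus.
Context {R : realType}.
Implicit Types (f g : R -> R) (p q : {poly R}).

Definition cont01 f := {within `[0, 1], continuous f}.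

Definition dist01_le p f (e : R) := forall r, 0 <= r <= 1 -> `|p.[r] - f r| <= e.

Lemma cont01D f g : cont01 f -> cont01 g -> cont01 (fun r => f r + g r).
Proof. by move=> cf cg x; apply: continuousD; [exact: cf|exact: cg]. Qed.

Lemma cont01M f g : cont01 f -> cont01 g -> cont01 (fun r => f r * g r).
Proof. by move=> cf cg x; apply: continuousM; [exact: cf|exact: cg]. Qed.

Lemma cont01N f : cont01 f -> cont01 (fun r => - f r).
Proof. by move=> cf x; apply: continuousN; exact: cf. Qed.

Lemma cont01_cst (c : R) : cont01 (fun=> c).
Proof. by move=> x; exact: cst_continuous. Qed.

Lemma cont01_id : cont01 id.
Proof. by apply: continuous_subspaceT => x; exact: cvg_id. Qed.

(** Replaces the limits e -> 0 of this calculus; e <= 1 allows products of two errors to be bounded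
    linearly in e, as in [fcalcM]. *)
Lemma le0_of_small (x C : R) :
  (forall e : R, 0 < e -> e <= 1 -> x <= C * e) -> x <= 0.
Proof.
move=> h; rewrite leNgt; apply/negP => x0.
have C0 : 0 < `|C| + 1 by rewrite ltr_wpDl.
pose e := Num.min 1 (x / (2 * (`|C| + 1))).
have e0 : 0 < e by rewrite lt_min ltr01 divr_gt0// mulr_gt0.
have := h _ e0; rewrite ge_min lexx => /(_ isT); apply/negP; rewrite -ltNge.
rewrite (@le_lt_trans _ _ ((`|C| + 1) * e))//.
  by rewrite ler_wpM2r ?(ltW e0)// (le_trans (ler_norm _))// lerDl.
rewrite mulrC -ltr_pdivlMr//.
rewrite (@le_lt_trans _ _ (x / (2 * (`|C| + 1))))//; first by rewrite ge_min lexx orbT.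
by rewrite ltr_pM2l// ltf_pV2 ?posrE ?mulr_gt0// ltr_pMl// ltr1n.
Qed.

Context {H : lmodType R} (dot : H -> H -> R).
Hypothesis hH : hilbert dot.
Variable L : {linear H -> H}.
Hypothesis Lsym : forall x y, dot (L x) y = dot x (L y).
Hypothesis Lge0 : forall x, 0 <= dot (L x) x.
Hypothesis Lle1 : forall x, dot (L x) x <= dot x x.
Implicit Types (x y : H).
Local Notation hn := (hnorm dot).

(** Says that y is f(L) x. Quantifying over all polynomials makes the value independent of an
    approximating sequence and gives the error bound at once. *)
Definition is_fcalc f x y := forall p e, 0 <= e -> dist01_le p f e ->
  hn (papp L p x - y) <= e * hn x.

Lemma papp_dist p q f a b x : dist01_le p f a -> dist01_le q f b ->
  hn (papp L p x - papp L q x) <= (a + b) * hn x.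
Proof.
move=> pa qb; rewrite -pappB.
have ab0 : 0 <= a + b.
  by apply: addr_ge0; [move: (pa 0)|move: (qb 0)]; rewrite lexx ler01 => /(_ isT);
    exact: le_trans.
apply: (papp_norm hH Lsym Lge0 Lle1) => // r r01; rewrite hornerD hornerN.
rewrite (le_trans (ler_distD (f r) _ _))// lerD//; first exact: pa.
by rewrite distrC; exact: qb.
Qed.

Lemma is_fcalc_ex f x : cont01 f -> exists y, is_fcalc f x y.
Proof.
move=> cf.
have /choice[p_ hp] n : exists p, dist01_le p f n.+1%:R^-1.
  by apply: weierstrass01.
have [y cy] : exists l, hn (papp L (p_ n) x - l) @[n --> \oo] --> 0.
  apply: (hcomplete hH) => e e0.
  have e2 : 0 < e / (2 * (hn x + 1)).
    by rewrite divr_gt0// mulr_gt0// ltr_wpDl// hnorm_ge0.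
  have [N _ hN] := near_infty_natSinv_lt (PosNum e2).
  exists N => m n Nm Nn; rewrite (le_lt_trans (papp_dist _ (hp m) (hp n)))//.
  have := hN m Nm; have := hN n Nn => /=.
  have := e2; set t := e / _ => t0; move: (m.+1%:R^-1) (n.+1%:R^-1) => a b bt at_.
  apply: (@le_lt_trans _ _ ((t + t) * hn x)).
    by rewrite ler_wpM2r ?hnorm_ge0// lerD// ltW.
  have -> : e = (t + t) * (hn x + 1).
    by rewrite /t; field; rewrite gt_eqF// ltr_wpDl// hnorm_ge0.
  by rewrite ltr_pM2l ?addr_gt0// ltrDl.
exists y => p e e0 pe; rewrite -subr_le0.
apply: (@le0_of_small _ (hn x + 1)) => d d0 d1.
have [N1 _ h1] := near_infty_natSinv_lt (PosNum d0).
move/cvgrPdist_lt : cy => /(_ _ d0) [N2 _ h2].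
pose n := maxn N1 N2.
have := h1 n (leq_maxl _ _) => /= n1.
have := h2 n (leq_maxr _ _) => /=.
rewrite sub0r normrN ger0_norm ?hnorm_ge0// => n2.
rewrite lerBlDr (le_trans (ler_hdistD hH (papp L (p_ n) x) _ _))//.
rewrite (le_trans (lerD (papp_dist x pe (hp n)) (ltW n2)))//.
have := ler_wpM2r (hnorm_ge0 dot x) (ltW n1).
by move: (n.+1%:R^-1) (hn x) => u v; nra.
Qed.

Definition fcalc f x : H := xget 0 [set y | is_fcalc f x y].

Lemma fcalcP f x : cont01 f -> is_fcalc f x (fcalc f x).
Proof. by move=> /(is_fcalc_ex x)[y hy]; exact: (xgetI 0 hy). Qed.

(** The tool for the algebraic rules: to identify f(L) x with y, exhibit polynomials approximating
    both f and y at a linear rate in e. *)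
Lemma fcalc_unique f x y (C D : R) : cont01 f -> 0 <= C ->
  (forall e : R, 0 < e -> e <= 1 ->
     exists2 p, dist01_le p f (C * e) & hn (papp L p x - y) <= D * e) ->
  fcalc f x = y.
Proof.
move=> cf C0 h; apply/eqP; rewrite -subr_eq0; apply/eqP/(hnorm0_eq0 hH)/eqP.
rewrite eq_le hnorm_ge0 andbT; apply: (@le0_of_small _ (C * hn x + D)) => e e0 e1.
have [p pf py] := h _ e0 e1.
rewrite (le_trans (ler_hdistD hH (papp L p x) _ _))// mulrDl lerD//.
by rewrite (hdistC hH) mulrAC fcalcP// mulr_ge0// ltW.
Qed.

Lemma fcalc_approx f : cont01 f -> forall e : R, 0 < e ->
  exists2 p, dist01_le p f e & forall x, hn (papp L p x - fcalc f x) <= e * hn x.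
Proof.
move=> cf e e0; have [p hp] := weierstrass01 cf e0.
by exists p => // x; apply: fcalcP => //; exact: ltW.
Qed.

Lemma fcalc_poly p x : fcalc (fun r => p.[r]) x = papp L p x.
Proof.
apply: (@fcalc_unique _ _ _ 1 1) => //.
  by apply: continuous_subspaceT => r; exact: continuous_horner.
move=> e e0 _; exists p; last by rewrite subrr (hnorm0 hH) mul1r ltW.
by move=> r _; rewrite subrr normr0 mul1r ltW.
Qed.

Lemma fcalc_cst c x : fcalc (fun=> c) x = c *: x.
Proof.
by rewrite -(pappC L) -fcalc_poly; congr fcalc; apply/funext => r; rewrite hornerC.
Qed.

Lemma fcalc_id x : fcalc id x = L x.
Proof.
by rewrite -(pappX L) -fcalc_poly; congr fcalc; apply/funext => r; rewrite hornerX.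
Qed.

Lemma fcalcD f g x : cont01 f -> cont01 g ->
  fcalc (fun r => f r + g r) x = fcalc f x + fcalc g x.
Proof.
move=> cf cg; apply: (@fcalc_unique _ _ _ 2 (2 * hn x)) => //; first exact: cont01D.
move=> e e0 _; have [p pf px] := fcalc_approx cf e0.
have [q qg qx] := fcalc_approx cg e0; exists (p + q).
  move=> r r01; rewrite hornerD opprD addrACA (le_trans (ler_normD _ _))//.
  by rewrite mulr_natl mulr2n lerD ?pf ?qg.
rewrite pappD opprD addrACA (le_trans (ler_hnormD hH _ _))//.
by rewrite -mulrA mulr_natl mulr2n (mulrC (hn x)) lerD ?px ?qx.
Qed.

Lemma fcalcM f g x : cont01 f -> cont01 g ->
  fcalc (fun r => f r * g r) x = fcalc f (fcalc g x).
Proof.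
move=> cf cg; have [M M0 hM] := itv01_bounded cf.
have [N N0 hN] := itv01_bounded cg.
have p_le p e r : e <= 1 -> dist01_le p f e -> 0 <= r <= 1 -> `|p.[r]| <= M + 1.
  move=> e1 pf r01; rewrite -(subrK (f r) p.[r]) addrC (le_trans (ler_normD _ _))//.
  by rewrite lerD ?hM// (le_trans _ e1)// pf.
apply: (@fcalc_unique _ _ _ (M + 1 + N) ((M + 1) * hn x + hn (fcalc g x))).
- exact: cont01M.
- by rewrite !addr_ge0.
move=> e e0 e1; have [p pf px] := fcalc_approx cf e0.
have [q qg qx] := fcalc_approx cg e0; exists (p * q).
  move=> r r01; rewrite hornerM.
  have -> : p.[r] * q.[r] - f r * g r = p.[r] * (q.[r] - g r) + (p.[r] - f r) * g r.
    by ring.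
  rewrite (le_trans (ler_normD _ _))// !normrM mulrDl lerD//.
    by rewrite ler_pM ?qg// (p_le p e).
  by rewrite mulrC ler_pM ?pf ?hN.
rewrite pappM (le_trans (ler_hdistD hH (papp L p (fcalc g x)) _ _))// mulrDl lerD//.
  rewrite -[_ - _]addrC -scaleN1r -papp_linear scaleN1r addrC.
  rewrite (le_trans (papp_norm hH Lsym Lge0 Lle1 (addr_ge0 M0 ler01) _ _))//.
    by move=> r; exact: p_le e1 pf.
  by rewrite -mulrA ler_wpM2l ?addr_ge0// mulrC qx.
by rewrite mulrC px.
Qed.

Lemma fcalcZ c f x : cont01 f -> fcalc (fun r => c * f r) x = c *: fcalc f x.
Proof. by move=> cf; rewrite fcalcM ?fcalc_cst//; exact: cont01_cst. Qed.

Lemma fcalcN f x : cont01 f -> fcalc (fun r => - f r) x = - fcalc f x.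
Proof.
move=> cf; rewrite -scaleN1r -fcalcZ//; congr fcalc.
by apply/funext => r; rewrite mulN1r.
Qed.

Lemma fcalc_linear f c x y : cont01 f ->
  fcalc f (c *: x + y) = c *: fcalc f x + fcalc f y.
Proof.
move=> cf; apply: (@fcalc_unique _ _ _ 1 (`|c| * hn x + hn y)) => // e e0 _.
have [p pf px] := fcalc_approx cf e0; exists p; first by rewrite mul1r.
rewrite papp_linear opprD addrACA -scalerBr (le_trans (ler_hnormD hH _ _))//.
rewrite mulrDl lerD//; last by rewrite mulrC px.
by rewrite (hnormZ hH) -mulrA ler_wpM2l// mulrC px.
Qed.

Lemma fcalc_sym f x y : cont01 f -> dot (fcalc f x) y = dot x (fcalc f y).
Proof.
move=> cf; apply/eqP; rewrite -subr_eq0 -normr_eq0 eq_le normr_ge0 andbT.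
apply: (@le0_of_small _ (2 * (hn x * hn y))) => e e0 _.
have [p pf px] := fcalc_approx cf e0.
rewrite -(subrKA (dot (papp L p x) y)) {2}(papp_sym hH Lsym).
rewrite -(dotBl hH) -(dotBr hH) (le_trans (ler_normD _ _))//.
rewrite (le_trans (lerD (cauchy_schwarz hH _ _) (cauchy_schwarz hH _ _)))//.
have := px x; rewrite (hdistC hH); have := px y.
by have := hnorm_ge0 dot x; have := hnorm_ge0 dot y; nra.
Qed.

Lemma fcalc_norm f M x : cont01 f -> 0 <= M ->
  (forall r : R, 0 <= r <= 1 -> `|f r| <= M) -> hn (fcalc f x) <= M * hn x.
Proof.
move=> cf M0 fM; rewrite -subr_le0.
apply: (@le0_of_small _ (2 * hn x)) => e e0 _.
have [p pf px] := fcalc_approx cf e0.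
have pM : hn (papp L p x) <= (M + e) * hn x.
  apply: (papp_norm hH Lsym Lge0 Lle1); first by rewrite addr_ge0// ltW.
  move=> r r01; rewrite -(subrK (f r) p.[r]) addrC (le_trans (ler_normD _ _))//.
  by rewrite lerD ?fM ?pf.
rewrite lerBlDr -(subrK (papp L p x) (fcalc f x)) (le_trans (ler_hnormD hH _ _))//.
have := px x; rewrite (hdistC hH); move: pM; move: (hn x) (hn _) (hn _) => a b c.
by lra.
Qed.

End ContinuousCalculus.

(** * The functions exp(-z (1/r - 1)) *)

Section ComplexExponential.
Context {R : realType}.
Local Notation normc := ComplexField.Normc.normc.
Local Notation Re := (@complex.Re R).
Local Notation Im := (@complex.Im R).
Implicit Types (z w : R[i]) (p q x : R).

Lemma mean_value_bound (f df : R -> R) q (M : R) :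
  (forall x, is_derive x 1 f (df x)) ->
  (forall x, `|x| <= `|q| -> `|df x| <= M) -> `|f q - f 0| <= M * `|q|.
Proof.
move=> fd dM.
have cf A : {within A, continuous f}.
  apply: continuous_subspaceT => x.
  by apply/differentiable_continuous/derivable1_diffP; case: (fd x).
have [q0|q0|->] := ltgtP q 0; last by rewrite subrr !normr0 mulr0.
- have [c /[!in_itv]/= /andP[qc c0] h] := MVT_segment (ltW q0) (fun x _ => fd x) (cf _).
  rewrite distrC h normrM sub0r normrN ler_wpM2r// dM//.
  by rewrite (ler0_norm c0) (ltr0_norm q0) lerN2.
have [c /[!in_itv]/= /andP[c0 cq] h] := MVT_segment (ltW q0) (fun x _ => fd x) (cf _).
rewrite h normrM subr0 ler_wpM2r// dM//.
by rewrite (ger0_norm c0) (gtr0_norm q0).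
Qed.

Lemma abs_sin_le1 x : `|sin x| <= 1.
Proof. by rewrite ler_norml sin_geN1 sin_le1. Qed.

Lemma abs_cos_le1 x : `|cos x| <= 1.
Proof. by rewrite ler_norml cos_geN1 cos_le1. Qed.

Lemma abs_sin_le x : `|sin x| <= `|x|.
Proof.
have := @mean_value_bound sin cos x 1 (fun x => is_derive_sin x).
by rewrite sin0 subr0 mul1r; apply => y _; exact: abs_cos_le1.
Qed.

Lemma abs_cosB1_le x : `|cos x - 1| <= `|x|.
Proof.
have := @mean_value_bound cos (fun x => - sin x) x 1 (fun x => is_derive_cos x).
by rewrite cos0 mul1r; apply => y _; rewrite normrN abs_sin_le1.
Qed.

Lemma abs_cosB1_le_sqr x : `|cos x - 1| <= x ^+ 2.
Proof.
have := @mean_value_bound cos (fun x => - sin x) x `|x| (fun x => is_derive_cos x).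
rewrite cos0 -expr2 real_normK ?num_real//; apply => y yx.
by rewrite normrN (le_trans (abs_sin_le _)).
Qed.

Lemma abs_sinB_le_sqr x : `|sin x - x| <= x ^+ 2.
Proof.
have d (y : R) : is_derive y (1 : R) (fun x : R => sin x - x) (cos y - 1) by exact: is_deriveB.
have := @mean_value_bound (fun x => sin x - x) (fun x => cos x - 1) x `|x| d.
rewrite sin0 !subr0 -expr2 real_normK ?num_real//; apply => y yx.
by rewrite (le_trans (abs_cosB1_le _)).
Qed.

Lemma expRB1_le x : expR x - 1 <= x * expR x.
Proof.
have := expR_ge1Dx (- x); rewrite -(ler_pM2r (expR_gt0 x)) -expRD addNr expR0.
by move: (expR x) => e; lra.
Qed.

Lemma abs_expRB1_le x : `|expR x - 1| <= `|x| * expR `|x|.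
Proof.
have h1 := expR_ge1Dx x; have h2 := expRB1_le x.
have [x0|x0] := leP 0 x.
  by rewrite !ger0_norm//; move: (expR x) h1 h2 => e; lra.
have e1 : expR x <= 1 by rewrite -expR0 ler_expR ltW.
have := expR_ge1Dx (- x).
rewrite (ltr0_norm x0) (@ler0_norm _ (expR x - 1)) ?subr_le0//.
by move: (expR x) (expR (- x)) h1 h2 e1 => e e'; nra.
Qed.

Lemma abs_expRB1D_le x : `|expR x - 1 - x| <= x ^+ 2 * expR `|x|.
Proof.
have h1 := expR_ge1Dx x; have h2 := expRB1_le x.
rewrite ger0_norm; last by move: (expR x) h1 => e; lra.
have h3 : x * (expR x - 1) <= `|x| * (`|x| * expR `|x|).
  rewrite (le_trans (ler_norm _))// normrM ler_wpM2l//; exact: abs_expRB1_le.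
rewrite -[x ^+ 2]real_normK ?num_real// expr2 -mulrA (le_trans _ h3)//.
by move: (expR x) h2 => e; lra.
Qed.

Definition cexp z : R[i] :=
  Complex (expR (Re z) * cos (Im z)) (expR (Re z) * sin (Im z)).

Lemma cexpD z w : cexp (z + w) = cexp z * cexp w.
Proof.
case: z w => [a b] [c d]; apply/eqP; rewrite eq_complex /=.
rewrite expRD cosD sinD; apply/andP; split; apply/eqP; ring.
Qed.

Lemma normc_cexp z : normc (cexp z) = expR (Re z).
Proof.
rewrite /cexp/= !exprMn -mulrDr addrC sin2cos2 subrK mulr1.
by rewrite sqrtr_sqr ger0_norm// expR_ge0.
Qed.

Lemma normc_sqr z : normc z ^+ 2 = Re z ^+ 2 + Im z ^+ 2.
Proof. by case: z => a b /=; rewrite sqr_sqrtr// addr_ge0 ?sqr_ge0. Qed.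

Lemma normc_ge0 z : 0 <= normc z.
Proof. by case: z => a b /=; exact: sqrtr_ge0. Qed.

Lemma normc_le z (e : R) : 0 <= e -> Re z ^+ 2 + Im z ^+ 2 <= e ^+ 2 -> normc z <= e.
Proof. by move=> e0; rewrite -normc_sqr ler_sqr ?nnegrE ?normc_ge0. Qed.

Lemma abs_Re_le z : `|Re z| <= normc z.
Proof.
rewrite -ler_sqr ?nnegrE ?normc_ge0// real_normK ?num_real// normc_sqr.
by rewrite lerDl sqr_ge0.
Qed.

Lemma abs_Im_le z : `|Im z| <= normc z.
Proof.
rewrite -ler_sqr ?nnegrE ?normc_ge0// real_normK ?num_real// normc_sqr.
by rewrite lerDr sqr_ge0.
Qed.

Lemma normc_le_abs z : normc z <= `|Re z| + `|Im z|.
Proof.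
apply: normc_le; first by rewrite addr_ge0.
by rewrite sqrrD !real_normK ?num_real// lerD2r lerDl mulrn_wge0// mulr_ge0.
Qed.

Lemma normc_real x : normc x%:C%C = `|x|.
Proof. by rewrite /= expr0n addr0 sqrtr_sqr. Qed.

Lemma normcM z w : normc (z * w) = normc z * normc w.
Proof. exact: ComplexField.Normc.normcM. Qed.

(** On this half plane no exponential factor is lost: with z = p + iq, the real part is at most |p|
    + |q| and the imaginary part at most |q|. *)
Lemma normc_cexpB1 z : Re z <= 0 -> normc (cexp z - 1) <= 3 * normc z.
Proof.
move=> z0; have hr := abs_Re_le z; have hi := abs_Im_le z.
rewrite (le_trans (normc_le_abs _))//.
case: z z0 hr hi => p q /= z0 hr hi.
have e1 : expR p <= 1 by rewrite -expR0 ler_expR.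
have e0 := expR_ge0 p.
have h1 : `|expR p * cos q - 1| <= `|p| + `|q|.
  have -> : expR p * cos q - 1 = (expR p - 1) * cos q + (cos q - 1) by ring.
  rewrite (le_trans (ler_normD _ _))// normrM lerD// ?abs_cosB1_le//.
  rewrite -[leRHS]mulr1 ler_pM ?abs_cos_le1// !ler0_norm// ?subr_le0//.
  by have := expR_ge1Dx p; move: (expR p) => e; lra.
have h2 : `|expR p * sin q| <= `|q|.
  rewrite normrM -[leRHS]mul1r ler_pM ?abs_sin_le// ger0_norm//.
rewrite oppr0 addr0.
by move: h1 h2; move: `|_ - 1| `|expR p * _| `|p| `|q| hr hi => a b c d; lra.
Qed.

Lemma normc_cexpB1D z :
  normc (cexp z - 1 - z) <= 3 * expR `|Re z| * normc z ^+ 2.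
Proof.
rewrite normc_sqr (le_trans (normc_le_abs _))//.
case: z => p q /=.
set E := expR `|p|.
have E1 : 1 + `|p| <= E by exact: expR_ge1Dx.
have h1 : `|expR p * cos q - 1 - p| <= p ^+ 2 * E + E * q ^+ 2.
  have -> : expR p * cos q - 1 - p = (expR p - 1 - p) * cos q + (1 + p) * (cos q - 1).
    by ring.
  rewrite (le_trans (ler_normD _ _))// !normrM lerD//.
    by rewrite -[leRHS]mulr1 ler_pM ?abs_cos_le1// abs_expRB1D_le.
  rewrite ler_pM ?abs_cosB1_le_sqr// (le_trans _ E1)// (le_trans (ler_normD _ _))//.
  by rewrite normr1.
have h2 : `|expR p * sin q - 0 - q| <= `|p| * E * `|q| + E * q ^+ 2.
  have -> : expR p * sin q - 0 - q = (expR p - 1) * sin q + (sin q - q) by ring.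
  rewrite (le_trans (ler_normD _ _))// !normrM lerD//.
    by rewrite ler_pM ?abs_expRB1_le ?abs_sin_le.
  rewrite (le_trans (abs_sinB_le_sqr _))// ler_peMl ?sqr_ge0//.
  by rewrite (le_trans _ E1)// lerDl.
rewrite (le_trans (lerD h1 h2))//.
have E0 : 0 <= E by exact: expR_ge0.
rewrite -[p ^+ 2]real_normK ?num_real// -[q ^+ 2]real_normK ?num_real//.
move: `|p| `|q| E E0 {h1 h2 E1} => a b E E0.
rewrite -subr_ge0.
(* The slack is E (2 a^2 - a b + b^2), written as a sum of squares. *)
have -> : 3 * E * (a ^+ 2 + b ^+ 2) - (a ^+ 2 * E + E * b ^+ 2 + (a * E * b + E * b ^+ 2))
  = E * ((3 / 2) * a ^+ 2 + (a - b) ^+ 2 / 2 + b ^+ 2 / 2) by field.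
apply: mulr_ge0 => //; apply: addr_ge0; last by rewrite divr_ge0 ?sqr_ge0.
by apply: addr_ge0; [rewrite mulr_ge0 ?sqr_ge0 ?divr_ge0|rewrite divr_ge0 ?sqr_ge0].
Qed.

(** From exp(sx) >= 1 + sx; the bound does not depend on x, which later makes estimates uniform in
    r. *)
Lemma linear_mul_expRN_le (s x : R) : 0 < s -> 0 <= x ->
  (1 + x) * expR (- (s * x)) <= 1 + s^-1.
Proof.
move=> s0 x0; rewrite expRN ler_pdivrMr ?expR_gt0//.
apply: (@le_trans _ _ ((1 + s^-1) * (1 + s * x))).
  rewrite -subr_ge0.
  have -> : (1 + s^-1) * (1 + s * x) - (1 + x) = s * x + s^-1 by field; rewrite gt_eqF.
  by rewrite addr_ge0 ?mulr_ge0 ?invr_ge0// ltW.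
by rewrite ler_wpM2l ?expR_ge1Dx// addr_ge0// invr_ge0 ltW.
Qed.

End ComplexExponential.

(** * Continuity and uniform estimates for the symbols of the semigroup *)

Section ResolventFunctions.
Context {R : realType}.
Local Notation normc := ComplexField.Normc.normc.
Local Notation Re := (@complex.Re R).
Local Notation Im := (@complex.Im R).
Implicit Types (z w : R[i]).

Lemma ReM z w : Re (z * w) = Re z * Re w - Im z * Im w.
Proof. by case: z => a b; case: w. Qed.

Lemma ImM z w : Im (z * w) = Re z * Im w + Im z * Re w.
Proof. by case: z => a b; case: w. Qed.

Lemma ReD z w : Re (z + w) = Re z + Re w.
Proof. by case: z => a b; case: w. Qed.

Lemma ImD z w : Im (z + w) = Im z + Im w.
Proof. by case: z => a b; case: w. Qed.

Lemma ReN z : Re (- z) = - Re z. Proof. by case: z. Qed.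

Lemma ImN z : Im (- z) = - Im z. Proof. by case: z. Qed.

Lemma ReZ (c : R) z : Re (c%:C%C * z) = c * Re z.
Proof. by rewrite ReM/= mul0r subr0. Qed.

Lemma ImZ (c : R) z : Im (c%:C%C * z) = c * Im z.
Proof. by rewrite ImM/= mul0r addr0. Qed.

Lemma complex_eq z w : Re z = Re w -> Im z = Im w -> z = w.
Proof. by case: z => a b; case: w => c d /= -> ->. Qed.

Lemma normc_opp z : normc (- z) = normc z.
Proof. by case: z => a b; rewrite /= !sqrrN. Qed.

Lemma cexp_real (x : R) : cexp x%:C%C = (expR x)%:C%C.
Proof. by apply: complex_eq; rewrite /= ?cos0 ?sin0 ?mulr1 ?mulr0. Qed.

Definition ccont (F : R -> R[i]) :=
  cont01 (fun r => Re (F r)) /\ cont01 (fun r => Im (F r)).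

Lemma ccontM F G : ccont F -> ccont G -> ccont (fun r => F r * G r).
Proof.
move=> [F1 F2] [G1 G2]; split; under eq_fun do rewrite ?ReM ?ImM.
  by apply: cont01D; [exact: cont01M|apply: cont01N; exact: cont01M].
by apply: cont01D; exact: cont01M.
Qed.

Lemma ccontD F G : ccont F -> ccont G -> ccont (fun r => F r + G r).
Proof.
by move=> [F1 F2] [G1 G2]; split; under eq_fun do rewrite ?ReD ?ImD;
  exact: cont01D.
Qed.

Lemma ccontN F : ccont F -> ccont (fun r => - F r).
Proof.
by move=> [F1 F2]; split; under eq_fun do rewrite ?ReN ?ImN; exact: cont01N.
Qed.

Lemma ccontB F G : ccont F -> ccont G -> ccont (fun r => F r - G r).
Proof. by move=> cF cG; apply: ccontD => //; exact: ccontN. Qed.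

Lemma ccont_cst z : ccont (fun=> z).
Proof. by split; exact: cont01_cst. Qed.

Lemma ccont_real f : cont01 f -> ccont (fun r => (f r)%:C%C).
Proof. by move=> cf; split => //; exact: cont01_cst. Qed.

(** With x = 1/r - 1 one has 1 + x = 1/r, so the hypothesis reads |h x| <= C r, and 0 is the limit
    at r = 0. *)
Lemma cont01_at_infty (h : R -> R) (C : R) : continuous h ->
  (forall x, 0 <= x -> `|h x| * (1 + x) <= C) ->
  cont01 (fun r => if 0 < r then h (r^-1 - 1) else 0).
Proof.
move=> ch hC; apply/subspace_continuousP => r; rewrite /= in_itv/= => /andP[r0 r1].
move: r0; rewrite le_eqVlt => /predU1P[<-|r0].
  rewrite /from_subspace ltxx; apply/cvgrPdist_lt => /= e e0; rewrite near_withinE.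
  have C1 : 0 < `|C| + 1 by rewrite ltr_wpDl.
  apply/nbhs_ballP; exists (e / (`|C| + 1)) => /=; first by rewrite divr_gt0.
  move=> y /=; rewrite /ball/= sub0r normrN => yd; rewrite in_itv/= => /andP[_ y1].
  rewrite sub0r normrN; case: ifPn => [y0|_]; last by rewrite normr0.
  have yl : 0 <= y^-1 - 1 by rewrite subr_ge0 invf_ge1.
  have := hC _ yl; rewrite subrKC ler_pdivrMr// => {}hC.
  rewrite (le_lt_trans hC)// (@le_lt_trans _ _ ((`|C| + 1) * y))//.
    by rewrite ler_wpM2r ?(ltW y0)// (le_trans (ler_norm _))// lerDl.
  by rewrite mulrC -ltr_pdivlMr// -[ltLHS]gtr0_norm.
rewrite /from_subspace r0; apply: cvg_within_filter.
have : h (s^-1 - 1) @[s --> r] --> h (r^-1 - 1).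
  apply: (@cvg_comp _ _ _ (fun s : R => s^-1 - 1) h); last exact: ch.
  apply: cvgB; last exact: cvg_cst.
  by apply: cvgV; [rewrite gt_eqF|exact: cvg_id].
apply: cvg_trans; apply: near_eq_cvg.
near=> s; have -> // : 0 < s.
by near: s; exact: lt_nbhsr.
Unshelve. all: by end_near.
Qed.

(* exp(-sz) as a function of r = 1/(1 + s); outside Re z > 0, only the value at
   z = 0 matters. *)
Definition resolvent_exp z (r : R) : R[i] :=
  if 0 < Re z then
    if 0 < r then cexp (- ((r^-1 - 1)%:C%C * z)) else 0
  else 1.

(* The derivative of [resolvent_exp z r] in z. *)
Definition resolvent_exp' z (r : R) : R[i] :=
  if 0 < r then - ((r^-1 - 1)%:C%C * cexp (- ((r^-1 - 1)%:C%C * z))) else 0.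

Lemma Re_if (b : bool) z w : Re (if b then z else w) = if b then Re z else Re w.
Proof. by case: b. Qed.

Lemma Im_if (b : bool) z w : Im (if b then z else w) = if b then Im z else Im w.
Proof. by case: b. Qed.

Lemma continuous_expRM_trig (s t : R) (g : R -> R) : continuous g ->
  continuous (fun x : R => expR (- (x * s)) * g (- (x * t))).
Proof.
move=> cg x.
have lin u : (fun x : R => - (x * u)) x @[x --> x] --> - (x * u).
  by apply: cvgN; apply: cvgMl; exact: cvg_id.
apply: cvgM.
  by apply: (@cvg_comp _ _ _ (fun x : R => - (x * s)) expR); [exact: lin|exact: continuous_expR].
by apply: (@cvg_comp _ _ _ (fun x : R => - (x * t)) g); [exact: lin|exact: cg].
Qed.

Lemma cont01_exp_decay (s t : R) (g : R -> R) : 0 < s -> continuous g ->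
  (forall x, `|g x| <= 1) ->
  cont01 (fun r => if 0 < r then
    expR (- ((r^-1 - 1) * s)) * g (- ((r^-1 - 1) * t)) else 0).
Proof.
move=> s0 cg g1.
apply: (@cont01_at_infty (fun x : R => expR (- (x * s)) * g (- (x * t))) (1 + s^-1)).
  exact: continuous_expRM_trig.
move=> x x0; rewrite (le_trans _ (linear_mul_expRN_le s0 x0))//.
rewrite mulrC normrM ler_wpM2l ?addr_ge0// ger0_norm ?expR_ge0// (mulrC s).
by rewrite ler_piMr ?expR_ge0.
Qed.

(** Two linear factors have to be absorbed, the x of the derivative and the 1 + x of
    [cont01_at_infty]; each takes half of the decay exp(-xs). *)
Lemma cont01_exp_decay' (s t : R) (g : R -> R) : 0 < s -> continuous g ->
  (forall x, `|g x| <= 1) ->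
  cont01 (fun r => if 0 < r then
    - ((r^-1 - 1) * (expR (- ((r^-1 - 1) * s)) * g (- ((r^-1 - 1) * t)))) else 0).
Proof.
move=> s0 cg g1.
apply: (@cont01_at_infty (fun x : R => - (x * (expR (- (x * s)) * g (- (x * t)))))
  ((1 + (s / 2)^-1) ^+ 2)).
  move=> x; apply: cvgN; apply: cvgM; first exact: cvg_id.
  exact: continuous_expRM_trig.
move=> x x0; have s2 : 0 < s / 2 by rewrite divr_gt0.
have h := linear_mul_expRN_le s2 x0.
rewrite normrN !normrM (ger0_norm x0) (ger0_norm (expR_ge0 _)).
have -> : - (x * s) = - (s / 2 * x) + - (s / 2 * x) by field.
rewrite expRD; have e0 := expR_ge0 (- (s / 2 * x)).
move: (expR _) e0 h => e e0 h.
rewrite (@le_trans _ _ (((1 + x) * e) ^+ 2))//; last first.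
  by rewrite ler_sqr ?nnegrE// ?(le_trans _ h)// mulr_ge0// addr_ge0.
have := g1 (- (x * t)); have := normr_ge0 (g (- (x * t))).
move: `|g _| => y y0 y1.
have -> : x * (e * e * y) * (1 + x) = (x * (1 + x) * e ^+ 2) * y by ring.
rewrite (@le_trans _ _ (x * (1 + x) * e ^+ 2))//.
  by rewrite ler_piMr// !mulr_ge0// addr_ge0.
rewrite exprMn ler_wpM2r ?sqr_ge0// expr2 ler_wpM2r ?addr_ge0//.
by rewrite lerDr.
Qed.

Lemma ccont_resolvent_exp z : 0 < Re z -> ccont (resolvent_exp z).
Proof.
move=> z0; rewrite /resolvent_exp z0; split.
  under eq_fun do rewrite Re_if/= ReN ReZ ImN ImZ.
  apply: cont01_exp_decay => //; [exact: continuous_cos|exact: abs_cos_le1].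
under eq_fun do rewrite Im_if/= ReN ReZ ImN ImZ.
apply: cont01_exp_decay => //; [exact: continuous_sin|exact: abs_sin_le1].
Qed.

Lemma ccont_resolvent_exp' z : 0 < Re z -> ccont (resolvent_exp' z).
Proof.
move=> z0; rewrite /resolvent_exp'; split.
  under eq_fun do rewrite Re_if ReN ReZ/= ReN ReZ ImN ImZ.
  apply: cont01_exp_decay' => //; [exact: continuous_cos|exact: abs_cos_le1].
under eq_fun do rewrite Im_if ImN ImZ/= ReN ReZ ImN ImZ.
apply: cont01_exp_decay' => //; [exact: continuous_sin|exact: abs_sin_le1].
Qed.

Lemma resolvent_expD z w r : 0 < Re z -> 0 < Re w ->
  resolvent_exp (z + w) r = resolvent_exp z r * resolvent_exp w r.
Proof.
move=> z0 w0; rewrite /resolvent_exp ReD addr_gt0// z0 w0.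
case: ifPn => _; last by rewrite mulr0.
by rewrite -cexpD mulrDr opprD.
Qed.

Lemma resolvent_exp_le1 z r : 0 < Re z -> 0 <= r <= 1 ->
  normc (resolvent_exp z r) <= 1.
Proof.
move=> z0 /andP[_ r1]; rewrite /resolvent_exp z0; case: ifPn => r0; last first.
  by rewrite ComplexField.Normc.normc0.
have l0 : 0 <= r^-1 - 1 by rewrite subr_ge0 invf_ge1.
by rewrite normc_cexp ReN ReZ -[leRHS]expR0 ler_expR oppr_le0 mulr_ge0// ltW.
Qed.

(** The symbol of (T(z) - 1) L: the factor r tames 1/r - 1, as r (1/r - 1) = 1 - r <= 1. This gives
    continuity at 0 on the range of L. *)
Lemma resolvent_exp_id z r : 0 < Re z -> 0 <= r <= 1 ->
  normc ((resolvent_exp z r - 1) * r%:C%C) <= 3 * normc z.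
Proof.
move=> z0 /andP[r0' r1]; rewrite /resolvent_exp z0; case: ifPn => r0; last first.
  have -> : r = 0 by apply/eqP; rewrite eq_le r0' leNgt r0.
  by rewrite mulr0 ComplexField.Normc.normc0 mulr_ge0// normc_ge0.
have l0 : 0 <= r^-1 - 1 by rewrite subr_ge0 invf_ge1.
rewrite normcM normc_real (gtr0_norm r0).
rewrite (le_trans (ler_wpM2r (ltW r0) (normc_cexpB1 _)))//.
  by rewrite ReN ReZ oppr_le0 mulr_ge0// ltW.
rewrite -mulrA ler_wpM2l// normc_opp normcM normc_real (ger0_norm l0).
rewrite mulrAC mulrBl mul1r mulVf ?gt_eqF// ler_piMl ?normc_ge0//.
by rewrite gerBl.
Qed.

(** With x = 1/r - 1, |h| <= Re z / 2 leaves the decay exp(-x Re z / 2), the square of exp(-x Re z /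
    4); each of these two factors absorbs one x of the Taylor remainder, uniformly in r. *)
Lemma resolvent_exp_deriv z : 0 < Re z -> exists2 K : R, 0 < K &
  forall h r, normc h <= Re z / 2 -> 0 < Re (z + h) -> 0 <= r <= 1 ->
  normc (resolvent_exp (z + h) r - resolvent_exp z r - h * resolvent_exp' z r) <=
    K * normc h ^+ 2.
Proof.
move=> z0; have s4 : 0 < Re z / 4 by rewrite divr_gt0.
have K0 : 0 < 1 + (Re z / 4)^-1 by rewrite addr_gt0// invr_gt0.
exists (3 * (1 + (Re z / 4)^-1) ^+ 2); first by rewrite mulr_gt0// exprn_gt0.
move=> h r hz zh0 /andP[_ r1]; rewrite /resolvent_exp /resolvent_exp' zh0 z0.
case: ifPn => r0; last first.
  rewrite mulr0 !subr0 ComplexField.Normc.normc0.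
  by rewrite mulr_ge0 ?sqr_ge0// mulr_ge0// exprn_ge0// ltW.
have : 0 <= r^-1 - 1 by rewrite subr_ge0 invf_ge1.
move: (r^-1 - 1) => x x0.
rewrite mulrDr opprD cexpD.
have -> : cexp (- (x%:C%C * z)) * cexp (- (x%:C%C * h)) - cexp (- (x%:C%C * z)) -
    h * - (x%:C%C * cexp (- (x%:C%C * z))) =
  cexp (- (x%:C%C * z)) * (cexp (- (x%:C%C * h)) - 1 - - (x%:C%C * h)).
  by ring.
rewrite normcM normc_cexp.
rewrite (le_trans (ler_wpM2l (expR_ge0 _) (normc_cexpB1D _)))//.
rewrite normc_opp normcM normc_real (ger0_norm x0).
rewrite !ReN !ReZ normrN normrM (ger0_norm x0).
have e1 : expR (- (x * Re z)) * expR (x * `|Re h|) <= expR (- (Re z / 4 * x)) ^+ 2.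
  rewrite -expRD expr2 -expRD ler_expR.
  have := le_trans (abs_Re_le h) hz; move: `|Re h| (Re z) x0 => a b x0 ab.
  by have := ler_wpM2l x0 ab; lra.
have e2 := linear_mul_expRN_le s4 x0.
move: (expR (- (Re z / 4 * x))) (expR_ge0 (- (Re z / 4 * x))) e1 e2 => E E0 e1 e2.
have -> : expR (- (x * Re z)) * (3 * expR (x * `|Re h|) * (x * normc h) ^+ 2) =
  3 * (expR (- (x * Re z)) * expR (x * `|Re h|) * x ^+ 2) * normc h ^+ 2 by ring.
rewrite ler_wpM2r ?sqr_ge0// ler_wpM2l//.
rewrite (le_trans (ler_wpM2r (sqr_ge0 _) e1))// -exprMn.
rewrite ler_sqr ?nnegrE ?mulr_ge0// ?(ltW K0)// (le_trans _ e2)// mulrC.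
by rewrite ler_wpM2r// lerDr.
Qed.

(* The symbol of (T(t) L - L) / t - (L - 1), where L = (1 + A)^-1 and thus
   - A L = L - 1. *)
Definition resolvent_quot (t r : R) : R[i] :=
  (t^-1)%:C%C * ((resolvent_exp t%:C%C r - 1) * r%:C%C) - (r%:C%C - 1).

Lemma ccont_resolvent_quot t : 0 < t -> ccont (resolvent_quot t).
Proof.
move=> t0; apply: ccontB.
  apply: ccontM; first exact: ccont_cst.
  apply: ccontM; last by apply: ccont_real; exact: cont01_id.
  by apply: ccontB; [exact: ccont_resolvent_exp|exact: ccont_cst].
by apply: ccontB; [apply: ccont_real; exact: cont01_id|exact: ccont_cst].
Qed.

(** The quotient does not tend to 0 uniformly, since its value at r = 0 is 1 for every t. It is
    bounded, and an extra factor r makes it O(t); density of the range of L then gives strong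
    convergence. *)
Lemma resolvent_quot_le t r : 0 < t -> 0 <= r <= 1 ->
  normc (resolvent_quot t r) <= 1 /\ normc (resolvent_quot t r * r%:C%C) <= t.
Proof.
move=> t0 /andP[r0' r1]; rewrite /resolvent_quot /resolvent_exp /= t0.
case: ifPn => r0; last first.
  have -> : r = 0 by apply/eqP; rewrite eq_le r0' leNgt r0.
  rewrite !rmorph0 !mulr0 !sub0r opprK ComplexField.Normc.normc0 (ltW t0).
  by rewrite ComplexField.Normc.normc1.
have x0 : 0 <= r^-1 - 1 by rewrite subr_ge0 invf_ge1.
have rx : r * (r^-1 - 1) = 1 - r by rewrite mulrBr divff ?mulr1// gt_eqF.
move: (r^-1 - 1) x0 rx => x x0 rx.
pose q := t^-1 * ((expR (- (x * t)) - 1) * r) - (r - 1).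
have -> : (t^-1)%:C%C * ((cexp (- (x%:C%C * t%:C%C)) - 1) * r%:C%C) - (r%:C%C - 1)
    = q%:C%C.
  rewrite -rmorphM/= -rmorphN/= cexp_real.
  by rewrite /q !(rmorphB, rmorphM, rmorph1).
rewrite normcM !normc_real (gtr0_norm r0).
(* Here r - 1 = - r x. The bracket lies between 0 and tx, and below (xt)^2, which yields q <= r x <=
   1 and q r <= t (r x)^2 <= t. *)
have qE : q = t^-1 * (r * (expR (- (x * t)) - 1 + t * x)).
  by rewrite /q -(opprB 1 r) -rx opprK; field; rewrite gt_eqF.
have E1 := expR_ge1Dx (- (x * t)); have E2 := expRB1_le (- (x * t)).
have E3 : expR (- (x * t)) <= 1 by rewrite -expR0 ler_expR oppr_le0 mulr_ge0// ltW.
have xt : 0 <= x * t by rewrite mulr_ge0// ltW.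
have q0 : 0 <= q.
  rewrite qE !mulr_ge0 ?invr_ge0 ?(ltW t0)//.
  by move: (expR _) E1 => E; lra.
rewrite (ger0_norm q0); split.
  apply: (@le_trans _ _ (1 - r)); last by rewrite gerBl.
  rewrite -rx qE mulrCA ler_wpM2l// mulrC ler_pdivrMr//.
  by move: (expR _) E3 => E; lra.
rewrite qE.
have -> : t^-1 * (r * (expR (- (x * t)) - 1 + t * x)) * r =
  t^-1 * (r ^+ 2 * (expR (- (x * t)) - 1 + t * x)) by ring.
have b : expR (- (x * t)) - 1 + t * x <= (x * t) ^+ 2.
  by move: (expR _) E1 E2 E3 => E; nra.
rewrite mulrC ler_pdivrMr// (le_trans (ler_wpM2l (sqr_ge0 _) b))//.
have -> : r ^+ 2 * (x * t) ^+ 2 = (r * x) ^+ 2 * (t * t) by ring.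
rewrite rx ler_piMl ?mulr_ge0 ?(ltW t0)// expr_le1// ?subr_ge0//.
by rewrite gerBl.
Qed.

End ResolventFunctions.

(** * The semigroup generated by minus a non negative self-adjoint operator *)

Section ComplexCalculus.
Context {R : realType} {H : lmodType R} (dot : H -> H -> R).
Hypothesis hH : hilbert dot.
Local Notation HC := (complexification H).
Local Notation N := (complexification_norm dot).
Local Notation normc := ComplexField.Normc.normc.
Local Notation Re := (@complex.Re R).
Local Notation Im := (@complex.Im R).
Implicit Types (x y : HC) (z w : R[i]) (F G : R -> R[i]).

Lemma complexification_eq x y : x.1 = y.1 -> x.2 = y.2 -> x = y.
Proof. by case: x => a b; case: y => c d /= -> ->. Qed.

Lemma fstD x y : (x + y).1 = x.1 + y.1. Proof. by []. Qed.
Lemma sndD x y : (x + y).2 = x.2 + y.2. Proof. by []. Qed.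
Lemma fstN x : (- x).1 = - x.1. Proof. by []. Qed.
Lemma sndN x : (- x).2 = - x.2. Proof. by []. Qed.
Lemma fstZ z x : (z *: x).1 = Re z *: x.1 - Im z *: x.2. Proof. by []. Qed.
Lemma sndZ z x : (z *: x).2 = Re z *: x.2 + Im z *: x.1. Proof. by []. Qed.
Definition complexificationE := (fstD, sndD, fstN, sndN, fstZ, sndZ).

(** Reduces identities between vectors to identities between reals, within reach of [ring]. *)
Lemma dot_inj (u v : H) : (forall h, dot u h = dot v h) -> u = v.
Proof.
move=> uv; apply/eqP; rewrite -subr_eq0; apply/eqP/(dot_eq0 hH).
by rewrite (dotBl hH) uv subrr.
Qed.

Lemma cnorm_ge0 x : 0 <= N x. Proof. exact: sqrtr_ge0. Qed.

Lemma cnorm_sqr x : N x ^+ 2 = dot x.1 x.1 + dot x.2 x.2.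
Proof. by rewrite sqr_sqrtr// addr_ge0 ?(dot_ge0 hH). Qed.

Lemma cnorm_le x (c : R) : 0 <= c -> dot x.1 x.1 + dot x.2 x.2 <= c ^+ 2 -> N x <= c.
Proof. by move=> c0; rewrite -cnorm_sqr ler_sqr ?nnegrE ?cnorm_ge0. Qed.

Lemma cnorm_fst x : hnorm dot x.1 <= N x.
Proof. by apply: (hnorm_le hH (cnorm_ge0 x)); rewrite cnorm_sqr lerDl (dot_ge0 hH). Qed.

Lemma cnorm_snd x : hnorm dot x.2 <= N x.
Proof. by apply: (hnorm_le hH (cnorm_ge0 x)); rewrite cnorm_sqr lerDr (dot_ge0 hH). Qed.

Lemma cnorm_le_sum x : N x <= hnorm dot x.1 + hnorm dot x.2.
Proof.
apply: cnorm_le; first by rewrite addr_ge0 ?hnorm_ge0.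
by rewrite sqrrD !(hnorm_sqr hH) lerD2r lerDl mulrn_wge0// mulr_ge0 ?hnorm_ge0.
Qed.

Lemma ler_cnormD x y : N (x + y) <= N x + N y.
Proof.
apply: cnorm_le; first by rewrite addr_ge0 ?cnorm_ge0.
rewrite sqrrD !cnorm_sqr !complexificationE !(dotE hH).
rewrite (dotC hH y.1) (dotC hH y.2).
have : dot x.1 y.1 + dot x.2 y.2 <= N x * N y; last first.
  by rewrite mulr2n; lra.
rewrite (le_trans (ler_norm _))// -ler_sqr ?nnegrE ?mulr_ge0 ?cnorm_ge0//.
rewrite real_normK ?num_real// exprMn !cnorm_sqr -!(hnorm_sqr hH).
rewrite (@le_trans _ _ ((hnorm dot x.1 * hnorm dot y.1 + hnorm dot x.2 * hnorm dot y.2) ^+ 2))//.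
  rewrite -ler_sqrt ?sqr_ge0// !sqrtr_sqr.
  rewrite [leRHS]ger0_norm ?addr_ge0 ?mulr_ge0 ?hnorm_ge0//.
  by rewrite (le_trans (ler_normD _ _))// lerD//; exact: (cauchy_schwarz hH).
move: (hnorm dot x.1) (hnorm dot x.2) (hnorm dot y.1) (hnorm dot y.2) => a b c d.
by have := sqr_ge0 (a * d - b * c); nra.
Qed.

Lemma cnormN x : N (- x) = N x.
Proof. by rewrite /complexification_norm !complexificationE !(dotE hH) !opprK. Qed.

Lemma cnorm0_eq0 x : N x = 0 -> x = 0.
Proof.
move=> x0; apply: complexification_eq; apply: (hnorm0_eq0 hH); apply/eqP;
  rewrite eq_le hnorm_ge0 andbT -x0; [exact: cnorm_fst|exact: cnorm_snd].
Qed.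

Variable L : {linear H -> H}.
Hypothesis Lsym : forall u v, dot (L u) v = dot u (L v).
Hypothesis Lge0 : forall u, 0 <= dot (L u) u.
Hypothesis Lle1 : forall u, dot (L u) u <= dot u u.
Local Notation fcalc := (fcalc dot L).

(* The value for discontinuous F makes [ccalc F] linear for all F. *)
Definition ccalc F x : HC := if `[< ccont F >] then
  (fcalc (fun r => Re (F r)) x.1 - fcalc (fun r => Im (F r)) x.2,
   fcalc (fun r => Re (F r)) x.2 + fcalc (fun r => Im (F r)) x.1) else x.

Lemma fst_ccalc F x : ccont F -> (ccalc F x).1 =
  fcalc (fun r => Re (F r)) x.1 - fcalc (fun r => Im (F r)) x.2.
Proof. by move=> /asboolP cF; rewrite /ccalc cF. Qed.

Lemma snd_ccalc F x : ccont F -> (ccalc F x).2 =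
  fcalc (fun r => Re (F r)) x.2 + fcalc (fun r => Im (F r)) x.1.
Proof. by move=> /asboolP cF; rewrite /ccalc cF. Qed.

Let flin := fcalc_linear hH Lsym Lge0 Lle1.

Lemma fcalc_comb f (c d : R) (u v t : H) : cont01 f ->
  fcalc f (c *: u + d *: v + t) = c *: fcalc f u + d *: fcalc f v + fcalc f t.
Proof. by move=> cf; rewrite -!addrA !flin. Qed.

Lemma ccalc_linear F : linear (ccalc F).
Proof.
move=> z x y; have [cF|ncF] := pselect (ccont F); last first.
  by rewrite /ccalc; case: asboolP.
have [cr ci] := cF.
apply: complexification_eq; rewrite !(fst_ccalc, snd_ccalc, complexificationE)//.
  rewrite -scaleNr !fcalc_comb//; apply: dot_inj => h; rewrite !(dotE hH); ring.
rewrite -scaleNr !fcalc_comb//; apply: dot_inj => h; rewrite !(dotE hH); ring.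
Qed.

Lemma dot_fcalc2 f g (u v : H) : cont01 f -> cont01 g ->
  dot (fcalc f u) (fcalc g v) = dot (fcalc (fun r => f r * g r) u) v.
Proof.
move=> cf cg; rewrite -(fcalc_sym hH Lsym Lge0 Lle1)// -(fcalcM hH Lsym Lge0 Lle1)//.
by under eq_fun do rewrite mulrC.
Qed.

(** Bounding real and imaginary parts separately would lose the constant, hence contractivity. For F
    = f + ig the cross terms cancel by symmetry, which leaves the forms of (f^2 + g^2)(L) at [x.1]
    and [x.2], and f^2 + g^2 = |F|^2. *)
Lemma ccalc_norm F (M : R) x : ccont F -> 0 <= M ->
  (forall r : R, 0 <= r <= 1 -> normc (F r) <= M) -> N (ccalc F x) <= M * N x.
Proof.
move=> cF M0 FM; have [cr ci] := cF.
apply: cnorm_le; first by rewrite mulr_ge0 ?cnorm_ge0.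
rewrite fst_ccalc// snd_ccalc//.
set f := fun r => Re (F r) in cr *; set g := fun r => Im (F r) in ci *.
have crr := cont01M cr cr; have cii := cont01M ci ci.
pose h r := f r * f r + g r * g r.
have hb u : dot (fcalc h u) u <= M ^+ 2 * dot u u.
  rewrite (le_trans (dot_le hH _ _))// -(hnorm_sqr hH u) expr2 mulrA.
  rewrite ler_wpM2r ?hnorm_ge0//; apply: (fcalc_norm hH Lsym Lge0 Lle1).
  - exact: cont01D.
  - exact: sqr_ge0.
  move=> r r01; rewrite ger0_norm /h; last by rewrite addr_ge0// -expr2 sqr_ge0.
  by rewrite -!expr2 -normc_sqr ler_sqr ?nnegrE ?normc_ge0// FM.
have hE u : dot (fcalc h u) u = dot (fcalc f u) (fcalc f u) + dot (fcalc g u) (fcalc g u).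
  by rewrite (fcalcD hH Lsym Lge0 Lle1)// (dotDl hH) -!dot_fcalc2.
rewrite exprMn cnorm_sqr mulrDr (le_trans _ (lerD (hb x.1) (hb x.2)))//.
rewrite !hE le_eqVlt; apply/orP; left; apply/eqP; rewrite !(dotE hH).
rewrite (dotC hH (fcalc g x.2)) (dotC hH (fcalc g x.1)).
rewrite (_ : dot (fcalc f x.2) (fcalc g x.1) = dot (fcalc f x.1) (fcalc g x.2)); first by ring.
rewrite (dot_fcalc2 x.2 x.1 cr ci) (dot_fcalc2 x.1 x.2 cr ci).
by rewrite (fcalc_sym hH Lsym Lge0 Lle1 _ _ (cont01M cr ci)) (dotC hH).
Qed.

Lemma ccalcD F G x : ccont F -> ccont G ->
  ccalc (fun r => F r + G r) x = ccalc F x + ccalc G x.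
Proof.
move=> cF cG; have cFG := ccontD cF cG; have [F1 F2] := cF; have [G1 G2] := cG.
apply: complexification_eq; rewrite !(fst_ccalc, snd_ccalc, complexificationE)//.
  under eq_fun do rewrite ReD; under [X in _ - fcalc X _]eq_fun do rewrite ImD.
  rewrite !(fcalcD hH Lsym Lge0 Lle1)//.
  by rewrite opprD addrACA.
under eq_fun do rewrite ReD; under [X in _ + fcalc X _]eq_fun do rewrite ImD.
rewrite !(fcalcD hH Lsym Lge0 Lle1)//.
by rewrite addrACA.
Qed.

Lemma ccalcM F G x : ccont F -> ccont G ->
  ccalc (fun r => F r * G r) x = ccalc F (ccalc G x).
Proof.
move=> cF cG; have cFG := ccontM cF cG; have [F1 F2] := cF; have [G1 G2] := cG.
have fM f g u : cont01 f -> cont01 g -> fcalc (fun r => f r * g r) u = fcalc f (fcalc g u).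
  exact: (fcalcM hH Lsym Lge0 Lle1).
have fD f u v : cont01 f -> fcalc f (u + v) = fcalc f u + fcalc f v.
  by move=> cf; rewrite -[u in LHS]scale1r flin// scale1r.
have fN f u : cont01 f -> fcalc f (- u) = - fcalc f u.
  move=> cf; have := flin (-1) u 0 cf; rewrite !scaleN1r addr0 => ->.
  suff -> : fcalc f 0 = 0 by rewrite addr0.
  by have := flin (-1) 0 0 cf; rewrite scaler0 addr0 scaleN1r addNr.
have reE u : fcalc (fun r => Re (F r * G r)) u =
   fcalc (fun r => Re (F r)) (fcalc (fun r => Re (G r)) u) -
   fcalc (fun r => Im (F r)) (fcalc (fun r => Im (G r)) u).
  under eq_fun do rewrite ReM.
  rewrite (fcalcD hH Lsym Lge0 Lle1)//; [|exact: cont01M|by apply: cont01N; exact: cont01M].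
  by rewrite (fcalcN hH Lsym Lge0 Lle1) ?fM//; exact: cont01M.
have imE u : fcalc (fun r => Im (F r * G r)) u =
   fcalc (fun r => Re (F r)) (fcalc (fun r => Im (G r)) u) +
   fcalc (fun r => Im (F r)) (fcalc (fun r => Re (G r)) u).
  under eq_fun do rewrite ImM.
  by rewrite (fcalcD hH Lsym Lge0 Lle1) ?fM//; exact: cont01M.
apply: complexification_eq; rewrite !(fst_ccalc, snd_ccalc, complexificationE)//;
  rewrite reE imE !fD// !fN//; apply: dot_inj => h; rewrite !(dotE hH); ring.
Qed.

Lemma ccalc_cst z x : ccalc (fun=> z) x = z *: x.
Proof.
have cz := ccont_cst z.
by apply: complexification_eq; rewrite !(fst_ccalc, snd_ccalc, complexificationE)//
  !(fcalc_cst hH Lsym Lge0 Lle1).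
Qed.

Lemma ccalcZ z F x : ccont F -> ccalc (fun r => z * F r) x = z *: ccalc F x.
Proof. by move=> cF; rewrite ccalcM ?ccalc_cst//; exact: ccont_cst. Qed.

Lemma ccalcB F G x : ccont F -> ccont G ->
  ccalc (fun r => F r - G r) x = ccalc F x - ccalc G x.
Proof.
move=> cF cG; rewrite ccalcD//; last exact: ccontN.
rewrite -scaleN1r -ccalcZ//; congr (_ + ccalc _ _).
by apply/funext => r; rewrite mulN1r.
Qed.

Lemma ccalc_id x : ccalc (fun r => r%:C%C) x = (L x.1, L x.2).
Proof.
have ci := ccont_real (@cont01_id R).
by apply: complexification_eq; rewrite !(fst_ccalc, snd_ccalc)//=
  !(fcalc_id hH Lsym Lge0 Lle1) !(fcalc_cst hH Lsym Lge0 Lle1) !scale0r ?subr0 ?addr0.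
Qed.

End ComplexCalculus.

(** * The semigroup and the identification of its generator *)

Section Generation.
Context {R : realType} {H : lmodType R} (dot : H -> H -> R).
Hypothesis hH : hilbert dot.
Local Notation HC := (complexification H).
Local Notation N := (complexification_norm dot).
Local Notation normc := ComplexField.Normc.normc.
Local Notation Re := (@complex.Re R).
Variable L : {linear H -> H}.
Hypothesis Lsym : forall u v, dot (L u) v = dot u (L v).
Hypothesis Lge0 : forall u, 0 <= dot (L u) u.
Hypothesis Lle1 : forall u, dot (L u) u <= dot u u.
Hypothesis Ldense : forall u (e : R), 0 < e -> exists v, hnorm dot (u - L v) < e.
Implicit Types (x y k : HC) (z w : R[i]).

HB.instance Definition _ F := GRing.isLinear.Build R[i] HC HC *:%R
  (ccalc dot L F) (ccalc_linear hH Lsym Lge0 Lle1 F).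

Definition resolvent_semigroup z : {linear HC -> HC} := ccalc dot L (resolvent_exp z).
Local Notation T := resolvent_semigroup.
Local Notation C1 := (ccalc dot L (fun r => r%:C%C)).

Let ci : ccont (fun r : R => r%:C%C) := ccont_real (@cont01_id R).

Lemma sector_Re_gt0 (theta : R) z : theta <= pi / 2 -> sector theta z -> 0 < Re z.
Proof.
move=> th [r [phi [r0 phi_lt ->]]] /=; rewrite mulr_gt0// cos_gt0_pihalf//.
by rewrite -ltr_norml (lt_le_trans phi_lt).
Qed.

Lemma resolvent_semigroup_le z x : 0 < Re z -> N (T z x) <= N x.
Proof.
move=> z0; rewrite -[leRHS]mul1r; apply: (ccalc_norm hH Lsym Lge0 Lle1) => //.
  exact: ccont_resolvent_exp.
by move=> r; exact: resolvent_exp_le1.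
Qed.

Lemma resolvent_semigroup0 x : T 0 x = x.
Proof.
have -> : T 0 x = ccalc dot L (fun=> 1) x.
  rewrite /resolvent_semigroup/=; congr ccalc.
  by apply/funext => r; rewrite /resolvent_exp/= ltxx.
by rewrite (ccalc_cst hH Lsym Lge0 Lle1) scale1r.
Qed.

Lemma resolvent_semigroupD z w x : 0 < Re z -> 0 < Re w -> T (z + w) x = T z (T w x).
Proof.
move=> z0 w0; rewrite /resolvent_semigroup/=.
have -> : resolvent_exp (z + w) = fun r => resolvent_exp z r * resolvent_exp w r.
  by apply/funext => r; exact: resolvent_expD.
by rewrite (ccalcM hH Lsym Lge0 Lle1)//; exact: ccont_resolvent_exp.
Qed.

Lemma resolvent_semigroup_analytic : analytic_on N (sector (pi / 2)) T.
Proof.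
move=> z /(sector_Re_gt0 (lexx _)) z0.
have cE := ccont_resolvent_exp z0; have cE' := ccont_resolvent_exp' z0.
have bounded' : bounded_operator N (ccalc dot L (resolvent_exp' z)).
  have [cr cim] := cE'.
  have [M1 M10 hM1] := itv01_bounded cr; have [M2 M20 hM2] := itv01_bounded cim.
  exists (M1 + M2) => x; apply: (ccalc_norm hH Lsym Lge0 Lle1) => //.
    exact: addr_ge0.
  by move=> r r01; rewrite (le_trans (normc_le_abs _))// lerD ?hM1 ?hM2.
exists (ccalc dot L (resolvent_exp' z)) => // e e0.
have [K K0 hK] := resolvent_exp_deriv z0.
exists (Num.min (Re z / 2) (e / K)); first by rewrite lt_min !divr_gt0.
move=> h; rewrite lt_min => /andP[h1 h2] /(sector_Re_gt0 (lexx _)) zh0 x.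
have cEh := ccont_resolvent_exp zh0.
rewrite /resolvent_semigroup/= -(ccalcZ hH Lsym Lge0 Lle1)// -(ccalcB hH Lsym Lge0 Lle1)//.
have chE' : ccont (fun r => h * resolvent_exp' z r) by apply: ccontM => //; exact: ccont_cst.
rewrite -(ccalcB hH Lsym Lge0 Lle1)//; last exact: ccontB.
apply: (ccalc_norm hH Lsym Lge0 Lle1).
- by apply: ccontB => //; exact: ccontB.
- by rewrite mulr_ge0 ?normc_ge0// ltW.
move=> r r01; rewrite (le_trans (hK h r (ltW h1) zh0 r01))//.
rewrite expr2 mulrA ler_wpM2r ?normc_ge0// mulrC -ler_pdivlMr//.
exact: ltW.
Qed.

Lemma cdense x (e : R) : 0 < e -> exists k, N (x - C1 k) < e.
Proof.
move=> e0; have e2 : 0 < e / 2 by rewrite divr_gt0.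
have [v1 h1] := Ldense x.1 e2; have [v2 h2] := Ldense x.2 e2.
exists (v1, v2); rewrite (ccalc_id hH Lsym Lge0 Lle1).
by rewrite (le_lt_trans (cnorm_le_sum hH _))// (splitr e) ltrD.
Qed.

(** Contractivity handles the distance from x to the range of L and [resolvent_exp_id] handles the
    range, so d is the same for the whole half plane. *)
Lemma resolvent_semigroup_cvg x (e : R) : 0 < e -> exists2 d : R, 0 < d &
  forall z, 0 < Re z -> normc z < d -> N (T z x - x) < e.
Proof.
move=> e0; have e3 : 0 < e / 3 by rewrite divr_gt0.
have [k hk] := cdense x e3.
have k1 : 0 < N k + 1 by rewrite ltr_wpDl ?cnorm_ge0.
exists (e / 3 / (3 * (N k + 1))); first by rewrite divr_gt0// mulr_gt0.
move=> z z0 zd; have cE := ccont_resolvent_exp z0.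
have c1 := ccont_cst (1 : R[i]).
have h : N (T z (C1 k) - C1 k) <= 3 * normc z * N k.
  rewrite /resolvent_semigroup/=.
  have -> : ccalc dot L (resolvent_exp z) (C1 k) - C1 k =
      ccalc dot L (fun r => (resolvent_exp z r - 1) * r%:C%C) k.
    rewrite (ccalcM hH Lsym Lge0 Lle1)//; last exact: ccontB.
    by rewrite (ccalcB hH Lsym Lge0 Lle1)// (ccalc_cst hH Lsym Lge0 Lle1) scale1r.
  apply: (ccalc_norm hH Lsym Lge0 Lle1).
  - by apply: ccontM => //; exact: ccontB.
  - by rewrite mulr_ge0 ?normc_ge0.
  by move=> r; exact: resolvent_exp_id.
have -> : T z x - x = T z (x - C1 k) + (T z (C1 k) - C1 k) - (x - C1 k).
  by rewrite linearB addrA subrK opprB addrA subrK.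
rewrite (le_lt_trans (ler_cnormD hH _ _))// cnormN//.
have h3 : N (T z (x - C1 k)) <= N (x - C1 k) by exact: resolvent_semigroup_le.
have h4 : 3 * normc z * N k < e / 3.
  rewrite (@le_lt_trans _ _ (normc z * (3 * (N k + 1))))//.
    rewrite mulrAC mulrC ler_wpM2l ?normc_ge0// ler_wpM2l// lerDl//.
  by rewrite -ltr_pdivlMr// mulr_gt0.
have := ler_cnormD hH (T z (x - C1 k)) (T z (C1 k) - C1 k).
move: (N _) (N (_ + _)) (N (_ - C1 k)) (N (x - _)) h h3 h4 hk => a b c d.
by lra.
Qed.

Lemma resolvent_quot_cvg k (e : R) : 0 < e -> exists2 d : R, 0 < d &
  forall t : R, 0 < t -> t < d -> N (ccalc dot L (resolvent_quot t) k) < e.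
Proof.
move=> e0; have e2 : 0 < e / 2 by rewrite divr_gt0.
have [m hm] := cdense k e2.
have m1 : 0 < N m + 1 by rewrite ltr_wpDl ?cnorm_ge0.
exists (e / 2 / (N m + 1)); first by rewrite divr_gt0.
move=> t t0 td; have cq := ccont_resolvent_quot t0.
rewrite -(subrK (C1 m) k) linearD (le_lt_trans (ler_cnormD hH _ _))//.
rewrite (splitr e) ltr_leD//.
  rewrite (le_lt_trans _ hm)// -[leRHS]mul1r.
  apply: (ccalc_norm hH Lsym Lge0 Lle1) => // r r01.
  by have [] := resolvent_quot_le t0 r01.
rewrite /= -(ccalcM hH Lsym Lge0 Lle1)//.
apply: (@le_trans _ _ (t * N m)).
  apply: (ccalc_norm hH Lsym Lge0 Lle1); [exact: ccontM|exact: ltW|].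
  by move=> r r01; have [] := resolvent_quot_le t0 r01.
apply: (@le_trans _ _ (t * (N m + 1))); first by rewrite ler_wpM2l ?(ltW t0)// lerDl.
by rewrite -ler_pdivlMr// ltW.
Qed.

Lemma resolvent_quotE k (t : R) : 0 < t -> ccalc dot L (resolvent_quot t) k =
  (t^-1)%:C%C *: (T t%:C%C (C1 k) - C1 k) - (C1 k - k).
Proof.
move=> t0; have cE : ccont (resolvent_exp t%:C%C) by exact: ccont_resolvent_exp.
have c1 := ccont_cst (1 : R[i]).
have cE1 := ccontB cE c1; have ci1 := ccontB ci c1; have cEi := ccontM cE1 ci.
rewrite /resolvent_quot (ccalcB hH Lsym Lge0 Lle1)//; last first.
  by apply: ccontM => //; exact: ccont_cst.
rewrite (ccalcZ hH Lsym Lge0 Lle1)// (ccalcM hH Lsym Lge0 Lle1)//.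
rewrite !(ccalcB hH Lsym Lge0 Lle1)//.
by rewrite !(ccalc_cst hH Lsym Lge0 Lle1) !scale1r.
Qed.

Lemma generator_resolvent k : generator N T (C1 k) (C1 k - k).
Proof.
apply/cvgrPdist_lt => /= e e0; have [d d0 hd] := resolvent_quot_cvg k e0.
near=> t; have t0 : 0 < t by near: t; exact: nbhs_right_gt.
rewrite sub0r normrN ger0_norm ?cnorm_ge0// -resolvent_quotE//.
by apply: hd => //; near: t; exact: nbhs_right_lt.
Unshelve. all: by end_near.
Qed.

Lemma generator_unique x y y' : generator N T x y -> generator N T x y' -> y = y'.
Proof.
move=> gy gy'; apply/eqP; rewrite -subr_eq0; apply/eqP/(cnorm0_eq0 hH)/eqP.
rewrite eq_le cnorm_ge0 andbT; apply: (@le0_of_small _ _ 2) => e e0 _.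
move/cvgrPdist_lt : gy => /(_ _ e0) gy; move/cvgrPdist_lt : gy' => /(_ _ e0) gy'.
near (0 : R)^'+ => t.
have : `|0 - N ((t^-1)%:C%C *: (T t%:C%C x - x) - y)| < e by near: t.
have : `|0 - N ((t^-1)%:C%C *: (T t%:C%C x - x) - y')| < e by near: t.
rewrite !sub0r !normrN !(ger0_norm (cnorm_ge0 _ _)).
set v := _ *: _ => h1 h2.
have -> : y - y' = (v - y') - (v - y).
  by rewrite opprB [RHS]addrC addrA subrK.
rewrite (le_trans (ler_cnormD hH _ _))// cnormN//.
by rewrite mulr_natl mulr2n lerD// ltW.
Unshelve. all: by end_near.
Qed.

Lemma generator_resolventP x y : generator N T x y <-> x = C1 (x - y).
Proof.
split=> [g|xE]; last first.
  by have := generator_resolvent (x - y); rewrite -xE opprB subrKC.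
(* L commutes with the semigroup and does not increase norms, so it maps generator pairs to
   generator pairs. By [generator_resolvent] the value at [C1 x] is also [C1 x - x], and uniqueness
   of the value concludes. *)
have : generator N T (C1 x) (C1 y).
  apply: (@squeeze_cvgr _ _ _ _ (fun=> 0) _ _ _ _ _ g); last exact: cvg_cst.
  near=> t; rewrite cnorm_ge0/=.
  have t0 : 0 < t by near: t; exact: nbhs_right_gt.
  have cE : ccont (resolvent_exp t%:C%C) by exact: ccont_resolvent_exp.
  have -> : T t%:C%C (C1 x) = C1 (T t%:C%C x).
    rewrite /resolvent_semigroup/= -!(ccalcM hH Lsym Lge0 Lle1)//.
    by congr ccalc; apply/funext => r; rewrite mulrC.
  rewrite -linearB -linearZ -linearB -[leRHS]mul1r.
  apply: (ccalc_norm hH Lsym Lge0 Lle1) => // r /andP[r0 r1].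
  by rewrite normc_real ger0_norm.
move=> /(generator_unique (generator_resolvent x)) h.
by rewrite linearB/= -h opprB subrKC.
Unshelve. all: by end_near.
Qed.

Lemma resolvent_semigroup_generates (A : operator H) :
  (forall u f, A u f <-> u = L (u + f)) ->
  generates_contractive_analytic_semigroup N (pi / 2)
    (complexify_operator (opp_operator A)).
Proof.
move=> hA; exists T; split.
- split.
  + move=> z /(sector_Re_gt0 (lexx _)) z0; exists 1 => x.
    by rewrite mul1r; exact: resolvent_semigroup_le.
  + exact: resolvent_semigroup0.
  + move=> z w x /(sector_Re_gt0 (lexx _)) z0 /(sector_Re_gt0 (lexx _)) w0.
    exact: resolvent_semigroupD.
  + exact: resolvent_semigroup_analytic.
  + move=> theta x e /andP[_ thlt] e0.
    have [d d0 hd] := resolvent_semigroup_cvg x e0.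
    by exists d => // z /(sector_Re_gt0 (ltW thlt)); exact: hd.
- by move=> z x /(sector_Re_gt0 (lexx _)); exact: resolvent_semigroup_le.
move=> x y; apply: (iff_trans _ (iff_sym (generator_resolventP x y))).
rewrite (ccalc_id hH Lsym Lge0 Lle1) /complexify_operator /opp_operator !hA.
split=> [[h1 h2]|h]; first exact: complexification_eq.
by split; rewrite [in LHS]h.
Qed.

End Generation.

Theorem self_adjoint_generates {R : realType} {H : lmodType R} (dot : H -> H -> R)
    (A : operator H) : hilbert dot -> linear_operator A ->
  dense_subset dot (dom A) -> self_adjoint dot A -> nonnegative_operator dot A ->
  generates_contractive_analytic_semigroup (complexification_norm dot) (pi / 2)
    (complexify_operator (opp_operator A)).
Proof.
move=> hH lA dA sA nnA; have [Afun A0 Alin] := lA.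
have /choice[f hf] := nonnegative_resolvent_onto hH lA sA nnA.
(* Injectivity of 1 + A: A maps u - v to its opposite, so nonnegativity forces u - v = 0. Thus f is
   the resolvent. *)
have Ainj u v y : A u (y - u) -> A v (y - v) -> u = v.
  move=> Au Av; have := Alin (-1) _ _ _ _ Av Au; rewrite !scaleN1r.
  have -> : - (y - v) + (y - u) = - (- v + u) by rewrite !opprB opprD opprK addrA addrC subrK addrC.
  move=> /nnA; rewrite (dotNl hH) oppr_ge0 => h.
  have : - v + u = 0.
    by apply: (dot_eq0 hH); apply/eqP; rewrite eq_le h (dot_ge0 hH).
  by move/eqP; rewrite addrC subr_eq0 => /eqP.
have flin : linear f.
  move=> c y z; apply: (Ainj _ _ (c *: y + z)) => //.
  have := Alin c _ _ _ _ (hf y) (hf z).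
  by rewrite scalerBr addrACA -opprD.
pose L : {linear H -> H} := HB.pack f (GRing.isLinear.Build R H H *:%R f flin).
have fsym u v : dot (f u) v = dot u (f v).
  have := (sA _ _).1 (hf v) _ _ (hf u).
  rewrite !(dotE hH) => h.
  by have : dot u (f v) = dot (f u) v; [move: h; lra|].
have AfE u g : A u g <-> u = f (u + g).
  split=> [Aug|uE]; last by have := hf (u + g); rewrite -uE addrAC subrr add0r.
  by apply: (Ainj _ _ (u + g)) => //; rewrite addrAC subrr add0r.
(* As A (f u) = u - f u, adding |f u|^2 gives L >= 0 and adding |u - f u|^2 gives L <= 1. *)
have Age0 u : 0 <= dot (u - f u) (f u) by exact: nnA (hf u).
apply: (@resolvent_semigroup_generates R H dot hH L) => //.
- move=> u; have := Age0 u; have := dot_ge0 hH (f u); rewrite !(dotE hH) (dotC hH (f u)).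
  by rewrite /=; lra.
- move=> u; have := Age0 u; have := dot_ge0 hH (u - f u).
  by rewrite !(dotE hH) (dotC hH (f u)) /=; lra.
(* The range of L is the domain of A, as v = f (v + g) whenever A v = g. *)
- move=> u e e0; have [v [g Avg] hv] := dA u e e0.
  by exists (v + g) => /=; rewrite -(AfE v g).1.
Qed.

(** * Integrable functions on (0,1) *)

Section IntegralsOn01.
Context {R : realType}.
Local Notation mu := (@lebesgue_measure R).
Implicit Types f g h : R -> R.

Let ae_filter : Filter (nbhs (almost_everywhere mu)).
Proof. exact: (@ae_filter_ringOfSetsType _ _ _ mu). Qed.
#[local] Existing Instance ae_filter.

Definition L1 f := mu.-integrable I01 (EFin \o f).
Definition int01 f : R := \int[mu]_(x in I01) f x.
Definition aeq f g := ae_eq mu I01 f g.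
Definition mf f := measurable_fun I01 f.

Lemma mI01 : measurable (I01 : set R). Proof. exact: measurable_itv. Qed.

Lemma muI01 : mu I01 = 1%E.
Proof. by rewrite lebesgue_measure_itv/= lte_fin ltr01 oppr0 adde0. Qed.

Lemma L1_mf f : L1 f -> mf f.
Proof. by move=> /integrableP[/measurable_EFinP]. Qed.

Lemma aeq_sym f g : aeq f g -> aeq g f. Proof. exact: ae_eq_sym. Qed.

Lemma aeq_trans f g h : aeq f g -> aeq g h -> aeq f h.
Proof. exact: ae_eq_trans. Qed.

Lemma aeq_in f g : (forall x, I01 x -> f x = g x) -> aeq f g.
Proof. by move=> fg; apply: aeW => x; exact: fg. Qed.

Lemma L1_aeq f g : L1 f -> mf g -> aeq f g -> L1 g.
Proof.
move=> Lf mg fg; apply/integrableP; split; first exact/measurable_EFinP.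
case/integrableP : (Lf) => mf' flt.
rewrite (_ : (\int[mu]_(x in I01) `|(EFin \o g) x|)%E =
    (\int[mu]_(x in I01) `|(EFin \o f) x|)%E)//.
apply: ae_eq_integral.
- exact: mI01.
- by apply: measurableT_comp => //; exact/measurable_EFinP.
- exact: measurableT_comp.
- by move: fg; apply: filterS => x fg Ix /=; rewrite fg.
Qed.

Lemma int01_aeq f g : mf f -> mf g -> aeq f g -> int01 f = int01 g.
Proof.
move=> mf_ mg fg; congr fine; apply: ae_eq_integral => //.
- exact/measurable_EFinP.
- exact/measurable_EFinP.
- by move: fg; apply: filterS => x fg Ix; rewrite fg.
Qed.

Lemma eq_int01 f g : (forall x, I01 x -> f x = g x) -> int01 f = int01 g.
Proof. by move=> fg; apply: eq_Rintegral => x; rewrite inE => /fg. Qed.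

Lemma L1D f g : L1 f -> L1 g -> L1 (fun x => f x + g x).
Proof.
move=> Lf Lg; rewrite /L1 (_ : _ \o _ = (EFin \o f) \+ (EFin \o g))%E.
  by apply: integrableD => //; exact: measurable_itv.
by apply/funext => x /=; rewrite EFinD.
Qed.

Lemma L1N f : L1 f -> L1 (fun x => - f x).
Proof.
move=> Lf; rewrite /L1 (_ : _ \o _ = -%E \o (EFin \o f))%E.
  by apply: integrableN => //; exact: measurable_itv.
by apply/funext => x /=; rewrite EFinN.
Qed.

Lemma L1B f g : L1 f -> L1 g -> L1 (fun x => f x - g x).
Proof. by move=> Lf Lg; apply: L1D => //; exact: L1N. Qed.

Lemma L1Z c f : L1 f -> L1 (fun x => c * f x).
Proof.
move=> Lf; rewrite /L1 (_ : _ \o _ = (fun x => c%:E * (EFin \o f) x)%E).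
  by apply: integrableZl => //; exact: measurable_itv.
by apply/funext => x /=; rewrite EFinM.
Qed.

Lemma L1_bounded f (M : R) : mf f -> (forall x, I01 x -> `|f x| <= M) -> L1 f.
Proof.
move=> mf_ fM; apply: measurable_bounded_integrable => //.
  by rewrite (_ : _ _ = 1%E) ?ltry//; exact: muI01.
exists M; split; first exact: num_real.
by move=> N MN x /= Ix; rewrite (le_trans (fM x Ix))// ltW.
Qed.

Lemma L1_cst (c : R) : L1 (fun=> c).
Proof. by apply: (@L1_bounded _ `|c|) => //; exact: measurable_cst. Qed.

Lemma mfM f g : mf f -> mf g -> mf (fun x => f x * g x).
Proof. exact: measurable_funM. Qed.

Lemma L1_le f g : mf f -> L1 g -> (forall x, I01 x -> `|f x| <= g x) -> L1 f.
Proof.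
move=> mf_ Lg fg; apply: (@le_integrable _ _ R mu _ _ _ (EFin \o g)) => //.
  exact/measurable_EFinP.
move=> x Ix /=; rewrite lee_fin (le_trans (fg x Ix))//; exact: ler_norm.
Qed.

Lemma L1M_bounded f g (M : R) : L1 f -> mf g -> (forall x, I01 x -> `|g x| <= M) ->
  L1 (fun x => f x * g x).
Proof.
move=> Lf mg gM; apply: (@L1_le _ (fun x => M * `|f x|)).
- by apply: mfM => //; exact: L1_mf.
- by apply: L1Z; exact: integrable_norm.
by move=> x Ix; rewrite normrM mulrC ler_wpM2r// gM.
Qed.

Lemma int01D f g : L1 f -> L1 g -> int01 (fun x => f x + g x) = int01 f + int01 g.
Proof. by move=> Lf Lg; apply: RintegralD => //; exact: mI01. Qed.

Lemma int01Z c f : L1 f -> int01 (fun x => c * f x) = c * int01 f.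
Proof. by move=> Lf; apply: RintegralZl => //; exact: mI01. Qed.

Lemma int01N f : L1 f -> int01 (fun x => - f x) = - int01 f.
Proof.
move=> Lf; rewrite -mulN1r -int01Z//; apply: eq_int01 => x _.
by rewrite mulN1r.
Qed.

Lemma int01B f g : L1 f -> L1 g -> int01 (fun x => f x - g x) = int01 f - int01 g.
Proof. by move=> Lf Lg; rewrite int01D ?int01N//; exact: L1N. Qed.

Lemma int01_ge0 f : (forall x, I01 x -> 0 <= f x) -> 0 <= int01 f.
Proof. by move=> f0; rewrite /int01; exact: Rintegral_ge0. Qed.

Lemma le_int01 f g : L1 f -> L1 g -> (forall x, I01 x -> f x <= g x) ->
  int01 f <= int01 g.
Proof. by move=> Lf Lg fg; apply: le_Rintegral => //; exact: mI01. Qed.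

Lemma int01_cst c : int01 (fun=> c) = c.
Proof.
rewrite /int01 Rintegral_cst; last exact: mI01.
by rewrite -[RHS]mulr1; congr (_ * _); exact: (congr1 fine muI01).
Qed.

Lemma int01_EFin f : L1 f -> (int01 f)%:E = (\int[mu]_(x in I01) (f x)%:E)%E.
Proof. by move=> Lf; rewrite fineK//; apply: integrable_fin_num Lf; exact: mI01. Qed.

Lemma int01_eq0_ae f : L1 f -> (forall x, I01 x -> 0 <= f x) -> int01 f = 0 ->
  aeq f (fun=> 0).
Proof.
move=> Lf f0 if0.
have : (\int[mu]_(x in I01) `|(f x)%:E|)%E = 0%E.
  transitivity ((int01 f)%:E); last by rewrite if0.
  rewrite int01_EFin//; apply: eq_integral => x; rewrite inE => Ix.
  by rewrite gee0_abs// lee_fin f0.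
move=> /(ae_eq_integral_abs mu mI01 (measurable_int mu Lf)).
by apply: filterS => x h Ix; have := h Ix => -[].
Qed.

Lemma ae_neq (c : R) : {ae mu, forall x, x != c}.
Proof.
exists [set c]; split; first exact: measurable_set1.
  exact: lebesgue_measure_set1.
by move=> x /= /negP; rewrite negbK => /eqP.
Qed.

Lemma cont_mf f : {within `[0, 1], continuous f} -> mf f.
Proof.
move=> cf; have m01 : measurable (`[0, 1]%classic : set R) by exact: measurable_itv.
have := subspace_continuous_measurable_fun m01 cf; apply: measurable_funS => //.
exact: subset_itv_oo_cc.
Qed.

Lemma cont_bounded f : {within `[0, 1], continuous f} ->
  exists2 M : R, 0 <= M & forall x, `[0, 1]%classic x -> `|f x| <= M.
Proof.
by move=> /itv01_bounded[M M0 hM]; exists M => // x; rewrite /= in_itv; exact: hM.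
Qed.

Lemma cont_L1 f : {within `[0, 1], continuous f} -> L1 f.
Proof.
move=> cf; have [M _ hM] := cont_bounded cf.
apply: (@L1_bounded _ M); first exact: cont_mf.
by move=> x Ix; apply: hM; exact: subset_itv_oo_cc Ix.
Qed.

Lemma L1M_cont f g : L1 f -> {within `[0, 1], continuous g} -> L1 (fun x => f x * g x).
Proof.
move=> Lf cg; have [M _ hM] := cont_bounded cg.
apply: (@L1M_bounded _ _ M) => //; first exact: cont_mf.
by move=> x Ix; apply: hM; exact: subset_itv_oo_cc Ix.
Qed.

End IntegralsOn01.

(** * Completeness of the weighted L^2 space *)

Section WeightedL2.
Context {R : realType}.
Local Notation mu := (@lebesgue_measure R).

Let ae_filter : Filter (nbhs (almost_everywhere mu)).
Proof. exact: (@ae_filter_ringOfSetsType _ _ _ mu). Qed.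
#[local] Existing Instance ae_filter.

Variables (a : R -> R) (x0 : R) (Ma : R).
Hypothesis a_gt0 : forall x, I01 x -> x != x0 -> 0 < a x.
Hypothesis a_x0 : a x0 = 0.
Hypothesis a_mf : mf a.
Hypothesis a_le : forall x, I01 x -> a x <= Ma.
Hypothesis a_inv : L1 (fun x => (a x)^-1).
Implicit Types u v w : L2w a.
Implicit Types f g : R -> R.

Definition sqw f := sq_integrable (fun x => (a x)^-1) f.

Lemma a_ge0 x : I01 x -> 0 <= a x.
Proof. by move=> Ix; have [->|/(a_gt0 Ix)/ltW//] := eqVneq x x0; rewrite a_x0. Qed.

Lemma ainv_ge0 x : I01 x -> 0 <= (a x)^-1.
Proof. by move=> /a_ge0; rewrite invr_ge0. Qed.

Lemma ae_a_gt0 : {ae mu, forall x, I01 x -> 0 < a x}.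
Proof. by apply: filterS (ae_neq x0) => x xx0 Ix; exact: a_gt0. Qed.

Lemma sqw_mf f : sqw f -> mf f. Proof. by case. Qed.

Lemma sqw_L1 f g : sqw f -> sqw g -> L1 (fun x => f x * g x / a x).
Proof. exact: sq_integrableM. Qed.

Lemma sqw_L1sqr f : sqw f -> L1 (fun x => f x ^+ 2 / a x). Proof. by case. Qed.

Lemma sqw_lin c f g : sqw f -> sqw g -> sqw (fun x => c * f x + g x).
Proof. exact: sq_integrable_lin. Qed.

Lemma sqwD f g : sqw f -> sqw g -> sqw (fun x => f x + g x).
Proof.
move=> sf sg; have := sqw_lin 1 sf sg.
by under eq_fun do rewrite mul1r.
Qed.

Lemma sqwB f g : sqw f -> sqw g -> sqw (fun x => f x - g x).
Proof.
move=> sf sg; have := sqw_lin (-1) sg sf.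
by under eq_fun do rewrite mulN1r addrC.
Qed.

Lemma sqw_aeq f g : sqw f -> mf g -> aeq f g -> sqw g.
Proof.
move=> [mf_ lf] mg fg; split => //.
apply: (L1_aeq lf).
  apply: mfM; first exact: measurable_funX.
  exact: L1_mf a_inv.
by move: fg; apply: filterS => x fg Ix; rewrite fg.
Qed.

Lemma sqw_bounded f (M : R) : mf f -> (forall x, I01 x -> `|f x| <= M) -> sqw f.
Proof.
move=> mf_ fM; split => //; apply: (@L1_le _ _ (fun x => M ^+ 2 * (a x)^-1)).
- by apply: mfM; [exact: measurable_funX|exact: L1_mf a_inv].
- exact: L1Z.
move=> x Ix; rewrite normrM (ger0_norm (ainv_ge0 Ix)) ler_wpM2r ?ainv_ge0//.
by rewrite normrX ler_sqr ?nnegrE ?fM// (le_trans _ (fM x Ix)).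
Qed.

(** Because f^2 = (f^2 / a) a with a bounded. The unweighted condition in [in_L2w] thus follows from
    the weighted one, and only [sqw] has to be checked. *)
Lemma sqw_in_L2w f : sqw f -> in_L2w a f.
Proof.
move=> sf; split => //; case: sf => mf_ lf; split => //.
apply: (L1_aeq (f := fun x => f x ^+ 2 / a x * a x)).
- apply: (@L1M_bounded _ _ _ Ma) => // x Ix.
  by rewrite ger0_norm ?a_ge0// a_le.
- by apply: mfM; [exact: measurable_funX|exact: measurable_cst].
apply: filterS ae_a_gt0 => x ax Ix /=.
by rewrite mulfVK ?mulr1// gt_eqF// ax.
Qed.

(** The constant 1 lies in the weighted space as 1/a is integrable. This is what makes fourth
    derivatives integrable on all of (0,1). *)
Lemma sqw_L1_div f : sqw f -> L1 (fun x => f x / a x).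
Proof.
move=> sf; have s1 : sqw (fun=> 1).
  by apply: (@sqw_bounded _ 1) => [|x _]; [exact: measurable_cst|rewrite normr1].
by have := sqw_L1 sf s1; under eq_fun do rewrite mulr1.
Qed.

Lemma in_L2w_sqw f : in_L2w a f -> sqw f. Proof. by case. Qed.

Lemma L2w_sqw u : sqw u.
Proof.
apply: in_L2w_sqw.
exact/asboolP/(L2wfunP (repr u)).
Qed.

Lemma L2w_mf u : mf u. Proof. exact: sqw_mf (L2w_sqw u). Qed.

Lemma L2w_classP f : sqw f -> f \in L2w_pred a.
Proof. by move=> sf; apply/asboolP; exact: sqw_in_L2w. Qed.

Definition L2w_class f (sf : sqw f) : L2w a :=
  \pi_(L2w a)%qT (Build_L2wfun (L2w_classP sf)).

Lemma L2w_class_aeq f (sf : sqw f) : @aeq R (L2w_class sf) f.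
Proof. exact: L2w_pi_ae. Qed.

Lemma L2wD_aeq u v : @aeq R (u + v : L2w a) (fun x => u x + v x).
Proof.
rewrite -[u in u + _]reprK -[v in _ + v]reprK -L2w_piD.
exact: L2w_pi_ae.
Qed.

Lemma L2wZ_aeq c u : @aeq R (c *: u : L2w a) (fun x => c * u x).
Proof. exact: L2w_pi_ae. Qed.

Lemma L2w0_aeq : @aeq R (0 : L2w a) (fun=> 0).
Proof.
have -> : 0 = \pi_(L2w a)%qT (0 : L2wfun a) :> L2w a by rewrite piE.
exact: L2w_pi_ae.
Qed.

Lemma L2wN_aeq u : @aeq R (- u : L2w a) (fun x => - u x).
Proof.
rewrite -scaleN1r; apply: filterS (L2wZ_aeq (-1) u) => x h Ix.
by rewrite h// mulN1r.
Qed.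

Lemma L2wB_aeq u v : @aeq R (u - v : L2w a) (fun x => u x - v x).
Proof.
move: (L2wD_aeq u (- v)) (L2wN_aeq v); apply: filterS2 => x h1 h2 Ix.
by rewrite h1// h2.
Qed.

Lemma L2w_lin_aeq c u v : @aeq R (c *: u + v : L2w a) (fun x => c * u x + v x).
Proof.
move: (L2wD_aeq (c *: u) v) (L2wZ_aeq c u); apply: filterS2 => x h1 h2 Ix.
by rewrite h1// h2.
Qed.

Lemma L2w_dot_aeq u v f g : sqw f -> sqw g -> @aeq R u f -> @aeq R v g ->
  L2w_dot a u v = int01 (fun x => f x * g x / a x).
Proof.
move=> sf sg uf vg; apply: int01_aeq.
- exact: L1_mf (sqw_L1 (L2w_sqw u) (L2w_sqw v)).
- exact: L1_mf (sqw_L1 sf sg).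
by move: uf vg; apply: filterS2 => x h1 h2 Ix; rewrite h1// h2.
Qed.

Lemma L2w_dot_eq0 u : L2w_dot a u u = 0 -> u = 0.
Proof.
move=> u0; apply: eq_L2w.
have h : @aeq R (fun x => u x * u x / a x) (fun=> 0).
  apply: int01_eq0_ae => //; first exact: sqw_L1 (L2w_sqw u) (L2w_sqw u).
  by move=> x Ix; rewrite -expr2 mulr_ge0 ?sqr_ge0 ?ainv_ge0.
apply: (@aeq_trans R _ (fun=> 0)); last exact: aeq_sym L2w0_aeq.
move: h ae_a_gt0; apply: filterS2 => x h ax Ix.
have /eqP := h Ix; rewrite mulf_eq0 invr_eq0 (gt_eqF (ax Ix)) orbF -expr2.
by rewrite sqrf_eq0 => /eqP.
Qed.

Lemma L2w_inner_product : inner_product (L2w_dot a).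
Proof.
split.
- move=> c u v w.
  rewrite (L2w_dot_aeq (sqw_lin c (L2w_sqw u) (L2w_sqw v)) (L2w_sqw w)
    (L2w_lin_aeq c u v) (ae_eq_refl _ _ _)).
  have Lu := sqw_L1 (L2w_sqw u) (L2w_sqw w); have Lv := sqw_L1 (L2w_sqw v) (L2w_sqw w).
  rewrite /L2w_dot -!/(int01 _) -int01Z// -int01D//; last exact: L1Z.
  by apply: eq_int01 => x _; rewrite mulrDl mulrDl !mulrA.
- by move=> u v; apply: eq_int01 => x _; congr (_ * _); exact: mulrC.
- move=> u; apply: int01_ge0 => x Ix.
  by rewrite -expr2 mulr_ge0 ?sqr_ge0 ?ainv_ge0.
exact: L2w_dot_eq0.
Qed.

Lemma L2w_dist_sqr u v : L2w_dot a (u - v) (u - v) =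
  int01 (fun x => (u x - v x) ^+ 2 / a x).
Proof.
have suv := sqwB (L2w_sqw u) (L2w_sqw v).
by rewrite (L2w_dot_aeq suv suv (L2wB_aeq u v) (L2wB_aeq u v)).
Qed.

(** Young's inequality with a free parameter. [ae_cvg_of_fast] takes c = 2^k, so that squared norms
    4^-k turn into the summable bound 2^-k (1 + int 1/a). *)
Lemma int01_abs_div_le f (c : R) : 0 < c -> sqw f ->
  L1 (fun x => `|f x| / a x) /\
  int01 (fun x => `|f x| / a x) <=
    c * int01 (fun x => f x ^+ 2 / a x) + c^-1 * int01 (fun x => (a x)^-1).
Proof.
move=> c0 sf; have Lf := sqw_L1sqr sf.
have Lc : L1 (fun x => c * (f x ^+ 2 / a x) + c^-1 * (a x)^-1).
  by apply: L1D; apply: L1Z.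
have fle x : I01 x -> `|f x| / a x <= c * (f x ^+ 2 / a x) + c^-1 * (a x)^-1.
  move=> Ix; rewrite mulrA -mulrDl ler_wpM2r ?ainv_ge0//.
  rewrite -[f x ^+ 2]real_normK ?num_real//.
  rewrite -subr_ge0.
  have -> : c * `|f x| ^+ 2 + c^-1 - `|f x| =
      c * (`|f x| - c^-1 / 2) ^+ 2 + c^-1 * (3 / 4).
    by field; rewrite gt_eqF.
  by rewrite addr_ge0// mulr_ge0 ?sqr_ge0 ?invr_ge0 ?(ltW c0)//; lra.
have La : L1 (fun x => `|f x| / a x).
  apply: (L1_le _ Lc).
    apply: mfM; last exact: L1_mf a_inv.
    by apply: measurableT_comp => //; exact: sqw_mf.
  by move=> x Ix; rewrite ger0_norm ?fle// mulr_ge0 ?ainv_ge0.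
split => //; rewrite -int01Z// -int01Z// -int01D; [|exact: L1Z|exact: L1Z].
exact: le_int01.
Qed.

Local Notation hn := (hnorm (L2w_dot a)).
Let ip := L2w_inner_product.

Lemma geometric_half_le n : \sum_(0 <= k < n) (2^-1 : R) ^+ k <= 2.
Proof.
suff -> : \sum_(0 <= k < n) (2^-1 : R) ^+ k = 2 - 2 * 2^-1 ^+ n.
  by rewrite gerBl mulr_ge0 ?exprn_ge0.
elim: n => [|n IH]; first by rewrite big_nil expr0 mulr1 subrr.
by rewrite big_nat_recr//= IH exprS; field.
Qed.

Lemma L2w_fast_subsequence (u_ : nat -> L2w a) :
  (forall e : R, 0 < e -> exists N, forall m n, (N <= m)%N -> (N <= n)%N ->
     hn (u_ m - u_ n) < e) ->
  exists2 phi : nat -> nat, {homo phi : k n / (k <= n)%N} &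
    forall k m, (phi k <= m)%N -> hn (u_ m - u_ (phi k)) < 2^-1 ^+ k.
Proof.
move=> cu.
have /choice[N hN] k : exists N, forall m n, (N <= m)%N -> (N <= n)%N ->
    hn (u_ m - u_ n) < 2^-1 ^+ k.
  by apply: cu; rewrite exprn_gt0.
(* Partial sums of the thresholds are nondecreasing and dominate each threshold. *)
exists (fun k => \sum_(j < k.+1) N j)%N => [|k m km].
  apply: homo_leq => [k|l k n|k]; [exact: leqnn|exact: leq_trans|].
  by rewrite [leqRHS]big_ord_recr leq_addr.
have Nk : (N k <= \sum_(j < k.+1) N j)%N by rewrite big_ord_recr leq_addl.
by apply: hN => //; exact: leq_trans km.
Qed.

(* Riesz-Fischer; finiteness of the measure dx/a turns the summability of the
   norms of the increments into almost everywhere absolute convergence. *)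
Lemma ae_cvg_of_fast (v : nat -> L2w a) :
  (forall k, hn (v k.+1 - v k) <= 2^-1 ^+ k) ->
  exists E : set R, [/\ measurable E, {ae mu, forall x, I01 x -> E x} &
    forall x, E x -> cvgn (fun k => v k x)].
Proof.
move=> hv.
pose d k x := `|v k.+1 x - v k x| / a x.
have sv k : sqw (fun x => v k.+1 x - v k x) by apply: sqwB; exact: L2w_sqw.
have d0 k x : I01 x -> 0 <= d k x by move=> Ix; rewrite mulr_ge0 ?ainv_ge0.
pose C := 1 + int01 (fun x => (a x)^-1).
have Ld k : L1 (d k) /\ int01 (d k) <= C * 2^-1 ^+ k.
  have c0 : 0 < (2 : R) ^+ k by rewrite exprn_gt0.
  have [Ld le_d] := int01_abs_div_le c0 (sv k); split => //.
  rewrite (le_trans le_d)// -exprVn mulrDl mul1r mulrC.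
  rewrite (mulrC (2^-1 ^+ k)) lerD2r -L2w_dist_sqr -(hnorm_sqr ip).
  have := hv k; rewrite -(ler_sqr) ?nnegrE ?hnorm_ge0 ?exprn_ge0// => h.
  rewrite (le_trans (ler_wpM2r (ltW c0) h))// expr2 -mulrA -exprMn mulVf//.
  by rewrite expr1n mulr1.
have md k : measurable_fun I01 (fun x => (d k x)%:E).
  by apply/measurable_EFinP; apply: L1_mf; case: (Ld k).
pose D x := (\sum_(0 <= k <oo) (d k x)%:E)%E.
have mD : measurable_fun I01 D.
  by apply: ge0_emeasurable_sum => // k x Ix _; rewrite lee_fin d0.
have D0 x : I01 x -> (0 <= D x)%E.
  by move=> Ix; apply: nneseries_ge0 => k _ _; rewrite lee_fin d0.
have intD : mu.-integrable I01 D.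
  apply/integrableP; split => //.
  have -> : (\int[mu]_(x in I01) `|D x|)%E = (\int[mu]_(x in I01) D x)%E.
    by apply: eq_integral => x /[!inE] Ix; rewrite gee0_abs// D0.
  rewrite integral_nneseries//.
  apply: (@le_lt_trans _ _ (C * 2)%:E); last exact: ltry.
  apply: lime_le.
    apply: is_cvg_nneseries => k _ _; apply: integral_ge0 => x Ix.
    by rewrite lee_fin d0.
  apply: nearW => n.
  rewrite (eq_bigr (fun k => (int01 (d k))%:E)); last first.
    by move=> k _; rewrite int01_EFin//; case: (Ld k).
  rewrite sumEFin lee_fin (@le_trans _ _ (\sum_(0 <= k < n) C * 2^-1 ^+ k))//.
    by apply: ler_sum => k _; case: (Ld k).
  rewrite -mulr_sumr ler_wpM2l ?geometric_half_le// addr_ge0//.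
  by apply: int01_ge0 => x; exact: ainv_ge0.
(* The point x0 is removed since (a x0)^-1 is 0 by convention: finiteness of D there says nothing
   about the increments. *)
exists ((I01 `&` [set x | D x \is a fin_num]) `&` [set~ x0]); split.
- apply: measurableI; first by apply: emeasurable_fin_num.
  by apply: measurableC; exact: measurable_set1.
- have aeD : {ae mu, forall x, I01 x -> D x \is a fin_num}.
    by apply: integrable_ae intD; exact: measurable_itv.
  move: aeD (ae_neq x0).
  by apply: filterS2 => x h xx0 Ix; split; [split=> //; exact: h|exact/eqP].
move=> x [[Ix Dx] /eqP xx0]; have ax := a_gt0 Ix xx0.
pose s k := v k.+1 x - v k x.
have sD n : \sum_(0 <= k < n) `|s k| <= a x * fine (D x).
  have -> : \sum_(0 <= k < n) `|s k| = a x * \sum_(0 <= k < n) d k x.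
    rewrite mulr_sumr; apply: eq_bigr => k _.
    by rewrite /d mulrCA divff ?mulr1// gt_eqF.
  rewrite ler_pM2l// -lee_fin fineK// -sumEFin.
  by apply: nneseries_lim_ge => k _; rewrite lee_fin d0.
have cs : cvgn (series s).
  apply: normed_cvg; apply: nondecreasing_is_cvgn.
    by apply: nondecreasing_series => n _ _; exact: normr_ge0.
  by exists (a x * fine (D x)) => _ [n _ <-]; exact: sD.
have -> : (fun k => v k x) = (fun k => series s k + v 0%N x).
  apply/funext => k; rewrite /series/= telescope_sumr// subrK//.
by apply: is_cvgD => //; exact: is_cvg_cst.
Qed.

Lemma L2w_hilbert : hilbert (L2w_dot a).
Proof.
split => // u_ /L2w_fast_subsequence[phi phi_le hphi].
pose v k : L2w a := u_ (phi k).
have hv k n : (k <= n)%N -> hn (v n - v k) <= 2^-1 ^+ k.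
  by move=> kn; apply/ltW/hphi/phi_le.
have [E [mE aeE cE]] := ae_cvg_of_fast (fun k => hv k k.+1 (leqnSn k)).
(* Cutting off outside E makes the sequence converge everywhere, so that its limit is measurable. *)
pose w k x : R := v k x * \1_E x.
pose V : R -> R := fun x => limn (fun k => w k x).
have cw x : w k x @[k --> \oo] --> V x.
  rewrite /V /w indicE; have [Ex|nEx] := pselect (E x).
    by rewrite mem_set// -[cvg_to _ _]/(cvgn _); under eq_fun do rewrite mulr1; exact: cE.
  by rewrite memNset// -[cvg_to _ _]/(cvgn _); under eq_fun do rewrite mulr0; exact: is_cvg_cst.
have mw k : mf (w k).
  by apply: mfM; [exact: L2w_mf|exact: measurable_indic].
have mV : mf V by apply: (measurable_fun_cvg mw) => x _; exact: cw.
have vw k : @aeq R (v k) (w k).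
  by move: aeE; apply: filterS => x Ex Ix; rewrite /w indicE mem_set ?mulr1//; exact: Ex.
have sw k : sqw (w k) := sqw_aeq (L2w_sqw (v k)) (mw k) (vw k).
have mVw k : mf (fun x => (V x - w k x) ^+ 2 / a x).
  apply: mfM; last exact: L1_mf a_inv.
  by apply: (measurable_funX 2); exact: (measurable_funB mV (mw k)).
(* Fatou's lemma applied to the differences w_(n+k) - w_k as n grows; it also shows that V is in the
   space. *)
have bound k : (\int[mu]_(x in I01) ((V x - w k x) ^+ 2 / a x)%:E <=
    ((2^-1 ^+ k) ^+ 2)%:E)%E.
  pose f n x := ((w (n + k)%N x - w k x) ^+ 2 / a x)%:E.
  have snk n : sqw (fun x => w (n + k)%N x - w k x) by exact: sqwB.
  have mfn n : measurable_fun I01 (f n).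
    by apply/measurable_EFinP; apply: L1_mf; exact: sqw_L1sqr.
  have f0 n x : I01 x -> (0 <= f n x)%E.
    by move=> Ix; rewrite lee_fin mulr_ge0 ?sqr_ge0 ?ainv_ge0.
  have := fatou mu (measurable_itv _) mfn f0.
  have -> : (\int[mu]_(x in I01) limn_einf (f^~ x) =
      \int[mu]_(x in I01) ((V x - w k x) ^+ 2 / a x)%:E)%E.
    apply: eq_integral => x _.
    have cf : f n x @[n --> \oo] --> ((V x - w k x) ^+ 2 / a x)%:E.
      apply: cvg_EFin; first exact: nearW.
      apply: cvgMl; under eq_fun do rewrite expr2; rewrite expr2.
      have cs : (w (n + k)%N x - w k x) @[n --> \oo] --> V x - w k x.
        by apply: cvgB; [rewrite (cvg_shiftn k (w^~ x)); exact: cw|exact: cvg_cst].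
      exact: cvgM.
    by rewrite is_cvg_limn_einfE; [apply: cvg_lim => //; exact: cf|exact: cvgP cf].
  move=> /le_trans; apply; rewrite limn_einf_lim; apply: lime_le.
    exact: is_cvg_einfs.
  apply: nearW => n; apply: (@le_trans _ _ (\int[mu]_(x in I01) f n x)%E).
    by apply: ereal_inf_lbound; exists n => //=.
  rewrite -int01_EFin; last exact: sqw_L1sqr.
  rewrite lee_fin.
  have -> : int01 (fun x => (w (n + k)%N x - w k x) ^+ 2 / a x) =
      L2w_dot a (v (n + k)%N - v k) (v (n + k)%N - v k).
    have h : @aeq R (v (n + k)%N - v k : L2w a) (fun x => w (n + k)%N x - w k x).
      move: (L2wB_aeq (v (n + k)%N) (v k)) (vw (n + k)%N) (vw k).
      by apply: filterS3 => x h1 h2 h3 Ix; rewrite h1// h2// h3.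
    by rewrite (L2w_dot_aeq (snk n) (snk n) h h).
  rewrite -(hnorm_sqr ip) ler_sqr ?nnegrE ?hnorm_ge0 ?exprn_ge0//.
  by apply: hv; exact: leq_addl.
have sVw k : sqw (fun x => V x - w k x).
  split; first exact: (measurable_funB mV (mw k)).
  apply/integrableP; split; first by apply/measurable_EFinP; exact: mVw.
  rewrite (_ : (\int[mu]_(x in I01) _)%E =
    (\int[mu]_(x in I01) ((V x - w k x) ^+ 2 / a x)%:E)%E).
    by rewrite (le_lt_trans (bound k))// ltry.
  apply: eq_integral => x /[!inE] Ix /=.
  by rewrite ger0_norm// mulr_ge0 ?sqr_ge0 ?ainv_ge0.
have sV : sqw V.
  apply: (sqw_aeq (sqwD (sVw 0%N) (sw 0%N)) mV).
  by apply: aeq_in => x _; rewrite subrK.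
pose l := L2w_class sV.
have hl k : hn (v k - l) <= 2^-1 ^+ k.
  rewrite (hdistC ip); apply: (hnorm_le ip); first by rewrite exprn_ge0.
  have h : @aeq R (l - v k : L2w a) (fun x => V x - w k x).
    move: (L2wB_aeq l (v k)) (vw k) (L2w_class_aeq sV).
    by apply: filterS3 => x h1 h2 h3 Ix; rewrite h1// h2// h3.
  rewrite (L2w_dot_aeq (sVw k) (sVw k) h h) -lee_fin.
  by rewrite int01_EFin ?bound//; exact: sqw_L1sqr.
exists l; apply/cvgrPdist_lt => /= e e0.
have e2 : 0 < e / 2 by rewrite divr_gt0.
have half1 : `|2^-1 : R| < 1 by rewrite ger0_norm// invf_lt1// ltr1n.
have /cvgrPdist_lt/(_ _ e2)[k _ hk] := cvg_expr half1.
exists (phi k) => // n kn; rewrite sub0r normrN ger0_norm ?hnorm_ge0//.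
rewrite (le_lt_trans (ler_hdistD ip (v k) _ _))// (splitr e).
have := hk k (leqnn k); rewrite /= sub0r normrN ger0_norm ?exprn_ge0// => hk'.
by rewrite ltrD// ?(lt_trans (hphi _ _ kn))// (le_lt_trans (hl k)).
Qed.

End WeightedL2.

(** * Absolutely continuous functions *)

Section Primitive.
Context {R : realType}.
Local Notation mu := (@lebesgue_measure R).
Implicit Types f g F G : R -> R.

Let ae_filter : Filter (nbhs (almost_everywhere mu)).
Proof. exact: (@ae_filter_ringOfSetsType _ _ _ mu). Qed.
#[local] Existing Instance ae_filter.

(** The upper limit is encoded by an indicator so that every integral runs over (0,1); exchanging t
    and x in the same indicator gives [tail]. *)
Definition prim f x : R := int01 (fun t => f t * (t <= x)%R%:R).

Definition tail f t : R := int01 (fun x => f x * (t <= x)%R%:R).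

Lemma mf_le_r x : @mf R (fun t => (t <= x)%R%:R).
Proof.
have -> : (fun t : R => (t <= x)%R%:R) = \1_(`]-oo, x]) :> (R -> R).
  by apply/funext => t; rewrite indicE mem_setE/= in_itv.
by apply: measurable_indic; exact: measurable_itv.
Qed.

Lemma mf_le_l t : @mf R (fun x => (t <= x)%R%:R).
Proof.
have -> : (fun x : R => (t <= x)%R%:R) = \1_(`[t, +oo[) :> (R -> R).
  by apply/funext => x; rewrite indicE mem_setE/= in_itv/= andbT.
by apply: measurable_indic; exact: measurable_itv.
Qed.

Lemma abs_bool_le1 (b : bool) : `|b%:R : R| <= 1.
Proof. by case: b; rewrite ?normr1 ?normr0. Qed.

Lemma L1_le_r f x : L1 f -> L1 (fun t => f t * (t <= x)%R%:R).
Proof.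
move=> Lf; apply: (@L1M_bounded _ _ _ 1) => //; first exact: mf_le_r.
by move=> t _; exact: abs_bool_le1.
Qed.

Lemma L1_le_l f t : L1 f -> L1 (fun x => f x * (t <= x)%R%:R).
Proof.
move=> Lf; apply: (@L1M_bounded _ _ _ 1) => //; first exact: mf_le_l.
by move=> x _; exact: abs_bool_le1.
Qed.

Lemma prim0 f : prim f 0 = 0.
Proof.
rewrite -[RHS]int01_cst; apply: eq_int01 => t /=; rewrite in_itv/= => /andP[t0 _].
by rewrite leNgt t0 mulr0.
Qed.

Lemma prim1 f : prim f 1 = int01 f.
Proof.
apply: eq_int01 => t /=; rewrite in_itv/= => /andP[_ t1].
by rewrite (ltW t1) mulr1.
Qed.

Lemma primD f g x : L1 f -> L1 g -> prim (fun t => f t + g t) x = prim f x + prim g x.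
Proof.
move=> Lf Lg; rewrite /prim -int01D; [|exact: L1_le_r|exact: L1_le_r].
by apply: eq_int01 => t _; rewrite mulrDl.
Qed.

Lemma primZ c f x : L1 f -> prim (fun t => c * f t) x = c * prim f x.
Proof.
move=> Lf; rewrite /prim -int01Z; last exact: L1_le_r.
by apply: eq_int01 => t _; rewrite mulrA.
Qed.

Lemma prim_tail f x : L1 f -> prim f x + tail f x = int01 f.
Proof.
move=> Lf; rewrite -int01D; [|exact: L1_le_r|exact: L1_le_l].
apply: int01_aeq.
- by apply: L1_mf; apply: L1D; [exact: L1_le_r|exact: L1_le_l].
- exact: L1_mf.
apply: filterS (ae_neq x) => t tx _; case: (ltgtP t x) => [tx'|tx'|tx'].
- by rewrite mulr1 mulr0 addr0.
- by rewrite mulr1 mulr0 add0r.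
- by rewrite tx' eqxx in tx.
Qed.

Lemma prim_restrict f x : prim f x = \int[mu]_(t in `]-oo, x]) (f \_ I01) t.
Proof.
rewrite -Rintegral_mkcondr setIC Rintegral_mkcondr; apply: eq_Rintegral => t _.
by rewrite patchE mem_setE/= in_itv/=; case: ifP; rewrite ?mulr1 ?mulr0.
Qed.

Lemma L1_restrict f : L1 f <-> mu.-integrable setT (EFin \o (f \_ I01)).
Proof.
rewrite -restrict_EFin; apply: integrable_mkcond; exact: measurable_itv.
Qed.

Lemma integral_restrict (f : R -> \bar R) :
  (\int[mu]_x (f \_ I01) x = \int[mu]_(x in I01) f x)%E.
Proof. by rewrite [RHS]integral_mkcond. Qed.

(** Both sides are the integral of f(t) g(x) over the triangle t <= x of the unit square. *)
Lemma prim_fubini f g : L1 f -> L1 g ->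
  int01 (fun x => prim f x * g x) = int01 (fun t => f t * tail g t).
Proof.
move=> Lf Lg.
pose fI : R -> R := f \_ I01; pose gI : R -> R := g \_ I01.
have If : mu.-integrable setT (EFin \o fI) by exact/L1_restrict.
have Ig : mu.-integrable setT (EFin \o gI) by exact/L1_restrict.
have mfI : measurable_fun setT fI by case/integrableP : If => /measurable_EFinP.
have mgI : measurable_fun setT gI by case/integrableP : Ig => /measurable_EFinP.
pose K (z : R * R) : \bar R := (if z.1 <= z.2 then fI z.1 * gI z.2 else 0)%:E.
have mK : measurable_fun setT K.
  apply/measurable_EFinP; apply: measurable_fun_ifT.
  - by apply: measurable_fun_ler; [exact: measurable_fst|exact: measurable_snd].
  - apply: measurable_funM.
      by apply: (measurableT_comp mfI); exact: measurable_fst.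
    by apply: (measurableT_comp mgI); exact: measurable_snd.
  - exact: measurable_cst.
have IK : (mu \x mu)%E.-integrable setT K.
  apply/integrable12ltyP => //.
  have c0 : (\int[mu]_x `|(gI x)%:E| < +oo)%E by case/integrableP : Ig.
  apply: (@le_lt_trans _ _ (\int[mu]_t (`|(fI t)%:E| * \int[mu]_x `|(gI x)%:E|))%E).
    apply: ge0_le_integral => //.
    - by move=> t _; exact: integral_ge0.
    - apply: (@measurable_fun_fubini_tonelli_F _ _ _ _ _ mu (abse \o K)) => //.
        exact: measurableT_comp.
      by move=> z; exact: abse_ge0.
    - apply: emeasurable_funM; last exact: measurable_cst.
      by apply: measurableT_comp => //; exact/measurable_EFinP.
    - move=> t _; rewrite -ge0_integralZl//; last first.
        by apply: measurableT_comp => //; exact/measurable_EFinP.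
      apply: ge0_le_integral => //.
      + apply: measurableT_comp => //; exact: measurableT_comp.
      + apply: emeasurable_funM; first exact: measurable_cst.
        by apply: measurableT_comp => //; exact/measurable_EFinP.
      + move=> x _; rewrite /K/= lee_fin; case: ifP => _; first by rewrite normrM.
        by rewrite normr0 mulr_ge0.
  rewrite ge0_integralZr//; last 2 first.
  - by apply: measurableT_comp => //; exact/measurable_EFinP.
  - exact: integral_ge0.
  rewrite lte_mul_pinfty//; first exact: integral_ge0.
    by rewrite ge0_fin_numE ?integral_ge0//; case/integrableP : If.
have innerx t : (\int[mu]_x K (t, x) = ((fun t => (f t * tail g t)%:E) \_ I01) t)%E.
  rewrite patchE; case: ifPn => [|tI].
    rewrite inE => It; rewrite -int01Z; last exact: L1_le_l.
    rewrite int01_EFin; last by apply: L1Z; exact: L1_le_l.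
    rewrite -integral_restrict; apply: eq_integral => x _.
    rewrite /K/= /fI /gI !patchE mem_set//; case: (x \in _); case: ifP => _;
      by rewrite ?mulr1 ?mulr0.
  apply: integral0_eq => x _.
  by rewrite /K/= /fI patchE (negbTE tI) mul0r; case: ifP.
have innert x : (\int[mu]_t K (t, x) = ((fun x => (prim f x * g x)%:E) \_ I01) x)%E.
  rewrite patchE; case: ifPn => [|xI].
    rewrite inE => Ix; rewrite mulrC -int01Z; last exact: L1_le_r.
    rewrite int01_EFin; last by apply: L1Z; exact: L1_le_r.
    rewrite -integral_restrict; apply: eq_integral => t _.
    rewrite /K/= /fI /gI !patchE (mem_set Ix); case: (t \in _); case: ifP => _;
      by rewrite ?mulr1 ?mulr0 ?mul0r// mulrC.
  apply: integral0_eq => t _.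
  by rewrite /K/= /gI patchE (negbTE xI) mulr0; case: ifP.
have := Fubini IK.
under eq_integral do rewrite innerx; under [in RHS]eq_integral do rewrite innert.
by rewrite !integral_restrict => /(congr1 fine).
Qed.

Lemma prim_by_parts f g : L1 f -> L1 g -> L1 (fun x => prim f x * g x) ->
  L1 (fun x => f x * prim g x) ->
  int01 (fun x => prim f x * g x) + int01 (fun x => f x * prim g x) =
  int01 f * int01 g.
Proof.
move=> Lf Lg L1_ L2_; rewrite prim_fubini//.
have -> : (fun t => f t * tail g t) = (fun t => int01 g * f t - f t * prim g t).
  apply/funext => t; rewrite -(prim_tail t Lg) mulrDl.
  by rewrite (mulrC _ (f t)) (mulrC _ (f t)) addrAC subrr add0r.
by rewrite int01B ?subrK ?int01Z//; [exact: mulrC|exact: L1Z].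
Qed.

Lemma prim_itv f x : L1 f -> 0 <= x <= 1 ->
  prim f x = \int[mu]_(t in `[0, x]) (f \_ I01) t.
Proof.
move=> Lf /andP[x0 x1]; rewrite prim_restrict.
rewrite Rintegral_mkcond [RHS]Rintegral_mkcond; apply: eq_Rintegral => t _.
rewrite !patchE !mem_setE/= !in_itv/=.
have [t0|t0] := leP 0 t => //=.
by case: ifP => // _; rewrite ltNge ltW.
Qed.

Lemma prim_cont f : L1 f -> {within `[0, 1], continuous (prim f)}.
Proof.
move=> /L1_restrict Lf.
have I1 : mu.-integrable `[0, 1] (EFin \o (f \_ I01)).
  by apply: integrableS Lf => //; exact: measurable_itv.
have := parameterized_integral_continuous ler01 I1.
apply: subspace_eq_continuous => x /[!inE] /= /[!in_itv]/= x01.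
by rewrite /from_subspace /parameterized_integral prim_itv//; exact/L1_restrict.
Qed.

(** Absolute continuity on the closed interval with derivative f, in integral form: F is a definite
    representative with values at 0 and 1, f only matters almost everywhere. *)
Definition ac F f := L1 f /\ forall x, 0 <= x <= 1 -> F x = F 0 + prim f x.

Lemma ac_prim f : L1 f -> ac (prim f) f.
Proof. by move=> Lf; split => // x _; rewrite prim0 add0r. Qed.

Lemma cont_cst_add c F : {within `[0, 1], continuous F} ->
  {within `[0, 1], continuous (fun x => c + F x)}.
Proof. by move=> cF x; apply: continuousD; [exact: cst_continuous|exact: cF]. Qed.

Lemma ac_cont F f : ac F f -> {within `[0, 1], continuous F}.
Proof.
move=> [Lf Ff]; have := cont_cst_add (c := F 0) (prim_cont Lf).
by apply: subspace_eq_continuous => x /[!inE] /= /[!in_itv]/= x01; rewrite /from_subspace [RHS]Ff.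
Qed.

Lemma ac_L1 F f : ac F f -> L1 F. Proof. by move=> /ac_cont/cont_L1. Qed.

Lemma acM_L1 F f g : ac F f -> L1 g -> L1 (fun x => F x * g x).
Proof.
move=> /ac_cont cF Lg; have := L1M_cont Lg cF.
by under eq_fun do rewrite mulrC.
Qed.

Lemma ac_int01 F f : ac F f -> int01 f = F 1 - F 0.
Proof.
by move=> [Lf Ff]; rewrite (Ff 1) ?ler01 ?lexx// prim1 addrAC subrr add0r.
Qed.

Lemma ac_by_parts F f G g : ac F f -> ac G g ->
  int01 (fun x => F x * g x) = F 1 * G 1 - F 0 * G 0 - int01 (fun x => f x * G x).
Proof.
move=> aF aG; have [Lf Ff] := aF; have [Lg Gg] := aG.
have L1' := acM_L1 (ac_prim Lf) Lg.
have L2' : L1 (fun x => f x * prim g x) by apply: L1M_cont => //; exact: prim_cont.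
have -> : int01 (fun x => F x * g x) = F 0 * int01 g + int01 (fun x => prim f x * g x).
  rewrite -int01Z// -int01D//; last exact: L1Z.
  apply: eq_int01 => x Ix; rewrite Ff ?mulrDl//.
  by have := subset_itv_oo_cc Ix; rewrite /= in_itv.
have -> : int01 (fun x => f x * G x) = G 0 * int01 f + int01 (fun x => f x * prim g x).
  rewrite -int01Z// -int01D//; last exact: L1Z.
  apply: eq_int01 => x Ix; rewrite Gg ?mulrDr ?(mulrC (G 0))//.
  by have := subset_itv_oo_cc Ix; rewrite /= in_itv.
have := prim_by_parts Lf Lg L1' L2'.
rewrite (ac_int01 aF) (ac_int01 aG); move: (int01 _) (int01 _) => p q h.
by rewrite -[q](addrK p) h; ring.
Qed.

Lemma ac_lin c F f G g : ac F f -> ac G g ->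
  ac (fun x => c * F x + G x) (fun x => c * f x + g x).
Proof.
move=> [Lf Ff] [Lg Gg]; split; first by apply: L1D => //; exact: L1Z.
move=> x x01; rewrite primD//; last exact: L1Z.
by rewrite primZ// Ff// Gg//; ring.
Qed.

Lemma ac_addc c F f : ac F f -> ac (fun x => F x + c) f.
Proof. by move=> [Lf Ff]; split => // x x01; rewrite Ff// addrAC. Qed.

End Primitive.

(** * Smooth functions and test functions *)

Section SmoothFunctions.
Context {R : realType}.
Implicit Types (f g F G : R -> R) (p q : {poly R}) (x y : R).

Definition smooth f := forall n x, derivable (derive1n n f) x 1.

Lemma derive1_eq f (df : R -> R) :
  (forall x, is_derive x (1 : R) f (df x)) -> derive1 f = df.
Proof. by move=> fd; apply/funext => x; rewrite derive1E; exact: derive_val. Qed.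

(** A coinduction principle: a class of derivable functions stable under derivation replaces
    formulas for n-th derivatives. *)
Lemma smooth_of_closed (C : (R -> R) -> Prop) f :
  (forall g, C g -> (forall x, derivable g x 1) /\ C (derive1 g)) ->
  C f -> smooth f.
Proof.
move=> hC Cf n; suff : C (derive1n n f) by case/hC.
by elim: n => [//|n IH]; rewrite derive1nS; case: (hC _ IH).
Qed.

Lemma smooth_derive1 f : smooth f -> smooth (derive1 f).
Proof. by move=> sf n x; rewrite -derive1Sn; exact: sf. Qed.

Lemma smooth_is_derive f x : smooth f -> is_derive x (1 : R) f (derive1 f x).
Proof. by move=> sf; rewrite derive1E; apply: derivableP; exact: (sf 0%N). Qed.

Lemma smooth_continuous f : smooth f -> continuous f.
Proof.
by move=> sf x; apply/differentiable_continuous/derivable1_diffP; exact: (sf 0%N).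
Qed.

Lemma derive1nD_smooth n (c : R) f g : smooth f -> smooth g ->
  derive1n n (fun x => f x + c * g x) = fun x => derive1n n f x + c * derive1n n g x.
Proof.
elim: n f g => [//|n IH] f g sf sg; rewrite !derive1Sn -IH; last 2 first.
- exact: smooth_derive1.
- exact: smooth_derive1.
congr (derive1n n _); apply: derive1_eq => x.
by apply: is_deriveD; [exact: smooth_is_derive|apply: is_deriveZ; exact: smooth_is_derive].
Qed.

Lemma smoothD_scaled (c : R) f g : smooth f -> smooth g -> smooth (fun x => f x + c * g x).
Proof.
move=> sf sg n x; rewrite derive1nD_smooth//.
by apply: derivableD; [exact: sf|apply: derivableZ; exact: sg].
Qed.

(** The class given to [smooth_of_closed] for products: Leibniz' rule does not leave it. *)
Inductive sum_of_products : (R -> R) -> Prop :=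
| sum_of_products_mul f g : smooth f -> smooth g -> sum_of_products (fun x => f x * g x)
| sum_of_products_add f g : sum_of_products f -> sum_of_products g ->
    sum_of_products (fun x => f x + g x).

Lemma smoothM f g : smooth f -> smooth g -> smooth (fun x => f x * g x).
Proof.
move=> sf sg; apply: (@smooth_of_closed sum_of_products); last exact: sum_of_products_mul.
move=> h; elim=> [{sf sg} {}f {}g sf sg|{sf sg} {}f {}g _ [df cf] _ [dg cg]].
  have d x : is_derive x (1 : R) (fun x => f x * g x)
      (f x * derive1 g x + g x * derive1 f x).
    by apply: is_deriveM; exact: smooth_is_derive.
  split=> [x|]; first exact: ex_derive.
  rewrite (derive1_eq d); apply: sum_of_products_add.
    by apply: sum_of_products_mul => //; exact: smooth_derive1.
  by apply: sum_of_products_mul => //; exact: smooth_derive1.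
split=> [x|]; first exact: derivableD.
have d x : is_derive x (1 : R) (fun x => f x + g x) (derive1 f x + derive1 g x).
  by apply: is_deriveD; rewrite derive1E; exact: derivableP.
by rewrite (derive1_eq d); exact: sum_of_products_add.
Qed.

Lemma smooth_affine f (c d : R) : smooth f -> smooth (fun x => f (c * x + d)).
Proof.
move=> sf; apply: (@smooth_of_closed (fun h => exists (k : R) g, smooth g /\
  h = fun x => k * g (c * x + d))); last first.
  by exists 1, f; split => //; apply/funext => x; rewrite mul1r.
move=> _ [k [g [sg ->]]].
have da x : is_derive x (1 : R) (fun x : R => c * x + d) c.
  have -> : (fun x : R => c * x + d) = horner (c *: 'X + d%:P).
    by apply/funext => y; rewrite !hornerE.
  have := is_derive_poly (c *: 'X + d%:P) x.
  by rewrite derivD derivZ derivX derivC addr0 hornerZ hornerC mulr1.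
have dg x : is_derive x (1 : R) (fun x => k * g (c * x + d))
    ((k * c) * derive1 g (c * x + d)).
  apply: is_derive_eq.
    apply: is_deriveZ; apply: (is_derive1_comp (f := g)); exact: smooth_is_derive.
  by rewrite /GRing.scale/= mulrA mulrAC.
split=> [x|]; first exact: ex_derive.
exists (k * c), (derive1 g); split; first exact: smooth_derive1.
exact: derive1_eq.
Qed.

Lemma smooth_horner p : smooth (fun x => p.[x]).
Proof.
apply: (@smooth_of_closed (fun h => exists q, h = fun x => q.[x])); last by exists p.
move=> _ [q ->]; split=> [x|]; first exact: derivable_horner.
by exists (deriv q); apply: derive1_eq => x; exact: is_derive_poly.
Qed.

(* The derivatives of exp(-1/x) are of this form. *)
Definition flat_exp p x : R := if 0 < x then p.[x^-1] * expR (- x^-1) else 0.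

(** Term by term, from y^i <= i! exp(y). *)
Lemma poly_exp_bounded p : exists2 C : R, 0 <= C &
  forall y, 0 <= y -> `|p.[y]| * expR (- y) <= C.
Proof.
exists (\sum_(i < size p) `|p`_i| * (i`!)%:R).
  by apply: sumr_ge0 => i _; rewrite mulr_ge0.
move=> y y0; rewrite horner_coef.
rewrite (@le_trans _ _ ((\sum_(i < size p) `|p`_i * y ^+ i|) * expR (- y)))//.
  by rewrite ler_wpM2r ?expR_ge0// ler_norm_sum.
rewrite mulr_suml; apply: ler_sum => i _.
rewrite normrM -mulrA ler_wpM2l// ger0_norm ?exprn_ge0// expRN ler_pdivrMr ?expR_gt0//.
case: (nat_of_ord i) => [|n].
  by rewrite fact0 mul1r expr0 -expR0 ler_expR.
have := expR_ge1Dxn n y0; move=> h.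
rewrite mulrC -ler_pdivrMr ?ltr0n ?fact_gt0// (le_trans _ h)// lerDr//.
Qed.

Lemma is_derive_flat_exp p x :
  is_derive x (1 : R) (flat_exp p) (flat_exp ('X^2 * (p - deriv p)) x).
Proof.
have [x0|x0|->] := ltgtP x 0.
- rewrite {2}/flat_exp ltNge (ltW x0)/=.
  apply: (@near_eq_is_derive _ _ _ (fun=> 0)).
    near=> y; rewrite /flat_exp ltNge ltW//; near: y; exact: lt_nbhsl.
- rewrite {2}/flat_exp x0/=.
  apply: (@near_eq_is_derive _ _ _ (fun y => p.[y^-1] * expR (- y^-1))).
  + near=> y; rewrite /flat_exp; have -> // : 0 < y.
    by near: y; exact: lt_nbhsr.
  have xn0 : x != 0 by rewrite gt_eqF.
  have dV : is_derive x (1 : R) (fun y : R => y^-1) (- x ^- 2).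
    apply: is_derive_eq; first by apply: is_deriveV.
    by rewrite /GRing.scale/= mulr1.
  have dp : is_derive x (1 : R) (fun y : R => p.[y^-1]) ((deriv p).[x^-1] * - x ^- 2).
    by apply: (is_derive1_comp (f := horner p)); exact: is_derive_poly.
  have de : is_derive x (1 : R) (fun y : R => expR (- y^-1)) (expR (- x^-1) * - (- x ^- 2)).
    by apply: (is_derive1_comp (f := expR)); exact: is_deriveN.
  apply: (is_derive_eq (is_deriveM dp de)).
  rewrite /GRing.scale/= hornerM hornerD hornerN hornerXn.
  by move: (p.[x^-1]) ((deriv p).[x^-1]) (expR (- x^-1)) => P Q E; field.
rewrite {2}/flat_exp ltxx.
(* For h > 0 and y = 1/h the difference quotient at 0 is p(y) y^2 exp(-y) h, a bounded quantity
   times h. *)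
have [C C0 hC] := poly_exp_bounded (p * 'X^2).
have c : (fun h => h^-1 *: ((flat_exp p \o shift 0) (h *: 1) - flat_exp p 0)) @ 0^' --> (0 : R).
  apply/cvgrPdist_le => /= e e0.
  have C1 : 0 < C + 1 by rewrite ltr_wpDl.
  near=> h.
  have h0 : h != 0 by near: h; exact: nbhs_dnbhs_neq.
  have he : `|h| <= e / (C + 1) by near: h; apply: dnbhs0_le; rewrite divr_gt0.
  rewrite sub0r normrN /GRing.scale/= mulr1 addr0 /flat_exp ltxx subr0.
  case: ifPn => [hp|_]; last by rewrite mulr0 normr0 ltW.
  rewrite !normrM (ger0_norm (expR_ge0 _)).
  have hi : 0 <= h^-1 by rewrite invr_ge0 ltW.
  have := hC _ hi; rewrite hornerM hornerXn normrM normrX !(ger0_norm hi).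
  move: he; rewrite (gtr0_norm hp) => he; set P := `|_|; set E := expR _ => b.
  have -> : h^-1 * (P * E) = P * h^-1 ^+ 2 * E * h by field.
  apply: (@le_trans _ _ ((C + 1) * h)); last by rewrite mulrC -ler_pdivlMr.
  by rewrite ler_wpM2r ?(ltW hp)// (le_trans b)// lerDl.
split; first by apply/cvg_ex; exists 0; exact: c.
by apply/cvg_lim => //; exact: c.
Unshelve. all: by end_near.
Qed.

Lemma smooth_flat_exp p : smooth (flat_exp p).
Proof.
apply: (@smooth_of_closed (fun h => exists q, h = flat_exp q)); last by exists p.
move=> _ [q ->]; split=> [x|].
  by have [] := is_derive_flat_exp q x.
by exists ('X^2 * (q - deriv q)); apply: derive1_eq => x; exact: is_derive_flat_exp.
Qed.

(* Converges to the indicator function of ]al, be[ as c tends to infinity. *)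
Definition bump (al be c : R) x : R :=
  flat_exp 1 (c * x + (- (c * al))) * flat_exp 1 ((- c) * x + c * be).

Lemma smooth_bump al be c : smooth (bump al be c).
Proof. by apply: smoothM; apply: smooth_affine; exact: smooth_flat_exp. Qed.

Lemma bumpE al be c x : 0 < c -> bump al be c x =
  if (al < x) && (x < be) then expR (- (c * (x - al))^-1) * expR (- (c * (be - x))^-1)
  else 0.
Proof.
move=> c0; rewrite /bump.
have -> : c * x + (- (c * al)) = c * (x - al) by ring.
have -> : (- c) * x + c * be = c * (be - x) by ring.
rewrite /flat_exp !hornerC !mul1r !pmulr_rgt0// !subr_gt0.
by case: ltP => _ /=; [case: ltP => _; rewrite ?mulr0|rewrite mul0r].
Qed.

Lemma bump_ge0 al be c x : 0 < c -> 0 <= bump al be c x.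
Proof. by move=> c0; rewrite bumpE//; case: ifP => // _; rewrite mulr_ge0 ?expR_ge0. Qed.

Lemma bump_le1 al be c x : 0 < c -> bump al be c x <= 1.
Proof.
move=> c0; rewrite bumpE//; case: ifP => // /andP[h1 h2].
rewrite mulr_ile1 ?expR_ge0// -[leRHS]expR0 ler_expR oppr_le0 invr_ge0 mulr_ge0 ?(ltW c0)//;
  by rewrite subr_ge0 ltW.
Qed.

Lemma bump_cvg al be x : bump al be n.+1%:R x @[n --> \oo] -->
  (((al < x) && (x < be))%R%:R : R).
Proof.
have h (d : R) : 0 < d -> expR (- (n.+1%:R * d)^-1) @[n --> \oo] --> (1 : R).
  move=> d0.
  have hv0 : n.+1%:R^-1 * d^-1 @[n --> \oo] --> (0 * d^-1 : R).
    by apply: cvgMl; exact: cvg_harmonic.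
  have hv : - (n.+1%:R * d)^-1 @[n --> \oo] --> (0 : R).
    have -> : (fun n : nat => - (n.+1%:R * d)^-1) = - (fun n : nat => n.+1%:R^-1 * d^-1).
      by apply/funext => n; rewrite invfM.
    have h : (- (fun n : nat => n.+1%:R^-1 * d^-1)) @ \oo --> (- (0 * d^-1) : R) by exact: cvgN.
    by rewrite mul0r oppr0 in h.
  rewrite -[X in _ --> X]expR0.
  by apply: (@cvg_comp _ _ _ _ expR _ _ _ hv); exact: continuous_expR.
under eq_fun do rewrite bumpE//.
have [/andP[h1 h2]|_] := boolP (al < x < be); last exact: cvg_cst.
have := @cvgM _ _ _ _ _ _ _ _ (h (x - al) _) (h (be - x) _).
by rewrite !subr_gt0 mulr1; apply.
Qed.

End SmoothFunctions.

(** * Test functions, the fundamental lemma and integration of weak derivatives *)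

Section TestFunctions.
Context {R : realType}.
Local Notation mu := (@lebesgue_measure R).
Implicit Types (f g u F phi psi : R -> R) (x : R).

Let ae_filter : Filter (nbhs (almost_everywhere mu)).
Proof. exact: (@ae_filter_ringOfSetsType _ _ _ mu). Qed.
#[local] Existing Instance ae_filter.

Lemma test_smooth phi : test_function phi -> smooth phi.
Proof. by case. Qed.

Lemma test_functionP phi al be : smooth phi -> 0 < al -> be < 1 ->
  (forall x, x < al \/ be < x -> phi x = 0) -> test_function phi.
Proof.
move=> sphi al0 be1 phi0; split => //=.
have sub : [set x | phi x != 0] `<=` `[al, be].
  move=> x /=; rewrite in_itv/= => phix; apply/andP; split; rewrite leNgt; apply/negP => h.
    by move: phix; rewrite phi0 ?eqxx//; left.
  by move: phix; rewrite phi0 ?eqxx//; right.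
have csub : closure [set x | phi x != 0] `<=` `[al, be].
  rewrite (closure_id `[al, be]%classic).1; last exact: itv_closed.
  exact: closure_subset.
split.
  apply: (@subclosed_compact _ _ `[al, be]%classic) => //.
    exact: closed_closure.
  exact: segment_compact.
apply: (subset_trans csub) => x /=; rewrite !in_itv/= => /andP[h1 h2].
by rewrite (lt_le_trans al0 h1) (le_lt_trans h2 be1).
Qed.

Lemma test_vanish phi : test_function phi ->
  exists2 e : R, 0 < e & forall x, x < e \/ 1 - e < x -> phi x = 0.
Proof.
move=> [_ /= [_ supp]].
have phi0 x : ~ closure [set x | phi x != 0] x -> phi x = 0.
  move=> nx; apply/eqP; rewrite -[_ == _]negbK; apply/negP => h; apply: nx.
  exact: subset_closure.
have out x : ~ I01 x -> exists2 d : R, 0 < d & forall y, `|x - y| < d -> phi y = 0.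
  move=> nIx.
  have : open (~` closure [set x | phi x != 0]) by exact/closed_openC/closed_closure.
  rewrite openE => /(_ x) /=; case; first by move=> /supp.
  move=> d /= d0 hd; exists d => // y xy; apply: phi0; exact: hd.
have [d0 d00 h0] := out 0 (ltac:(by rewrite /= in_itv/= ltxx)).
have [d1 d10 h1] := out 1 (ltac:(by rewrite /= in_itv/= ltxx andbF)).
exists (Num.min d0 d1); first by rewrite lt_min d00.
move=> x [|].
  rewrite lt_min => /andP[xd0 _].
  have [x0|x0] := leP x 0; first by apply: phi0 => /supp; rewrite /= in_itv/= ltNge x0.
  by apply: h0; rewrite sub0r normrN gtr0_norm.
rewrite ltrBlDr -ltrBlDl lt_min => /andP[_ xd1].
have [x1|x1] := leP 1 x; first by apply: phi0 => /supp; rewrite /= in_itv/= (ltNge x) x1 andbF.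
by apply: h1; rewrite gtr0_norm// subr_gt0.
Qed.

Lemma test_out phi x : test_function phi -> ~ I01 x -> phi x = 0.
Proof.
move=> /test_vanish[e e0 h] nIx; apply: h.
have [x0|x0] := leP x 0; first by left; exact: le_lt_trans e0.
have [x1|x1] := leP 1 x; last by exfalso; apply: nIx; rewrite /= in_itv/= x0.
by right; rewrite (lt_le_trans _ x1)// gtrBl.
Qed.

Lemma test_derive1 phi : test_function phi -> test_function (derive1 phi).
Proof.
move=> tphi; have [e e0 h] := test_vanish tphi.
apply: (@test_functionP _ e (1 - e)) => //.
- by apply: smooth_derive1; exact: test_smooth.
- by rewrite gtrBl.
move=> x hx; rewrite derive1E.
have -> : 'D_1 phi x = 'D_1 (fun=> (0 : R)) x.
  apply: near_eq_derive; case: hx => hx.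
    by near=> y; apply: h; left; near: y; exact: lt_nbhsl.
  by near=> y; apply: h; right; near: y; exact: lt_nbhsr.
exact: derive_cst.
Unshelve. all: by end_near.
Qed.

Lemma test_derive1n k phi : test_function phi -> test_function (derive1n k phi).
Proof.
by move=> tphi; elim: k => [//|k IH]; rewrite derive1nS; exact: test_derive1.
Qed.

Lemma testD_scaled (c : R) phi psi : test_function phi -> test_function psi ->
  test_function (fun x => phi x + c * psi x).
Proof.
move=> tphi tpsi; have [e e0 h] := test_vanish tphi; have [d d0 k] := test_vanish tpsi.
have m0 : 0 < Num.min e d by rewrite lt_min e0.
apply: (@test_functionP _ (Num.min e d) (1 - Num.min e d)) => //.
- by apply: smoothD_scaled; exact: test_smooth.
- by rewrite gtrBl.
move=> x [|].
  by rewrite lt_min => /andP[xe xd]; rewrite h ?k ?mulr0 ?addr0//; left.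
rewrite ltrBlDr -ltrBlDl lt_min => /andP[xe xd].
by rewrite h ?k ?mulr0 ?addr0//; right; rewrite ltrBlDr -ltrBlDl.
Qed.

Lemma test_scaled (c : R) phi : test_function phi -> test_function (fun x => c * phi x).
Proof.
move=> tphi; have := testD_scaled (c - 1) tphi tphi.
by under eq_fun do rewrite -{1}[phi _]mul1r -mulrDl subrKC.
Qed.

Lemma test_bump (al be c : R) : 0 < al -> be < 1 -> 0 < c -> test_function (bump al be c).
Proof.
move=> al0 be1 c0; apply: (@test_functionP _ al be) => //; first exact: smooth_bump.
move=> x hx; rewrite bumpE//; case: ifPn => // /andP[h1 h2].
by case: hx => h; [have := lt_trans h h1|have := lt_trans h h2]; rewrite ltxx.
Qed.

Lemma smooth_cont01 f : smooth f -> {within `[0, 1], continuous f}.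
Proof. by move=> sf; apply: continuous_subspaceT; exact: smooth_continuous. Qed.

Lemma L1M_test f phi : L1 f -> test_function phi -> L1 (fun x => f x * phi x).
Proof. by move=> Lf tphi; apply: L1M_cont => //; exact/smooth_cont01/test_smooth. Qed.

Lemma ac_smooth F : smooth F -> ac F (derive1 F).
Proof.
move=> sF; have cF := smooth_continuous sF.
have cF' := smooth_continuous (smooth_derive1 sF).
have LF' : L1 (derive1 F) by exact/cont_L1/smooth_cont01/smooth_derive1.
split => // x /andP[+ x1]; rewrite le_eqVlt => /predU1P[<-|x0]; first by rewrite prim0 addr0.
have := @continuous_FTC2 _ (derive1 F) F 0 x x0 (continuous_subspaceT cF').
move=> /(_ _ _)/(congr1 fine); rewrite prim_itv//; last by rewrite (ltW x0).
have -> : \int[mu]_(t in `[0, x]) ((derive1 F) \_ I01) t = \int[mu]_(t in `[0, x]) derive1 F t.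
  congr fine; apply: ae_eq_integral => //.
  - apply/measurable_EFinP; apply: measurable_funTS.
    by move/L1_restrict : LF' => /integrableP[/measurable_EFinP].
  - apply/measurable_EFinP; apply: measurable_funTS; exact: continuous_measurable_fun.
  move: (ae_neq (0 : R)) (ae_neq (1 : R)); apply: filterS2 => t t0 t1 /=.
  rewrite in_itv/= => /andP[h0 h1]; rewrite patchE mem_set// /= in_itv/=.
  by rewrite !lt_neqAle eq_sym t0 h0 t1 (le_trans h1).
rewrite /Rintegral => ->; first by rewrite subrKC.
  split=> [y _||]; first exact: (sF 0%N).
    by apply: cvg_at_right_filter; exact: cF.
  by apply: cvg_at_left_filter; exact: cF.
by [].
Qed.

(* Bump functions approximating indicators of intervals show that the primitive of
   f is constant; f is its derivative almost everywhere. *)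
Lemma fundamental_lemma f : L1 f ->
  (forall phi, test_function phi -> int01 (fun x => f x * phi x) = 0) ->
  aeq f (fun=> 0).
Proof.
move=> Lf f0.
have itv0 al be : 0 < al -> al < be -> be < 1 -> prim f be = prim f al.
  move=> al0 ab be1.
  pose h x := f x * ((al < x) && (x < be))%R%:R.
  have mind : @mf R (fun x => ((al < x) && (x < be))%R%:R).
    have -> : (fun t : R => ((al < t) && (t < be))%R%:R) = \1_(`]al, be[) :> (R -> R).
      by apply/funext => t; rewrite indicE mem_setE/= in_itv.
    by apply: measurable_indic; exact: measurable_itv.
  have mh : mf h by apply: mfM => //; exact: L1_mf.
  have [n|||||_ _ lim] := @dominated_convergence _ _ R mu I01 (measurable_itv _)
    (fun n x => (f x * bump al be n.+1%:R x)%:E) (EFin \o h) (EFin \o (fun x => `|f x|)) _ _ _ _ _.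
  - apply/measurable_EFinP; apply: mfM; first exact: L1_mf.
    by apply: cont_mf; apply: smooth_cont01; exact: smooth_bump.
  - exact/measurable_EFinP.
  - apply: aeW => x _; apply: cvg_EFin; first exact: nearW.
    by apply: cvgMr; exact: bump_cvg.
  - exact: integrable_norm.
  - apply: aeW => x n _; rewrite lee_fin normrM ler_piMr//.
    by rewrite ger0_norm ?bump_ge0// bump_le1.
  have h0 : int01 h = 0.
    rewrite /int01 /Rintegral.
    suff -> : (\int[mu]_(x in I01) (h x)%:E = 0)%E by [].
    rewrite -(cvg_lim _ lim)//; apply: lim_near_cst => //; apply: nearW => n /=.
    rewrite -int01_EFin; last by apply: L1M_test => //; exact: test_bump.
    by rewrite f0//; exact: test_bump.
  (* The difference of primitives integrates over ]al, be], which differs from the interval of h by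
     the null set {be}. *)
  apply/eqP; rewrite -subr_eq0 -h0 -int01B; [|exact: L1_le_r|exact: L1_le_r].
  apply/eqP; apply: int01_aeq => //.
    by apply: L1_mf; apply: L1B; exact: L1_le_r.
  apply: filterS (ae_neq be) => t tbe _; rewrite -mulrBr /h; congr (_ * _).
  rewrite [t < be]lt_neqAle tbe/=; have [ta|ta] := leP t al.
    by rewrite (le_trans ta (ltW ab))/= subrr.
  by rewrite subr0.
have If : mu.-integrable setT (EFin \o (f \_ I01)) by exact/L1_restrict.
have := @FTC1Ny R (f \_ I01) _ _.
case=> [y||N [mN N0 hN]].
- by apply: integrableS If => //; exact: measurable_itv.
- by apply: open_integrable_locally => //; exact: openT.
exists N; split => //; apply: subset_trans hN => x /= nx h; apply: nx => Ix.
have [dx] := h; rewrite derive1E patchE mem_set// => <-.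
have -> : (fun x : R => \int[mu]_(t in `]-oo, x]) (f \_ I01) t) = prim f.
  by apply/funext => y; rewrite prim_restrict.
have -> : 'D_1 (prim f) x = 'D_1 (fun=> prim f x) x.
  apply: near_eq_derive; move: (Ix); rewrite /= in_itv/= => /andP[x0 x1].
  near=> y; have y0 : 0 < y by near: y; exact: lt_nbhsr.
  have y1 : y < 1 by near: y; exact: lt_nbhsl.
  have [xy|xy|->//] := ltgtP x y; first exact: itv0.
  by apply/esym; exact: itv0.
exact: derive_cst.
Unshelve. all: by end_near.
Qed.

(** No integral is computed: if all test functions had integral 0, the fundamental lemma would give
    1 = 0 almost everywhere. *)
Lemma test_function_int1 : exists2 psi : R -> R, test_function psi & int01 (psi : R -> R) = 1.
Proof.
have [[phi tphi phi0]|h] :=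
    pselect (exists2 phi : R -> R, test_function phi & int01 phi != 0).
  exists (fun x => (int01 phi)^-1 * phi x); first exact: test_scaled.
  by rewrite int01Z ?mulVf//; exact/cont_L1/smooth_cont01/test_smooth.
exfalso; have : aeq (fun=> 1 : R) (fun=> 0).
  apply: fundamental_lemma => [|phi tphi]; first exact: L1_cst.
  under eq_fun do rewrite mul1r.
  by apply/eqP; rewrite -[_ == _]negbK; apply/negP => phi0; apply: h; exists phi.
move=> /int01_aeq; rewrite !int01_cst => /(_ (measurable_cst _) (measurable_cst _))/eqP.
by rewrite oner_eq0.
Qed.

(** Zero mean is what makes the primitive vanish to the right of the support. *)
Lemma prim_test phi : test_function phi -> int01 phi = 0 ->
  test_function (prim phi) /\ derive1 (prim phi) = phi.
Proof.
move=> tphi phi0; have [e e0 h] := test_vanish tphi.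
have cphi := smooth_continuous (test_smooth tphi).
have Lphi : L1 phi by exact/cont_L1/smooth_cont01/test_smooth.
have restr : phi \_ I01 = phi.
  apply/funext => x; rewrite patchE; case: ifPn => //; rewrite notin_setE => nx.
  by rewrite test_out.
have primE : prim phi = fun x => \int[mu]_(t in [set` Interval -oo%O (BRight x)]) phi t.
  by apply/funext => x; rewrite prim_restrict restr.
have d x : derivable (prim phi) x 1 /\ derive1 (prim phi) x = phi x.
  rewrite primE; apply: (@continuous_FTC1 _ phi -oo%O x (x + 1)) => //.
  - by rewrite ltrDl.
  - move: Lphi => /L1_restrict; rewrite restr; exact: integrableS.
  - exact: ltNyr.
  - exact: cphi.
have dE : derive1 (prim phi) = phi by apply/funext => x; case: (d x).
split => //; apply: (@test_functionP _ e (1 - e)) => //.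
- case=> [x|n x]; first by case: (d x).
  by rewrite derive1Sn dE; exact: (test_smooth tphi).
- by rewrite gtrBl.
move=> x [xe|xe].
  rewrite /prim -[RHS]int01_cst; apply: eq_int01 => t _.
  have [tx|tx] := leP t x; last by rewrite mulr0.
  by rewrite h ?mul0r//; left; exact: le_lt_trans xe.
rewrite -phi0; apply: eq_int01 => t _.
have [tx|tx] := leP t x; first by rewrite mulr1.
by rewrite h ?mul0r//; right; exact: lt_trans tx.
Qed.

(** The integral identity of [weak_derivative] alone; integrability is tracked separately, as [L1]
    on all of (0,1) rather than locally. *)
Definition weakly k u g := forall phi, test_function phi ->
  int01 (fun x => u x * derive1n k phi x) = (-1) ^+ k * int01 (fun x => g x * phi x).

(* du Bois-Reymond: every test function is the sum of a multiple of a fixed one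
   and of a derivative of a test function. *)
Lemma weakly_pred k u g : L1 u -> L1 g -> weakly k.+1 u g ->
  exists c, weakly k u (fun x => prim g x + c).
Proof.
move=> Lu Lg hw; have [psi tpsi psi1] := test_function_int1.
(* This value is forced by testing the conclusion with psi, whose integral is 1. *)
pose c := (-1) ^+ k * int01 (fun x => u x * derive1n k psi x) -
  int01 (fun x => prim g x * psi x).
exists c => phi tphi; pose m := int01 phi.
have Lphi : L1 phi by exact/cont_L1/smooth_cont01/test_smooth.
have Lpsi : L1 psi by exact/cont_L1/smooth_cont01/test_smooth.
pose chi x := phi x + (- m) * psi x.
have tchi : test_function chi by exact: testD_scaled.
have Lchi : L1 chi by exact/cont_L1/smooth_cont01/test_smooth.
have chi0 : int01 chi = 0.
  by rewrite int01D ?int01Z// ?psi1 ?mulr1 ?subrr//; exact: L1Z.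
have [tP dP] := prim_test tchi chi0.
have := hw _ tP; rewrite derive1Sn dP.
have Lpg f : L1 f -> L1 (fun x => prim g x * f x).
  by move=> Lf; exact: acM_L1 (ac_prim Lg) Lf.
have -> : int01 (fun x => g x * prim chi x) = - int01 (fun x => prim g x * chi x).
  have := prim_by_parts Lg Lchi (Lpg _ Lchi) (L1M_cont Lg (prim_cont Lchi)).
  by rewrite chi0 mulr0 => /eqP; rewrite addrC addr_eq0 => /eqP.
have Luk f : test_function f -> L1 (fun x => u x * derive1n k f x).
  by move=> tf; apply: L1M_test => //; exact: test_derive1n.
have -> : int01 (fun x => u x * derive1n k chi x) =
    int01 (fun x => u x * derive1n k phi x) - m * int01 (fun x => u x * derive1n k psi x).
  rewrite -mulNr -int01Z ?Luk// -int01D ?Luk//; last by apply: L1Z; exact: Luk.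
  apply: eq_int01 => x _.
  by rewrite derive1nD_smooth; [ring|exact: test_smooth|exact: test_smooth].
have -> : int01 (fun x => prim g x * chi x) =
    int01 (fun x => prim g x * phi x) - m * int01 (fun x => prim g x * psi x).
  rewrite -mulNr -int01Z ?Lpg// -int01D ?Lpg//; last by apply: L1Z; exact: Lpg.
  by apply: eq_int01 => x _; rewrite /chi; ring.
have -> : int01 (fun x => (prim g x + c) * phi x) =
    int01 (fun x => prim g x * phi x) + c * m.
  rewrite /m -int01Z// -int01D ?Lpg//; last exact: L1Z.
  by apply: eq_int01 => x _; rewrite mulrDl.
have s2 : (-1) ^+ k * (-1) ^+ k = 1 :> R by rewrite -exprMn mulrNN mulr1 expr1n.
rewrite /c exprS mulN1r mulrNN.
set A := int01 (fun x => u x * derive1n k phi x).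
set B := int01 (fun x => u x * derive1n k psi x) => h.
transitivity (A - m * B + ((-1) ^+ k * (-1) ^+ k) * (m * B)); first by rewrite s2; ring.
by rewrite h; ring.
Qed.

Lemma weakly0 u g : L1 u -> L1 g -> weakly 0 u g -> aeq u g.
Proof.
move=> Lu Lg hw.
have : aeq (fun x => u x - g x) (fun=> 0).
  apply: fundamental_lemma; first exact: L1B.
  move=> phi tphi; have := hw _ tphi; rewrite expr0 mul1r derive1n0 => h.
  under eq_fun do rewrite mulrBl.
  by rewrite int01B ?h ?subrr//; exact: L1M_test.
by apply: filterS => x h Ix; apply/eqP; rewrite -subr_eq0 h.
Qed.

Lemma ac_weakly u g : ac u g -> weakly 1 u g.
Proof.
move=> aug phi tphi; rewrite derive1n1.
rewrite (ac_by_parts aug (ac_smooth (test_smooth tphi))).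
rewrite !(test_out tphi) ?mulr0 ?subrr ?sub0r ?expr1 ?mulN1r//= in_itv/= ltxx// andbF//.
Qed.

Lemma weakly_trans j k u v g : weakly j u v -> weakly k v g -> weakly (j + k) u g.
Proof.
move=> h1 h2 phi tphi.
have -> : derive1n (j + k) phi = derive1n j (derive1n k phi) by rewrite /derive1n iterD.
by rewrite h1 ?h2// ?exprD ?mulrA//; exact: test_derive1n.
Qed.

Lemma weakly_aeq k u v g h : L1 u -> L1 v -> L1 g -> L1 h -> aeq u v -> aeq g h ->
  weakly k u g -> weakly k v h.
Proof.
move=> Lu Lv Lg Lh uv gh hw phi tphi.
have E f f' psi : L1 f -> L1 f' -> aeq f f' -> test_function psi ->
    int01 (fun x => f x * psi x) = int01 (fun x => f' x * psi x).
  move=> Lf Lf' ff' tpsi; apply: int01_aeq.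
  - by apply: L1_mf; exact: L1M_test.
  - by apply: L1_mf; exact: L1M_test.
  by move: ff'; apply: filterS => x fx Ix; rewrite fx.
rewrite -(E u v _ Lu Lv uv (test_derive1n k tphi)) -(E g h _ Lg Lh gh tphi).
exact: hw.
Qed.

End TestFunctions.

(** * The operator A2 *)

Section WeakDerivatives.
Context {R : realType}.
Local Notation mu := (@lebesgue_measure R).
Implicit Types (f g u v : R -> R).

Let ae_filter : Filter (nbhs (almost_everywhere mu)).
Proof. exact: (@ae_filter_ringOfSetsType _ _ _ mu). Qed.
#[local] Existing Instance ae_filter.

Lemma weak_derivative_of_weakly k u g : L1 u -> L1 g -> weakly k u g ->
  weak_derivative k u g.
Proof.
by move=> Lu Lg h; split => //; apply: open_integrable_locally => //; exact: interval_open.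
Qed.

Lemma weakly_of_weak_derivative k u g : weak_derivative k u g -> weakly k u g.
Proof. by case. Qed.

Lemma weakly_unique k u f g : L1 f -> L1 g -> weakly k u f -> weakly k u g -> aeq f g.
Proof.
move=> Lf Lg hf hg; apply: weakly0 => // phi tphi; rewrite derive1n0 expr0 mul1r.
have s2 : (-1) ^+ k * (-1) ^+ k = 1 :> R by rewrite -exprMn mulrNN mulr1 expr1n.
by rewrite -[LHS]mul1r -s2 -mulrA -hf// hg// mulrA s2 mul1r.
Qed.

(** If f x and g x differ, so do f and g on a one- or two-sided neighbourhood of x in (0,1), an
    interval of positive measure. The endpoints are included, as needed for boundary values. *)
Lemma cont_aeq f g : {within `[0, 1], continuous f} -> {within `[0, 1], continuous g} ->
  aeq f g -> forall x, 0 <= x <= 1 -> f x = g x.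
Proof.
move=> cf cg fg x x01; apply/eqP; rewrite -subr_eq0 -[_ == _]negbK; apply/negP => fgx.
have ch : {within `[0, 1], continuous (f \- g)}.
  by move=> y; apply: continuousB; [exact: cf|exact: cg].
have /cvgrPdist_lt/(_ `|f x - g x|) : (f \- g) @ within `[0, 1] (nbhs x) --> (f x - g x).
  by move/subspace_continuousP : ch => /(_ x); apply; rewrite /= in_itv.
rewrite normr_gt0 => /(_ fgx); rewrite near_withinE => -[d /= d0 hd].
have [N [mN N0 hN]] := fg.
pose l := Num.max 0 (x - d); pose r := Num.min 1 (x + d).
have lr : l < r.
  by move: x01 => /andP[? ?]; rewrite /l /r lt_min !gt_max; do ?[apply/andP; split]; lra.
have sub : `]l, r[ `<=` N.
  move=> y /=; rewrite in_itv/= gt_max lt_min => /andP[/andP[y0 yl] /andP[y1 yr]].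
  apply: hN => /= h; have y01 : I01 y by rewrite /= in_itv/= y0.
  have := hd y; rewrite /ball/= /ball_/= ltr_distlC yl yr => /(_ isT).
  by rewrite in_itv/= (ltW y0) (ltW y1) => /(_ isT); rewrite h// subrr subr0 ltxx.
have mI : measurable (`]l, r[%classic : set (measurableTypeR R)) by exact: measurable_itv.
have : mu `]l, r[%classic = (r - l)%:E by rewrite lebesgue_measure_itv/= lte_fin lr -EFinB.
rewrite (@subset_measure0 _ _ _ mu _ _ mI mN sub N0) => /eqP.
by rewrite eq_sym eqe subr_eq0 gt_eqF.
Qed.

Lemma weakly4_ac u g : L1 u -> L1 g -> weakly 4 u g -> exists u0 u1 u2 u3,
  aeq u u0 /\ [/\ ac u0 u1, ac u1 u2, ac u2 u3 & ac u3 g].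
Proof.
move=> Lu Lg h4.
have [c3 h3] := weakly_pred Lu Lg h4; have a3 := ac_addc c3 (ac_prim Lg).
have [c2 h2] := weakly_pred Lu (ac_L1 a3) h3; have a2 := ac_addc c2 (ac_prim (ac_L1 a3)).
have [c1 h1] := weakly_pred Lu (ac_L1 a2) h2; have a1 := ac_addc c1 (ac_prim (ac_L1 a2)).
have [c0 h0] := weakly_pred Lu (ac_L1 a1) h1; have a0 := ac_addc c0 (ac_prim (ac_L1 a1)).
do 4 eexists; split; last by split; [exact: a0|exact: a1|exact: a2|exact: a3].
by apply: weakly0 h0 => //; exact: ac_L1 a0.
Qed.

(** The boundary conditions on u alone kill all boundary terms, so the formula is available for v in
    the adjoint domain, before anything is known of v at 0 and 1. *)
Lemma green_half u2 u3 g v0 v1 v2 : ac u2 u3 -> ac u3 g -> ac v0 v1 -> ac v1 v2 ->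
  u2 0 = 0 -> u2 1 = 0 -> u3 0 = 0 -> u3 1 = 0 ->
  int01 (fun x => g x * v0 x) = int01 (fun x => u2 x * v2 x).
Proof.
move=> a2 a3 b0 b1 u20 u21 u30 u31.
have := ac_by_parts b0 a3; have := ac_by_parts b1 a2.
rewrite u20 u21 u30 u31 !mulr0 !subr0 !sub0r.
under eq_int01 do rewrite mulrC.
under [in X in _ -> X -> _]eq_int01 do rewrite mulrC.
by move=> -> ->; rewrite opprK; apply: eq_int01 => x _; rewrite mulrC.
Qed.

Lemma ac_horner (p : {poly R}) : ac (horner p) (horner p^`()).
Proof. by rewrite derivE; apply: ac_smooth; exact: smooth_horner. Qed.

End WeakDerivatives.

(** * Symmetry, density of the domain and self-adjointness of the operator *)

Section A2.
Context {R : realType}.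
Local Notation mu := (@lebesgue_measure R).

Let ae_filter : Filter (nbhs (almost_everywhere mu)).
Proof. exact: (@ae_filter_ringOfSetsType _ _ _ mu). Qed.
#[local] Existing Instance ae_filter.

Variables (a : R -> R) (x0 : R) (Ma : R).
Hypothesis a_gt0 : forall x, I01 x -> x != x0 -> 0 < a x.
Hypothesis a_x0 : a x0 = 0.
Hypothesis a_mf : mf a.
Hypothesis a_le : forall x, I01 x -> a x <= Ma.
Hypothesis a_inv : L1 (fun x => (a x)^-1).
Implicit Types u v w f h : L2w a.

Let hH := L2w_hilbert a_gt0 a_x0 a_mf a_le a_inv.

Lemma L2w_L1 u : L1 u.
Proof.
have [_ iu] := (sqw_in_L2w a_gt0 a_x0 a_mf a_le (L2w_sqw u)).1.
have L : L1 (fun x => 1 + u x ^+ 2 * 1) by apply: L1D => //; exact: L1_cst.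
apply: (L1_le (L2w_mf u) L) => x _; rewrite mulr1 -[u x ^+ 2]real_normK ?num_real//.
have := sqr_ge0 (`|u x| - 1); have := normr_ge0 (u x); nra.
Qed.

Lemma cont_sqw (f : R -> R) : {within `[0, 1], continuous f} -> sqw a f.
Proof.
move=> cf; have [M _ hM] := cont_bounded cf.
apply: (sqw_bounded a_gt0 a_x0 a_inv (cont_mf cf) (M := M)) => x Ix; apply: hM.
exact: subset_itv_oo_cc.
Qed.

Lemma aeq_divK (f : R -> R) : aeq f (fun x => a x * (f x / a x)).
Proof.
move: (ae_a_gt0 a_gt0); apply: filterS => x h Ix.
by rewrite mulrCA divff ?mulr1// gt_eqF ?h.
Qed.

Lemma aeq_mulK (f g : R -> R) : aeq f (fun x => a x * g x) -> aeq (fun x => f x / a x) g.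
Proof.
move: (ae_a_gt0 a_gt0); apply: filterS2 => x h fg Ix.
by rewrite fg// mulrAC divff ?mul1r// gt_eqF ?h.
Qed.

(** The working form of the graph: a chain of absolutely continuous representatives with pointwise
    boundary values. It exists because u'''' = f/a is integrable by [sqw_L1_div]. *)
Lemma A2P u f : A2 a u f <-> exists u0 u1 u2 u3 g : R -> R,
  [/\ aeq u u0, [/\ ac u0 u1, ac u1 u2, ac u2 u3 & ac u3 g],
      [/\ u2 0 = 0, u2 1 = 0, u3 0 = 0 & u3 1 = 0]
    & aeq f (fun x => a x * g x)].
Proof.
have Lu := L2w_L1 u.
have wk (u0 u1 u2 u3 g : R -> R) : aeq u u0 -> [/\ ac u0 u1, ac u1 u2, ac u2 u3 & ac u3 g] ->
    [/\ weakly 1 u u1, weakly 2 u u2, weakly 3 u u3 & weakly 4 u g].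
  move=> uu0 [a0 a1 a2 a3].
  have h1 : weakly 1 u u1.
    apply: weakly_aeq (ac_weakly a0); rewrite ?(ac_L1 a0) ?(ac_L1 a1)//; last exact: aeq_in.
    exact: aeq_sym.
  have h2 := weakly_trans h1 (ac_weakly a1); have h3 := weakly_trans h2 (ac_weakly a2).
  by split => //; exact: weakly_trans h3 (ac_weakly a3).
split=> [[[_ [b20 b21 b30 b31]] [g wg fg]]|[u0 [u1 [u2 [u3 [g [uu0 [a0 a1 a2 a3]
    [z20 z21 z30 z31] fg]]]]]]].
  have Lg : L1 g.
    apply: (L1_aeq (sqw_L1_div a_gt0 a_x0 a_inv (L2w_sqw f))).
      by case: wg => _ [].
    exact: aeq_mulK.
  have [u0 [u1 [u2 [u3 [uu0 ch]]]]] := weakly4_ac Lu Lg (weakly_of_weak_derivative wg).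
  have [h1 h2 h3 h4] := wk _ _ _ _ _ uu0 ch; have [a0 a1 a2 a3] := ch.
  exists u0, u1, u2, u3, g; split => //.
  (* The continuous representative in [has_boundary_value] is another weak derivative of the same
     order, hence equals [uk] on the closed interval. *)
  have bv k (uk : R -> R) x c : weakly k u uk -> {within `[0, 1], continuous uk} ->
      has_boundary_value k u x c -> 0 <= x <= 1 -> uk x = c.
    move=> hk cuk [gk [cgk wgk <-]] x01; apply: (cont_aeq cuk cgk) => //.
    apply: (weakly_unique (cont_L1 cuk) (cont_L1 cgk) hk).
    exact: weakly_of_weak_derivative.
  have [c2 c3] := (ac_cont a2, ac_cont a3).
  by split; [apply: bv h2 c2 b20 _|apply: bv h2 c2 b21 _|
    apply: bv h3 c3 b30 _|apply: bv h3 c3 b31 _]; rewrite !lexx ler01.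
have [h1 h2 h3 h4] := wk _ _ _ _ _ uu0 (And4 a0 a1 a2 a3).
have [L1_ L2] := (ac_L1 a1, ac_L1 a2); have [L3 L4] := (ac_L1 a3, a3.1).
have w4 : weak_derivative 4 u g by exact: weak_derivative_of_weakly.
have inL := sqw_in_L2w a_gt0 a_x0 a_mf a_le.
split; last by exists g.
split; last first.
  have bv k (uk : R -> R) x : L1 uk -> weakly k u uk -> {within `[0, 1], continuous uk} ->
    uk x = 0 -> has_boundary_value k u x 0.
    by move=> Lk hk ck ukx; exists uk; split => //; exact: weak_derivative_of_weakly.
  by split; [apply: bv z20|apply: bv z21|apply: bv z30|apply: bv z31] => //;
    [exact: ac_cont a2|exact: ac_cont a2|exact: ac_cont a3|exact: ac_cont a3].
split; first exact/inL/L2w_sqw.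
  split; first exact: (inL _ (L2w_sqw u)).1.
    exists u1; first exact: weak_derivative_of_weakly.
    exact: (inL _ (cont_sqw (ac_cont a1))).1.
  exists u2; first exact: weak_derivative_of_weakly.
  exact: (inL _ (cont_sqw (ac_cont a2))).1.
exists g => //; apply: inL; apply: (sqw_aeq a_inv (L2w_sqw f)) => //.
by apply: mfM => //; exact: L1_mf.
Qed.

(** The weight 1/a cancels the coefficient a, so the form is the unweighted one of u'' and v''. *)
Lemma A2_dot u f v (u0 u1 u2 u3 g v0 v1 v2 : R -> R) :
  aeq u u0 -> [/\ ac u0 u1, ac u1 u2, ac u2 u3 & ac u3 g] ->
  [/\ u2 0 = 0, u2 1 = 0, u3 0 = 0 & u3 1 = 0] -> aeq f (fun x => a x * g x) ->
  aeq v v0 -> ac v0 v1 -> ac v1 v2 ->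
  L2w_dot a f v = int01 (fun x => u2 x * v2 x).
Proof.
move=> uu0 [a0 a1 a2 a3] [z20 z21 z30 z31] fg vv0 b0 b1.
rewrite -(green_half a2 a3 b0 b1)//.
have Lg : L1 g by case: a3.
have sag : sqw a (fun x => a x * g x).
  by apply: (sqw_aeq a_inv (L2w_sqw f)) => //; apply: mfM => //; exact: L1_mf.
have sv0 := cont_sqw (ac_cont b0).
rewrite (L2w_dot_aeq sag sv0 fg vv0); apply: int01_aeq.
- exact: L1_mf (sqw_L1 sag sv0).
- by apply: L1_mf; apply: L1M_cont => //; exact: ac_cont b0.
move: (ae_a_gt0 a_gt0); apply: filterS => x h Ix.
by field; rewrite gt_eqF ?h.
Qed.

Lemma A2_symmetric u f v h : A2 a u f -> A2 a v h -> L2w_dot a f v = L2w_dot a u h.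
Proof.
move=> /A2P[u0 [u1 [u2 [u3 [g [uu0 cu zu fg]]]]]] /A2P[v0 [v1 [v2 [v3 [k [vv0 cv zv hk]]]]]].
have [a0 a1 _ _] := cu; have [b0 b1 _ _] := cv.
rewrite (A2_dot uu0 cu zu fg vv0 b0 b1) (dotC hH) (A2_dot vv0 cv zv hk uu0 a0 a1).
by apply: eq_int01 => x _; rewrite mulrC.
Qed.

Lemma A2_nonnegative : nonnegative_operator (L2w_dot a) (A2 a).
Proof.
move=> u f /A2P[u0 [u1 [u2 [u3 [g [uu0 cu zu fg]]]]]]; have [a0 a1 _ _] := cu.
rewrite (A2_dot uu0 cu zu fg uu0 a0 a1); apply: int01_ge0 => x _.
by rewrite -expr2 sqr_ge0.
Qed.

Lemma A2_unique u f h : A2 a u f -> A2 a u h -> f = h.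
Proof.
move=> [_ [g wg fg]] [_ [k wk hk]].
have L w (l : R -> R) : weak_derivative 4 u l -> aeq w (fun x => a x * l x) -> L1 l.
  move=> [_ [ml _ _] _] wl.
  exact: (L1_aeq (sqw_L1_div a_gt0 a_x0 a_inv (L2w_sqw w)) ml (aeq_mulK wl)).
have gk := weakly_unique (L _ _ wg fg) (L _ _ wk hk) (weakly_of_weak_derivative wg)
  (weakly_of_weak_derivative wk).
apply: eq_L2w; apply: aeq_trans fg _; apply: aeq_trans (aeq_sym hk).
by move: gk; apply: filterS => x e Ix; rewrite e.
Qed.

Lemma A2_linear : linear_operator (A2 a).
Proof.
split=> [||c u v f h]; first exact: A2_unique.
- have ac0 : ac (fun=> 0 : R) (fun=> 0).
    split=> [|x _]; first exact: L1_cst.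
    rewrite add0r -[LHS](int01_cst (0 : R)); apply: eq_int01 => t _; by rewrite mul0r.
  apply/A2P; exists (fun=> 0), (fun=> 0), (fun=> 0), (fun=> 0), (fun=> 0); split => //.
    exact: L2w0_aeq.
  apply: aeq_trans (L2w0_aeq a) _; apply: aeq_in => x _; by rewrite mulr0.
move=> /A2P[u0 [u1 [u2 [u3 [g [uu0 [a0 a1 a2 a3] [z20 z21 z30 z31] fg]]]]]].
move=> /A2P[v0 [v1 [v2 [v3 [k [vv0 [b0 b1 b2 b3] [y20 y21 y30 y31] hk]]]]]].
apply/A2P; exists (fun x => c * u0 x + v0 x), (fun x => c * u1 x + v1 x),
  (fun x => c * u2 x + v2 x), (fun x => c * u3 x + v3 x), (fun x => c * g x + k x).
split.
- apply: aeq_trans (L2w_lin_aeq c u v) _.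
  by move: uu0 vv0; apply: filterS2 => x e1 e2 Ix; rewrite e1// e2.
- by split; exact: ac_lin.
- by rewrite z20 z21 z30 z31 y20 y21 y30 y31 mulr0 addr0.
- apply: aeq_trans (L2w_lin_aeq c f h) _.
  by move: fg hk; apply: filterS2 => x e1 e2 Ix; rewrite e1// e2//; ring.
Qed.

(** Supplies both kinds of elements of the domain that are used: test functions and polynomials.
    Boundedness of a and of phi'''' puts their product in the weighted space. *)
Lemma A2_smooth (phi : R -> R) : smooth phi ->
  derive1n 2 phi 0 = 0 -> derive1n 2 phi 1 = 0 ->
  derive1n 3 phi 0 = 0 -> derive1n 3 phi 1 = 0 ->
  exists u f, [/\ A2 a u f, aeq u phi & aeq f (fun x => a x * derive1n 4 phi x)].
Proof.
move=> sphi z20 z21 z30 z31.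
have sk k : smooth (derive1n k phi).
  by elim: k => [//|k IH]; rewrite derive1nS; exact: smooth_derive1.
have su := cont_sqw (smooth_cont01 sphi).
have ca : mf (fun x => a x * derive1n 4 phi x).
  by apply: mfM => //; apply: cont_mf; apply: smooth_cont01; exact: (sk 4).
have [M _ hM] := cont_bounded (smooth_cont01 (sk 4)).
have sf : sqw a (fun x => a x * derive1n 4 phi x).
  apply: (sqw_bounded a_gt0 a_x0 a_inv ca (M := Ma * M)) => x Ix.
  rewrite normrM ler_pM// ?hM//; last exact: subset_itv_oo_cc.
  by rewrite ger0_norm ?a_le//; exact: (a_ge0 a_gt0 a_x0).
pose u := L2w_class a_gt0 a_x0 a_mf a_le su; pose f := L2w_class a_gt0 a_x0 a_mf a_le sf.
have uE : aeq u phi by exact: L2w_class_aeq.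
have fE : aeq f (fun x => a x * derive1n 4 phi x) by exact: L2w_class_aeq.
exists u, f; split => //; apply/A2P.
exists phi, (derive1n 1 phi), (derive1n 2 phi), (derive1n 3 phi), (derive1n 4 phi).
have d k : ac (derive1n k phi) (derive1n k.+1 phi).
  by rewrite derive1nS; apply: ac_smooth; exact: sk.
split; [exact: uE| |split|exact: fE]; last 4 first.
- exact: z20.
- exact: z21.
- exact: z30.
- exact: z31.
split; [exact: (d 0%N)|exact: (d 1%N)|exact: (d 2%N)|exact: (d 3%N)].
Qed.

Lemma A2_test (phi : R -> R) : test_function phi ->
  exists u f, [/\ A2 a u f, aeq u phi & aeq f (fun x => a x * derive1n 4 phi x)].
Proof.
move=> tphi; have z k x : ~ I01 x -> derive1n k phi x = 0.
  by move=> nx; apply: test_out => //; exact: test_derive1n.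
by apply: A2_smooth; [exact: test_smooth|..]; apply: z; rewrite /= in_itv/= ltxx ?andbF.
Qed.

(** Test functions belong to the domain, so the integrable function v/a annihilates them all and the
    fundamental lemma applies. *)
Lemma dom_A2_orthogonal v : (forall u, dom (A2 a) u -> L2w_dot a u v = 0) -> v = 0.
Proof.
move=> v0; have Lv := sqw_L1_div a_gt0 a_x0 a_inv (L2w_sqw v).
have va : aeq (fun x => v x / a x) (fun=> 0).
  apply: fundamental_lemma => // phi tphi.
  have [u [f [uf uphi _]]] := A2_test tphi.
  have := v0 u (ex_intro _ f uf).
  have sphi := cont_sqw (smooth_cont01 (test_smooth tphi)).
  rewrite (L2w_dot_aeq sphi (L2w_sqw v) uphi (aeq_in _))// => h.
  by rewrite -[RHS]h; apply: eq_int01 => x _; rewrite mulrC mulrA.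
apply: eq_L2w; apply: aeq_trans (aeq_sym (L2w0_aeq a)).
apply: aeq_trans (aeq_divK v) _; move: va; apply: filterS => x h Ix.
by rewrite h// mulr0.
Qed.

Lemma A2_dense : dense_subset (L2w_dot a) (dom (A2 a)).
Proof.
have [_ A00 Alin] := A2_linear.
apply: (dense_orthogonal hH) => [|v]; last exact: dom_A2_orthogonal.
split=> [|c u w [f uf] [h wh]]; first by exists 0.
by exists (c *: f + h); exact: Alin.
Qed.

(* Testing with C_c^\infty functions gives v'''' = w / a weakly; testing with
   polynomials of degree 0, 1, 6 and 7 of the domain then gives the boundary
   conditions. *)
Lemma A2_adjoint v w : adjoint (L2w_dot a) (A2 a) v w -> A2 a v w.
Proof.
move=> adj; pose k x := w x / a x.
have Lk : L1 k := sqw_L1_div a_gt0 a_x0 a_inv (L2w_sqw w).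
have dotE (phi : R -> R) u f (v0 : R -> R) : smooth phi -> A2 a u f -> aeq u phi ->
    aeq f (fun x => a x * derive1n 4 phi x) -> aeq v v0 -> L1 v0 ->
    int01 (fun x => v0 x * derive1n 4 phi x) = int01 (fun x => k x * phi x).
  move=> sphi uf uphi fphi vv0 Lv0.
  have c4 : {within `[0, 1], continuous (derive1n 4 phi)}.
    by apply: smooth_cont01; do 4 apply: smooth_derive1.
  have := adj u f uf.
  have sf : sqw a (fun x => a x * derive1n 4 phi x).
    apply: (sqw_aeq a_inv (L2w_sqw f)) => //.
    by apply: mfM => //; exact: cont_mf.
  have sphi' := cont_sqw (smooth_cont01 sphi).
  have sv0 : sqw a v0 by apply: (sqw_aeq a_inv (L2w_sqw v)) => //; exact: L1_mf.
  rewrite (L2w_dot_aeq sf sv0 fphi vv0) (L2w_dot_aeq sphi' (L2w_sqw w) uphi (aeq_in _))//.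
  move=> e; transitivity (int01 (fun x => phi x * w x / a x)); last first.
    by apply: eq_int01 => x _; rewrite /k; ring.
  rewrite -e; apply: int01_aeq.
  - by apply: L1_mf; exact: L1M_cont.
  - exact: L1_mf (sqw_L1 sf sv0).
  move: (ae_a_gt0 a_gt0); apply: filterS => x h Ix; have := h Ix => ax.
  by field; rewrite gt_eqF.
have h4 : weakly 4 v k.
  move=> phi tphi; have [u [f [uf uphi fphi]]] := A2_test tphi.
  rewrite (dotE _ u f) ?L2w_L1//; [|exact: test_smooth|exact: aeq_in].
  by rewrite -signr_odd expr0 mul1r.
have [v0 [v1 [v2 [v3 [vv0 [b0 b1 b2 b3]]]]]] := weakly4_ac (L2w_L1 v) Lk h4.
apply/A2P; exists v0, v1, v2, v3, k; split => //; last exact: aeq_divK.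
(* If p is in the domain, Green's formula for the pair (p, v) leaves only the boundary terms of v''
   p' - v''' p. *)
have bnd (p q r s : {poly R}) : p^`() = q -> q^`() = r -> r^`() = s ->
    r.[0] = 0 -> r.[1] = 0 -> s.[0] = 0 -> s.[1] = 0 ->
    v2 1 * q.[1] - v2 0 * q.[0] = v3 1 * p.[1] - v3 0 * p.[0].
  move=> dp dq dr z20 z21 z30 z31.
  have dE n : derive1n n (horner p) = horner p^`(n).
    by elim: n => [//|n IH]; rewrite derive1nS IH -derivE derivnS.
  have d2 : p^`(2) = r by rewrite derivnS derivn1 dp.
  have d3 : p^`(3) = s by rewrite derivnS d2.
  have d4 : p^`(4) = s^`() by rewrite derivnS d3.
  have [||||u [f [uf up fp]]] := A2_smooth (@smooth_horner R p); rewrite ?dE ?d2 ?d3//.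
  have := dotE _ u f v0 (@smooth_horner R p) uf up fp vv0 (ac_L1 b0).
  have := ac_horner s; have := ac_horner r; rewrite dr => ar as_.
  have e1 := green_half ar as_ b0 b1 z20 z21 z30 z31.
  rewrite dE d4 => e2.
  have := ac_horner q; rewrite dq => /(ac_by_parts b2).
  have := ac_horner p; rewrite dp => /(ac_by_parts b3).
  have -> : int01 (fun x => v2 x * r.[x]) = int01 (fun x => k x * p.[x]).
    rewrite -e2; transitivity (int01 (fun x => s^`().[x] * v0 x)).
      by rewrite e1; apply: eq_int01 => x _; rewrite mulrC.
    by apply: eq_int01 => x _; rewrite mulrC.
  by move=> -> /eqP; lra.
have z : (0 : {poly R})^`() = 0 := linear0 _.
(* The polynomials 1 and X are annihilated by [A2]; they give two of the four linear equations for
   the boundary values of v'' and v'''. *)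
have e1 : v3 1 = v3 0.
  have := @bnd 1%:P 0 0 0 (derivC _) z z.
  by rewrite !hornerC => /(_ erefl erefl erefl erefl); lra.
have e2 : v2 1 - v2 0 = v3 1.
  have := @bnd 'X 1%:P 0 0 (derivX _) (derivC _) z.
  by rewrite !hornerX !hornerC => /(_ erefl erefl erefl erefl); lra.
have dX (c : R) n : (c *: 'X^(n.+1) : {poly R})^`() = (c * n.+1%:R) *: 'X^n.
  by rewrite derivZ derivXn -scaler_nat scalerA.
(* Four consecutive powers: derivation preserves this shape, so the derivatives and their values at
   0 and 1 reduce to arithmetic on coefficients. *)
pose P m (b c d e : R) : {poly R} :=
  b *: 'X^m + c *: 'X^(m.+1) + d *: 'X^(m.+2) + e *: 'X^(m.+3).
have dP m b c d e : (P m.+1 b c d e)^`() =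
    P m (b * m.+1%:R) (c * m.+2%:R) (d * m.+3%:R) (e * m.+4%:R).
  by rewrite /P !derivD !dX.
have P0 m b c d e : (P m.+1 b c d e).[0] = 0.
  by rewrite /P !hornerD !hornerZ !hornerXn !expr0n /= !mulr0 !addr0.
have P1 m b c d e : (P m b c d e).[1] = b + c + d + e.
  by rewrite /P !hornerD !hornerZ !hornerXn !expr1n !mulr1.
(* The second derivatives are multiples of X^2 (1 - X)^2 and of
   X^2 (1 - X)^2 (X - 1/2). *)
have e3 := @bnd (P 4%N 5 (-6) 2 0) _ _ _ (dP _ _ _ _ _) (dP _ _ _ _ _) (dP _ _ _ _ _).
have e4 := @bnd (P 4%N (-35) 84 (-70) 20) _ _ _ (dP _ _ _ _ _) (dP _ _ _ _ _) (dP _ _ _ _ _).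
rewrite !P0 !P1 in e3 e4.
(* Both polynomials vanish with their derivative at 0; at 1 the values are 1 and -1, and those of
   the derivatives 2 and 0. So the second gives v'''(1) = 0 and the first then v''(1) = 0. *)
have {}e3 : v2 1 * 2 = v3 1.
  by move: (e3 erefl) => /(_ ltac:(lra) erefl ltac:(lra)); lra.
have {}e4 : v3 1 = 0 by move: (e4 erefl) => /(_ ltac:(lra) erefl ltac:(lra)); lra.
by split; lra.
Qed.


Lemma A2_self_adjoint : self_adjoint (L2w_dot a) (A2 a).
Proof.
by move=> v w; split=> [vw u f uf|]; [exact: A2_symmetric|exact: A2_adjoint].
Qed.

End A2.

Theorem theorem3p1 (R : realType) (a : R -> R) (x0 : R) :
  weakly_degenerate a x0 ->
  [/\ linear_operator (A2 a),
      dense_subset (L2w_dot a) (dom (A2 a)),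
      self_adjoint (L2w_dot a) (A2 a)
    & nonnegative_operator (L2w_dot a) (A2 a)] /\
  generates_contractive_analytic_semigroup
    (complexification_norm (L2w_dot a)) (pi / 2)
    (complexify_operator (opp_operator (A2 a))).
Proof.
move=> [_ [a_x0 a_pos] a_cont _ a_inv].
have a_gt0 x : I01 x -> x != x0 -> 0 < a x.
  by move=> Ix /eqP xx0; apply: a_pos; split => //; exact: subset_itv_oo_cc.
have a_mf := cont_mf a_cont; have [M _ a_bound] := cont_bounded a_cont.
have a_le x : I01 x -> a x <= M.
  by move=> Ix; apply: le_trans (ler_norm _) (a_bound _ _); exact: subset_itv_oo_cc.
have lin := A2_linear a_gt0 a_x0 a_mf a_le a_inv.
have dense := A2_dense a_gt0 a_x0 a_mf a_le a_inv.
have sa := A2_self_adjoint a_gt0 a_x0 a_mf a_le a_inv.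
have nonneg := A2_nonnegative a_gt0 a_x0 a_mf a_le a_inv.
split=> //; apply: self_adjoint_generates => //.
exact: L2w_hilbert a_gt0 a_x0 a_mf a_le a_inv.
Qed.
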